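(* Consider $N$ particles with dynamics $\dot r_k=x_k$, $\dot R_k=R_k\hat u_k$, $R_k=[x_k,y_k,z_k]\in SO(3)$, $r_k\in\mathbb{R}^3$, and the dynamic control law with consensus variables $b_k\in\mathbb{R}^3$ (arbitrary initial conditions), $$u_k=e_1\times b_k,\qquad \dot b_k=\hat u_k^Tb_k-\sum_{j=1}^NL_{kj}(t)R_k^TR_jb_j,\qquad k=1,\dots,N,$$ where $L(t)$ is the Laplacian of the communication graph $G(t)$. The closed-loop vector field is invariant under an action of the group $SE(3)$ on the state variables $(r_k,R_k)$ and an action of the group $\mathbb{R}^3$ on the consensus variables $b_k^a=R_kb_k$. Suppose that the communication graph $G(t)$ is uniformly connected and that $L(t)$ is bounded and piecewise continuous. Then every solution exists for all $t\ge0$ and asymptotically converges to $\Sigma(0)\times C_b$. Furthermore, the set $E(0)\times C_b$ is asymptotically stable in the (extended) shape space and every other positive limit set is unstable.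
   Context: Model: $r_k\in\mathbb{R}^3$ is the position of particle $k$, $x_k=R_ke_1$ its unit velocity, $u_k\in\mathbb{R}^3$ its control, $e_1=(1,0,0)^T$, and $\hat u$ the skew-symmetric matrix with $\hat uv=u\times v$. With $g_k=\begin{bmatrix}R_k&r_k\\0&1\end{bmatrix}\in SE(3)$, $\xi_k=\mathrm{col}(e_1,u_k)$ and $\hat\xi_k=\begin{bmatrix}\hat u_k&e_1\\0&0\end{bmatrix}$, the dynamics are $\dot g_k=g_k\hat\xi_k$. $\Sigma(0)$ is the set of solutions with $g_k(t)=g_k(0)e^{\hat\xi_kt}$, $\xi_k=\mathrm{col}(e_1,0)$, $g_k(0)\in SE(3)$, $k=1,\dots,N$ (every particle moves in a straight line); $E(0)$ is its subset corresponding to relative equilibria, i.e. $x_k=x_j$ for all $k,j$ (parallel motions). $C_b$ is the set of consensus states $b_k^a=b_j^a$ for all $k,j$. When used as sets to which closed-loop solutions converge or whose stability is asserted, these are understood as the sets of closed-loop solutions of this form. $SE(3)$ acts on the particle states by simultaneous rigid motions $g_k\mapsto hg_k$. The shape space is the quotient by this action, described by $g_{kj}=g_k^{-1}g_j$, i.e. $R_k^TR_j$ and $R_k^T(r_j-r_k)$; the extended shape space is the shape space augmented with the (body-frame) consensus variables $b_k$, and stability assertions refer to the dynamics induced there. Graphs: $G(t)=(\mathcal V,\mathcal E(t),A(t))$ is a weighted digraph on $\mathcal V=\{v_1,\dots,v_N\}$ with weighted adjacency matrix $A(t)=(a_{kj}(t))$ piecewise continuous and bounded, $a_{kk}=0$,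 $a_{kj}(t)\in\{0\}\cup[\eta,\gamma]$ for fixed finite scalars $0<\eta\le\gamma$ and all $t\ge0$. Agent $k$ receives information from agent $j$ at time $t$ iff $a_{kj}(t)\ge\eta$, and this corresponds to an edge directed from $v_k$ to $v_j$. The Laplacian is $L_{kk}=\sum_ia_{ki}$, $L_{kj}=-a_{kj}$ for $j\neq k$. Node $v_k$ is connected to node $v_j\ne v_k$ in $I=[t_a,t_b]$ if there is a path from $v_k$ to $v_j$ respecting edge orientation in the digraph $(\mathcal V,\bigcup_{t\in I}\mathcal E(t),\int_IA(\tau)\,d\tau)$. $G(t)$ is uniformly connected if there exist $T>0$ and an index $k$ such that for all $t$ all nodes $v_j$, $j\ne k$, are connected to $v_k$ across $[t,t+T]$.
   Formalization: E(0)×C_b is asserted asymptotically stable only where the common b_k^a is a positive multiple of the velocity; uniform connectedness requires integrated edge weights at least some δ>0 in every window; R^3 invariance is stated only for the vector field of the consensus variables b_k^a. *)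

(* Defs.v *)
From HB Require Import structures.
From mathcomp Require Import all_boot all_order all_algebra.
From mathcomp Require Import all_classical all_reals all_analysis.
Import Order.TTheory GRing.Theory Num.Theory.
Import numFieldNormedType.Exports.

Set Implicit Arguments.
Unset Strict Implicit.
Unset Printing Implicit Defensive.

Local Open Scope classical_set_scope.
Local Open Scope ring_scope.

Section RigidMotions.
Variable R : realType.
Implicit Types (u v r : 'cV[R]_3) (Q : 'M[R]_3).

Definition e1 : 'cV[R]_3 := delta_mx 0 0.

Definition hat u : 'M[R]_3 :=
  let c k := u (inord k) 0 in
  \matrix_(i < 3, j < 3)
    nth 0 (nth [::] [:: [:: 0; - c 2%N; c 1%N];
                        [:: c 2%N; 0; - c 0%N];
                        [:: - c 1%N; c 0%N; 0]] i) j.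

Definition cross u v : 'cV[R]_3 := hat u *m v.

Definition dot u v : R := (u^T *m v) 0 0.

Definition SO3 : set 'M[R]_3 := [set Q | Q^T *m Q = 1%:M /\ \det Q = 1].

Definition pose Q r : 'M[R]_(3 + 1) := block_mx Q r 0 1%:M.

(* The matrix of the twist col(e1, u). *)
Definition twist u : 'M[R]_(3 + 1) := block_mx (hat u) e1 0 0.

Definition expmx (X : 'M[R]_(3 + 1)) : 'M[R]_(3 + 1) :=
  lim (series (fun n : nat => (n`!%:R)^-1 *: X ^+ n) @ \oo).

End RigidMotions.

Section Graphs.
Variables (R : realType) (N : nat).
Implicit Types (A : R -> 'M[R]_N) (f : R -> R).

(* On [0, +oo): locally finitely many discontinuities, with finite one-sided
   limits everywhere. *)
Definition piecewise_continuous f : Prop :=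
  [/\ forall b, exists D : seq R, forall t,
        0 < t < b -> t \notin D -> {for t, continuous f},
      forall t, 0 < t -> cvg (f x @[x --> t^'-])
    & forall t, 0 <= t -> cvg (f x @[x --> t^'+])].

Definition bounded_forward f : Prop :=
  exists M, forall t, 0 <= t -> `|f t| <= M.

Definition communication_graph (eta gamma : R) A : Prop :=
  [/\ 0 < eta <= gamma,
      forall k j, piecewise_continuous (fun t => A t k j),
      forall k j, bounded_forward (fun t => A t k j),
      forall t k, 0 <= t -> A t k k = 0
    & forall t k j, 0 <= t -> A t k j = 0 \/ eta <= A t k j <= gamma].

Definition laplacian (W : 'M[R]_N) : 'M[R]_N :=
  \matrix_(k, j) (if j == k then \sum_i W k i else - W k j).

(* The edges of the digraph (V, \bigcup_(t in [a, b]) E(t), \int_a^b A).  An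
   edge is counted only if its integrated weight is at least delta: without a
   lower bound independent of the window, links active for ever shorter times
   would count although they do not enforce consensus. *)
Definition window_edge (eta delta : R) A (a b : R) : rel 'I_N :=
  fun k j =>
    `[< exists2 t, a <= t <= b & eta <= A t k j >] &&
    (delta <= \int[lebesgue_measure]_(t in `[a, b]) A t k j).

Definition uniformly_connected (eta : R) A : Prop :=
  exists T delta : R, exists k : 'I_N,
    [/\ 0 < T, 0 < delta
      & forall t, 0 <= t -> forall j, j != k ->
          connect (window_edge eta delta A t (t + T)) j k].

End Graphs.

Section ClosedLoop.
Variables (R : realType) (N : nat).

(* [att] is the rotation R_k and [cons] the body-frame consensus variable b_k.
   The record also serves for tangent vectors (r', R', b'). *)
Record state := State {
  pos : 'I_N -> 'cV[R]_3;
  att : 'I_N -> 'M[R]_3;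
  cons : 'I_N -> 'cV[R]_3 }.

Implicit Types (p q : state) (s : R -> state) (A : R -> 'M[R]_N).
Implicit Types (M U V : set state) (t e : R) (k j : 'I_N).

Definition vel p k : 'cV[R]_3 := att p k *m e1 R.
Definition cons_abs p k : 'cV[R]_3 := att p k *m cons p k.
Definition control p k : 'cV[R]_3 := cross (e1 R) (cons p k).

Definition rotations p : Prop := forall k, SO3 (att p k).

Definition field A t p : state := State
  (vel p)
  (fun k => att p k *m hat (control p k))
  (fun k => (hat (control p k))^T *m cons p k -
            \sum_j laplacian (A t) k j *: ((att p k)^T *m att p j *m cons p j)).

(* g_k |-> h g_k with h = (Q, c); its differential is [rigid_act Q 0]. *)
Definition rigid_act (Q : 'M[R]_3) (c : 'cV[R]_3) p : state :=
  State (fun k => Q *m pos p k + c) (fun k => Q *m att p k) (cons p).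

(* b_k^a |-> b_k^a + c at fixed (r_k, R_k). *)
Definition shift_act (c : 'cV[R]_3) p : state :=
  State (pos p) (att p) (fun k => cons p k + (att p k)^T *m c).

(* The derivative of R_k b_k along the closed-loop vector field. *)
Definition cons_abs_field A t p k : 'cV[R]_3 :=
  att (field A t p) k *m cons p k + att p k *m cons (field A t p) k.

(* Solutions on [t0, tau): continuous, and satisfying the differential equation
   at the times where the graph does not switch. *)
Definition solution A t0 (tau : \bar R) s : Prop :=
  let I := [set t | t0 <= t /\ (t%:E < tau)%E] in
  [/\ forall t, I t -> rotations (s t),
      forall k, [/\ {within I, continuous (fun t => pos (s t) k)},
                    {within I, continuous (fun t => att (s t) k)}
                  & {within I, continuous (fun t => cons (s t) k)}]
    & forall t, I t -> t0 < t ->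
        (forall i j, {for t, continuous (fun x => A x i j)}) ->
        forall k,
        [/\ is_derive t 1 (fun x => pos (s x) k) (pos (field A t (s t)) k),
            is_derive t 1 (fun x => att (s x) k) (att (field A t (s t)) k)
          & is_derive t 1 (fun x => cons (s x) k) (cons (field A t (s t)) k)]].

Definition straight t0 s : Prop := forall k t, t0 <= t ->
  pose (att (s t) k) (pos (s t) k) =
  pose (att (s t0) k) (pos (s t0) k) *m expmx ((t - t0) *: twist 0).

Definition parallel t0 s : Prop := forall k j t, t0 <= t ->
  vel (s t) k = vel (s t) j.

Definition consensus t0 s : Prop := forall k j t, t0 <= t ->
  cons_abs (s t) k = cons_abs (s t) j.

(* The states lying on the closed-loop solutions of the given form. *)
Definition Sigma0_Cb A t0 : set state :=
  [set p | exists s t, [/\ solution A t0 +oo s, straight t0 s, consensus t0 s,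
                           t0 <= t & s t = p]].

Definition E0_Cb A t0 : set state :=
  [set p | exists s t, [/\ solution A t0 +oo s, straight t0 s /\ parallel t0 s,
                           consensus t0 s, t0 <= t & s t = p]].

(* On [E0_Cb] the common consensus vector is beta x_k for some real beta, x_k
   being the common velocity; this selects beta > 0.  The solutions with
   beta < 0, and with beta = 0 if N > 1, belong to [E0_Cb] but are unstable:
   x_k' is the component of b_k^a orthogonal to x_k. *)
Definition heading : set state :=
  [set p | forall k, 0 < dot (vel p k) (cons_abs p k)].

Definition state_close e p q : Prop := forall k,
  [/\ `|pos p k - pos q k| < e, `|att p k - att q k| < e
    & `|cons p k - cons q k| < e].

Definition rel_att p k j : 'M[R]_3 := (att p k)^T *m att p j.
Definition rel_pos p k j : 'cV[R]_3 := (att p k)^T *m (pos p j - pos p k).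

(* The balls of the position-free part (R_k^T R_j, b_k) of the extended shape
   space, in which the closed loop is self-contained since its vector field does
   not involve the r_k. *)
Definition attitude_close e p q : Prop :=
  (forall k j, `|rel_att p k j - rel_att q k j| < e) /\
  (forall k, `|cons p k - cons q k| < e).

(* The balls of the extended shape space, pulled back to states. *)
Definition shape_close e p q : Prop :=
  attitude_close e p q /\
  (forall k j, `|rel_pos p k j - rel_pos q k j| < e).

Section Stability.
Variable close : R -> state -> state -> Prop.

(* For the relations above other than [state_close], the open sets are the
   preimages of open sets of shapes. *)
Definition open_for U : Prop :=
  forall p, U p -> exists2 e, 0 < e & forall q, close e p q -> U q.

Definition neighborhood M U : Prop := open_for U /\ M `<=` U.

Definition converges_to s M : Prop := forall e, 0 < e ->
  exists T, forall t, T <= t -> exists2 p, M p & close e (s t) p.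

(* Stability in terms of neighborhoods, since the sets need not be compact. *)
Definition stable A t0 M : Prop :=
  forall U, neighborhood M U -> exists2 V, neighborhood M V &
    forall s, solution A t0 +oo s -> V (s t0) ->
    forall t, t0 <= t -> U (s t).

Definition attractive A t0 M : Prop :=
  exists2 V, neighborhood M V &
    forall s, solution A t0 +oo s -> V (s t0) -> converges_to s M.

Definition asymptotically_stable A t0 M : Prop :=
  stable A t0 M /\ attractive A t0 M.

Definition unstable A t0 M : Prop := ~ stable A t0 M.

End Stability.

(* The positive limit set of a solution with respect to (R_k^T R_j, b_k), as a
   set of states with free positions.  Relative positions are left out because
   they diverge along every solution whose velocities do not become parallel;
   its limit set in the full shape space would be empty. *)
Definition limit_set s : set state :=
  [set p | rotations p /\
     forall e T, 0 < e -> exists2 t, T <= t & attitude_close e (s t) p].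

End ClosedLoop.

(* Main.v *)
Require Import Defs.
From HB Require Import structures.
From mathcomp Require Import all_boot all_order all_algebra.
From mathcomp Require Import all_classical all_reals all_analysis.
From mathcomp Require Import measurable_realfun.
From mathcomp Require Import ring lra.
Import Order.TTheory GRing.Theory Num.Theory.
Import numFieldNormedType.Exports.

(* The absolute consensus variables w_k = R_k b_k solve the linear consensus
   equation w_k' = sum_j a_kj (w_j - w_k).  Over a window of uniform length the
   spread of the w_k is contracted by a fixed factor, so they converge exponentially
   to a common w.  In body coordinates b_k = (a, b', b''), and the equation for R_k
   reads x_k' = w_k - a x_k with a = x_k . w_k, so a' = |w_k|^2 - a^2 up to an
   exponentially small error.  This Riccati equation forces a to converge to |w| or
   to -|w|, whence b_k tends to a multiple of e_1, the controls vanish, and rotating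
   the frames slightly gives nearby straight motions.

   Near a parallel motion with beta > 0 the value -|w| is excluded, which gives the
   stability.  For the other limit sets, the common consensus variable of a limit
   point is perturbed (and, when w = 0, one of its frames): for a constant w the
   equation a' = |w|^2 - a^2 drives every x_k not exactly along -w to w/|w|,
   which makes x_k . x_j or a leave its value on the limit set.

   Solutions are obtained from three linear equations solved in turn: for the w_k,
   for a projective lift of x_k, and for R_k. *)

Set Implicit Arguments.
Unset Strict Implicit.
Unset Printing Implicit Defensive.

Local Open Scope classical_set_scope.
Local Open Scope ring_scope.

(** The vector field depends on time through discontinuous weights, so invariance arguments of
    LaSalle type are not at hand; every limit is obtained from an explicit exponential error, whose
    integral is finite. A triangular structure makes this possible: the [w_k] evolve without
    reference to the frames, [x_k] is driven by [w_k] alone, and the rest of the frame by [x_k] and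
    [w_k]. The second lever is a sign. In [a' = |w_k|^2 - a^2 + error] the difference
    [|w_k|^2 - a^2] is a sum of two squares, so [a] can decrease only by the integral of the error.
    This gives the limit of [a], excludes [-|w|] near a parallel motion for all times at once, and
    tells which perturbations leave an unstable limit set. The projective lift linearizes the
    Riccati equation: the sphere of velocities is the set of rays of a light cone in four
    dimensions, on which [w] acts as an infinitesimal Lorentz boost. The constants of the stability
    estimate depend on the parallel motion (on [beta] and the relative positions), so neighborhoods
    are built point by point, with bounds linear in the initial deviation. *)

Notation o0 := (inord 0 : 'I_3).
Notation o1 := (inord 1 : 'I_3).
Notation o2 := (inord 2 : 'I_3).

(** * Differential inequalities for functions differentiable off a finite set *)

Section PiecewiseDerivative.
Variable R : realType.
Implicit Types (a b c t x l e B C K L M : R) (f g df dg y dy : R -> R).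

(** The regularity of a solution across the switching times of the graph: [df] is unconstrained on
    the finite list [D], and continuity on the closed interval lets increments be computed across
    it. *)
Definition pw_derive a b f df : Prop :=
  {within `[a, b], continuous f} /\
  exists D : seq R, forall t, a < t < b -> t \notin D -> is_derive t 1 f (df t).

Lemma eq_ler x (y : R) : x = y -> x <= y.
Proof. by move=> ->. Qed.

Lemma pw_derive_sub a b a' b' f df :
  a <= a' -> b' <= b -> pw_derive a b f df -> pw_derive a' b' f df.
Proof.
move=> aa bb [cf [D hD]]; split.
  by apply: continuous_subspaceW cf; apply: subset_itv; rewrite bnd_simp.
exists D => t /andP[h1 h2]; apply: hD; rewrite (le_lt_trans aa)//=.
exact: lt_le_trans bb.
Qed.

Lemma pw_derive_ext a b f df df' :
  (forall t, a < t < b -> df t = df' t) -> pw_derive a b f df ->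
  pw_derive a b f df'.
Proof.
by move=> e [cf [D hD]]; split=> //; exists D => t tab tD; rewrite -e//; exact: hD.
Qed.

Lemma pw_derive_eqf a b f f' df :
  (forall t, a <= t <= b -> f t = f' t) -> pw_derive a b f df ->
  pw_derive a b f' df.
Proof.
move=> e [cf [D hD]]; split.
  apply: subspace_eq_continuous cf => t; rewrite inE/= in_itv/= => tab.
  exact: e.
exists D => t tab tD; have := hD t tab tD.
apply: near_eq_is_derive.
near=> s; rewrite -e//.
suff : s \in `]a, b[ by rewrite in_itv/= => /andP[/ltW -> /ltW ->].
by near: s; apply: near_in_itvoo; rewrite in_itv.
Unshelve. all: by end_near. Qed.

Lemma pw_derive_all a b f df :
  (forall t, is_derive t 1 f (df t)) -> pw_derive a b f df.
Proof.
move=> h; split; last by exists [::].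
by apply: continuous_subspaceT => t; apply/differentiable_continuous/derivable1_diffP.
Qed.

Lemma pw_derive_cst a b c : pw_derive a b (fun=> c) (fun=> 0).
Proof. by apply: pw_derive_all => t; exact: is_derive_cst. Qed.

Lemma pw_derive_id a b : pw_derive a b id (fun=> 1).
Proof. by apply: pw_derive_all => t; exact: is_derive_id. Qed.

Lemma pw_deriveD a b f g df dg :
  pw_derive a b f df -> pw_derive a b g dg ->
  pw_derive a b (fun t => f t + g t) (fun t => df t + dg t).
Proof.
move=> [cf [D hD]] [cg [E hE]]; split.
  by move=> x; apply: continuousD; [exact: cf|exact: cg].
exists (D ++ E) => t tab; rewrite mem_cat negb_or => /andP[tD tE].
by apply: is_deriveD; [exact: hD|exact: hE].
Qed.

Lemma pw_deriveM a b f g df dg :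
  pw_derive a b f df -> pw_derive a b g dg ->
  pw_derive a b (fun t => f t * g t) (fun t => df t * g t + f t * dg t).
Proof.
move=> [cf [D hD]] [cg [E hE]]; split.
  by move=> x; apply: continuousM; [exact: cf|exact: cg].
exists (D ++ E) => t tab; rewrite mem_cat negb_or => /andP[tD tE].
have := is_deriveM (hD _ tab tD) (hE _ tab tE).
by rewrite /GRing.scale/= addrC (mulrC (g t)).
Qed.

Lemma pw_deriveZ a b c f df :
  pw_derive a b f df -> pw_derive a b (fun t => c * f t) (fun t => c * df t).
Proof.
move=> h; apply: pw_derive_ext (pw_deriveM (pw_derive_cst a b c) h) => t _.
by rewrite mul0r add0r.
Qed.

Lemma pw_deriveN a b f df :
  pw_derive a b f df -> pw_derive a b (fun t => - f t) (fun t => - df t).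
Proof.
move=> h; apply: pw_derive_ext (pw_derive_eqf _ (pw_deriveZ (-1) h)) => t _;
by rewrite mulN1r.
Qed.

Lemma pw_deriveB a b f g df dg :
  pw_derive a b f df -> pw_derive a b g dg ->
  pw_derive a b (fun t => f t - g t) (fun t => df t - dg t).
Proof. by move=> hf hg; exact: pw_deriveD hf (pw_deriveN hg). Qed.

Lemma pw_derive_sum (I : Type) (r : seq I) (P : pred I) a b (f df : I -> R -> R) :
  (forall i, P i -> pw_derive a b (f i) (df i)) ->
  pw_derive a b (fun t => \sum_(i <- r | P i) f i t)
                (fun t => \sum_(i <- r | P i) df i t).
Proof.
move=> h; elim: r => [|i r IH].
  apply: pw_derive_ext (pw_derive_eqf _ (pw_derive_cst a b 0)) => t _;
  by rewrite big_nil.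
have [Pi|Pi] := boolP (P i).
  apply: pw_derive_ext (pw_derive_eqf _ (pw_deriveD (h i Pi) IH)) => t _;
  by rewrite big_cons Pi.
by apply: pw_derive_ext (pw_derive_eqf _ IH) => t _; rewrite big_cons (negbTE Pi).
Qed.

Lemma pw_derive_exp a b c t0 :
  pw_derive a b (fun t => expR (c * (t - t0))) (fun t => c * expR (c * (t - t0))).
Proof.
apply: pw_derive_all => t.
have h : is_derive t 1 (fun t => c * (t - t0)) c.
  have := is_deriveM (is_derive_cst c t 1)
    (is_deriveB (is_derive_id t 1) (is_derive_cst t0 t 1)).
  by rewrite /GRing.scale/= mulr0 addr0 subr0 mulr1.
have -> : (fun t => expR (c * (t - t0))) = expR \o (fun t => c * (t - t0)) by [].
have := is_derive1_comp (is_derive_expR _) h.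
by rewrite mulrC.
Qed.

Lemma pw_deriveV a b f df :
  (forall t, a <= t <= b -> f t != 0) ->
  pw_derive a b f df -> pw_derive a b (fun t => (f t)^-1)
    (fun t => - (f t) ^- 2 * df t).
Proof.
move=> f0 [cf [D hD]]; split.
  apply/subspace_continuousP => x; rewrite /= in_itv/= => xab.
  apply: cvgV; first exact: f0.
  by move/subspace_continuousP : cf; apply; rewrite /= in_itv.
exists D => t tab tD.
have ft : f t != 0 by apply: f0; case/andP: tab => /ltW -> /ltW ->.
have fD := hD t tab tD.
by apply: DeriveDef; [exact: derivableV|rewrite deriveV// derive_val].
Qed.

(** Induction on the exceptional list: the interval is cut at the head [d] when [d] lies in it, and
    the mean value theorem applies once the list is empty. All comparison results below reduce to
    this one. *)
Lemma pw_derive_ndecr a b f df :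
  a <= b -> pw_derive a b f df -> (forall t, a < t < b -> 0 <= df t) ->
  f a <= f b.
Proof.
move=> + [cf [D hD]]; elim: D a b cf hD => [|d D IH] a b cf hD ab df0.
  have [//|c cab e] := @MVT_segment _ f df a b ab _ cf.
    by move=> x; rewrite in_itv/= => xab; exact: hD.
  case: (ltgtP a b) ab e => // [ab|->] _ e; last by [].
  have [c' c'ab {}e] := @MVT _ f df a b ab (fun x xab => hD x xab isT) cf.
  by rewrite -subr_ge0 e mulr_ge0// ?df0// subr_ge0 ltW.
have [/andP[ad db]|dab] := boolP (a <= d <= b).
  apply: (@le_trans _ _ (f d)).
    apply: IH => // [|t /andP[at_ td] tD|t /andP[at_ td]].
    - by apply: continuous_subspaceW cf; apply: subset_itv; rewrite bnd_simp.
    - apply: hD; first by rewrite at_/= (lt_le_trans td).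
      by rewrite inE negb_or tD andbT lt_eqF.
    - by rewrite df0// at_/= (lt_le_trans td).
  apply: IH => // [|t /andP[at_ td] tD|t /andP[at_ td]].
  - by apply: continuous_subspaceW cf; apply: subset_itv; rewrite bnd_simp.
  - apply: hD; first by rewrite td andbT (le_lt_trans ad).
    by rewrite inE negb_or tD andbT gt_eqF.
  - by rewrite df0// td andbT (le_lt_trans ad).
apply: IH => // t tab tD; apply: hD => //; rewrite inE negb_or tD andbT.
apply: contraNneq dab => <-.
by case/andP: tab => /ltW -> /ltW ->.
Qed.

Lemma pw_derive_le a b f df g dg :
  a <= b -> pw_derive a b f df -> pw_derive a b g dg ->
  (forall t, a < t < b -> df t <= dg t) -> f b - f a <= g b - g a.
Proof.
move=> ab hf hg h.
have h' : g a - f a <= g b - f b.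
  by apply: (pw_derive_ndecr ab (pw_deriveB hg hf)) => t tab; rewrite subr_ge0 h.
by lra.
Qed.

Lemma pw_derive_norm_le a b f df g dg :
  a <= b -> pw_derive a b f df -> pw_derive a b g dg ->
  (forall t, a < t < b -> `|df t| <= dg t) -> `|f b - f a| <= g b - g a.
Proof.
move=> ab hf hg h; rewrite ler_norml; apply/andP; split.
  rewrite lerNl opprB.
  have := pw_derive_le ab (pw_deriveN hf) hg.
  rewrite -opprD opprB => -> // t tab.
  by rewrite (le_trans _ (h t tab))// -normrN ler_norm.
by apply: (pw_derive_le ab hf hg) => t tab; rewrite (le_trans _ (h t tab))// ler_norm.
Qed.

Lemma pw_derive0 a b f df :
  a <= b -> pw_derive a b f df -> (forall t, a < t < b -> df t = 0) -> f b = f a.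
Proof.
move=> ab hf h; apply/eqP; rewrite -subr_eq0 -normr_le0.
have := @pw_derive_norm_le a b f df (fun=> 0) (fun=> 0) ab hf (pw_derive_cst _ _ _).
by rewrite subr0; apply => t /h ->; rewrite normr0.
Qed.

(** To be read with [P i M] saying that [M] bounds the quantity of index [i]. The sum of the
    absolute values of chosen bounds serves as the common one. *)
Lemma fin_bound (I : finType) (P : I -> R -> Prop) :
  (forall i M M', P i M -> M <= M' -> P i M') -> (forall i, exists M, P i M) ->
  exists2 M, 0 <= M & forall i, P i M.
Proof.
move=> mono /choice[F hF]; exists (\sum_i `|F i|).
  by apply: sumr_ge0 => i _.
move=> i; apply: mono (hF i) _; rewrite (bigD1 i)//=.
by rewrite (le_trans (ler_norm _))// lerDl sumr_ge0.
Qed.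

Lemma within_bounded a b f : {within `[a, b], continuous f} ->
  exists M, forall t, a <= t <= b -> `|f t| <= M.
Proof.
move=> cf; have [ab|ba] := leP a b; last first.
  by exists 0 => t /andP[h1 h2]; have := lt_le_trans ba (le_trans h1 h2); rewrite ltxx.
have [c _ hc] := EVT_min ab cf; have [d _ hd] := EVT_max ab cf.
exists (`|f c| + `|f d|) => t tab.
have {}hc := hc t; have {}hd := hd t; rewrite !in_itv/= in hc hd.
move/(_ tab) : hc; move/(_ tab) : hd => h1 h2.
rewrite ler_norml; apply/andP; split.
  have := ler_norm (- f c); rewrite normrN => h3.
  by have := normr_ge0 (f d); lra.
by have := ler_norm (f d); have := normr_ge0 (f c); lra.
Qed.

Lemma half_pow_lt C e : 0 < e -> exists n : nat, C / 2 ^+ n < e.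
Proof.
move=> e0; have [C0|C0] := leP C 0.
  by exists 0%N; rewrite expr0 divr1 (le_lt_trans C0).
have := archi_boundP (ltW (divr_gt0 C0 e0)); set n := Num.bound _ => hn.
exists n; rewrite ltr_pdivrMr ?exprn_gt0// mulrC -ltr_pdivrMr//.
rewrite (lt_trans hn)// -natrX ltr_nat; exact: ltn_expl.
Qed.

Lemma le_half_pow0 C x : (forall n : nat, x <= C / 2 ^+ n) -> x <= 0.
Proof.
move=> h; rewrite leNgt; apply/negP => /half_pow_lt-/(_ C)[n].
by rewrite ltNge h.
Qed.

(* The lower bounds [- S] of a cooperative system improve by the factor 1/2 at
   each pass when they are weighted by [expR (2 K (t - a))]. *)
Lemma cooperative_ge0 (I : finType) a b K (v dv : I -> R -> R) :
  a <= b -> 0 <= K -> (forall i, pw_derive a b (v i) (dv i)) ->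
  (forall i, 0 <= v i a) ->
  (forall t S, a < t < b -> 0 <= S -> (forall j, - S <= v j t) ->
     forall i, - (K * S) <= dv i t) ->
  forall i, 0 <= v i b.
Proof.
move=> ab K0 hv va0 hdv.
have [B B0 hB] : exists2 B, 0 <= B & forall i t, a <= t <= b -> `|v i t| <= B.
  apply: (@fin_bound _ (fun i M => forall t, a <= t <= b -> `|v i t| <= M)).
    by move=> i M M' h MM t /h /le_trans; apply.
  by move=> i; apply: within_bounded; case: (hv i).
pose K1 := K + 1; have K10 : 0 < K1 by rewrite ltr_wpDl.
pose E t := expR (2 * K1 * (t - a)).
have E1 t : a <= t -> 1 <= E t.
  move=> ta; rewrite /E -[leLHS]expR0 ler_expR mulr_ge0// ?subr_ge0//.
  by rewrite mulr_ge0// ltW.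
have claim n : forall i t, a <= t <= b -> - (B / 2 ^+ n * E t) <= v i t.
  elim: n => [|n IH] i t /andP[ta tb].
    rewrite expr0 divr1 lerNl; apply: (@le_trans _ _ B).
      by rewrite (le_trans (ler_norm _))// normrN hB// ta.
    by rewrite ler_peMr// E1.
  have hE : pw_derive a t (fun t => - (B / 2 ^+ n.+1 * E t))
     (fun t => - (B / 2 ^+ n.+1 * (2 * K1 * E t))).
    by apply: pw_deriveN; apply: pw_deriveZ; exact: pw_derive_exp.
  have := pw_derive_le ta hE (pw_derive_sub (lexx _) tb (hv i)) _.
  have -> : E a = 1 by rewrite /E subrr mulr0 expR0.
  rewrite mulr1 => h.
  have {}h : - (B / 2 ^+ n.+1 * E t) - - (B / 2 ^+ n.+1) <= v i t - v i a.
    apply: h => u /andP[au ut].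
    have Eu : 0 <= E u by rewrite /E expR_ge0.
    have Bn : 0 <= B / 2 ^+ n by rewrite divr_ge0// exprn_ge0.
    have hu : a <= u <= b by rewrite (ltW au) (le_trans (ltW ut)).
    have := @hdv u (B / 2 ^+ n * E u) _ (mulr_ge0 Bn Eu) _ i.
    rewrite au (lt_le_trans ut tb) => /(_ isT (fun j => IH j u hu)).
    apply: le_trans; rewrite lerN2 exprS invfM.
    have -> : B * (2^-1 / 2 ^+ n) * (2 * K1 * E u) = K1 * (B / 2 ^+ n * E u).
      by field; rewrite expf_neq0.
    by rewrite ler_wpM2r ?mulr_ge0// lerDl.
  have Bn : 0 <= B / 2 ^+ n.+1 by rewrite divr_ge0// exprn_ge0.
  by have := va0 i; lra.
move=> i; rewrite -oppr_le0; apply: (@le_half_pow0 (B * E b)) => n.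
by have := claim n i b; rewrite ab lexx => /(_ isT); rewrite lerNl mulrAC.
Qed.

(* [cooperative_ge0] for the family consisting of the [d i] and the [- d i]. *)
Lemma linear_eq0 (I : finType) a b K (d dd : I -> R -> R) :
  a <= b -> 0 <= K -> (forall i, pw_derive a b (d i) (dd i)) ->
  (forall i, d i a = 0) ->
  (forall t S, a < t < b -> 0 <= S -> (forall j, `|d j t| <= S) ->
     forall i, `|dd i t| <= K * S) ->
  forall i, d i b = 0.
Proof.
move=> ab K0 hd da0 hdd.
pose sg (e : bool) : R := if e then 1 else -1.
have h (i : I * bool) : 0 <= sg i.2 * d i.1 b.
  move: i; apply: (@cooperative_ge0 _ a b K (fun i t => sg i.2 * d i.1 t)
    (fun i t => sg i.2 * dd i.1 t)) => //.
  - by move=> i; exact: pw_deriveZ.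
  - by move=> i; rewrite da0 mulr0.
  - move=> t S tab S0 hS [i e] /=.
    have : `|dd i t| <= K * S.
      apply: hdd => // j; have := hS (j, true); have := hS (j, false).
      by rewrite /sg/= ler_norml; lra.
    by rewrite ler_norml /sg; case: e => /=; lra.
move=> i; have := h (i, true); have := h (i, false); rewrite /sg/=; lra.
Qed.

(** Completeness of the reals, used in place of Cauchy sequences: with [h = f - E] and [k = f + E]
    the separating number is a limit of [f] that comes with its rate [E]. *)
Lemma sandwich (T : Type) (A : set T) (h k : T -> R) : A !=set0 ->
  (forall s t : T, A s -> A t -> h s <= k t) ->
  exists L, forall t : T, A t -> h t <= L <= k t.
Proof.
move=> [x Ax] hk; exists (sup (h @` A)) => t At; apply/andP; split.
  apply: ub_le_sup; last by exists t.
  by exists (k x) => _ [s As <-]; exact: hk.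
by apply: ge_sup; [exists (h x), x|move=> _ [s As <-]; exact: hk].
Qed.

Lemma expN_lt a l C e : 0 < l -> 0 < e ->
  exists2 T, a <= T & forall t, T <= t -> C * expR (- l * (t - a)) < e.
Proof.
move=> l0 e0; exists (a + `|C| / e / l).
  by rewrite lerDl divr_ge0// ?divr_ge0// ltW.
move=> t ht; apply: (@le_lt_trans _ _ (`|C| * expR (- l * (t - a)))).
  by rewrite ler_wpM2r ?expR_ge0// ler_norm.
rewrite mulNr expRN ltr_pdivrMr ?expR_gt0// mulrC -ltr_pdivrMr//.
apply: (@lt_le_trans _ _ (1 + l * (t - a))); last exact: expR_ge1Dx.
have : `|C| / e <= l * (t - a).
  by rewrite [leRHS]mulrC -ler_pdivrMr//; move: ht; rewrite -lerBrDl.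
by move=> h; rewrite (le_lt_trans h)// ltrDr.
Qed.

Lemma exp_decay_variation a s t f df C l : 0 < l -> a <= s -> s <= t ->
  pw_derive a t f df ->
  (forall u, a < u < t -> `|df u| <= C * expR (- l * (u - a))) ->
  `|f t - f s| <= C / l * (expR (- l * (s - a)) - expR (- l * (t - a))).
Proof.
move=> l0 as_ st hf hdf.
have hE : pw_derive s t (fun t => - (C / l) * expR (- l * (t - a)))
     (fun t => - (C / l) * (- l * expR (- l * (t - a)))).
  by apply: pw_deriveZ; exact: pw_derive_exp.
apply: le_trans (pw_derive_norm_le st (pw_derive_sub as_ (lexx _) hf) hE _) _; last first.
  by apply: eq_ler; ring.
move=> u /andP[su ut]; rewrite (le_trans (hdf u _))//.
  by rewrite ut (le_lt_trans as_).
by apply: eq_ler; field; rewrite gt_eqF.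
Qed.

Lemma exp_decay_variation0 a t f df C l : 0 < l -> 0 <= C -> a <= t ->
  pw_derive a t f df ->
  (forall u, a < u < t -> `|df u| <= C * expR (- l * (u - a))) ->
  `|f t - f a| <= C / l.
Proof.
move=> l0 C0 at_ hf hdf.
rewrite (le_trans (exp_decay_variation l0 (lexx a) at_ hf hdf))//.
by rewrite subrr mulr0 expR0 ler_piMr ?divr_ge0 ?(ltW l0)// gerBl expR_ge0.
Qed.

(** Integrating factor [expR (al (u - a))]; the gap [nu < al] makes the weighted forcing integrate
    to at most [D / (al - nu)] times an exponential. The rates may be negative, in which case this
    is a Gronwall bound. *)
Lemma exp_decay_bound a t y dy al nu D : a <= t -> nu < al -> 0 <= D -> 0 <= y a ->
  pw_derive a t y dy ->
  (forall u, a < u < t -> dy u <= - al * y u + D * expR (- nu * (u - a))) ->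
  y t <= (y a + D / (al - nu)) * expR (- nu * (t - a)).
Proof.
move=> at_ an D0 ya hy hdy; have an0 : 0 < al - nu by rewrite subr_gt0.
have h1 := pw_deriveM (pw_derive_exp a t al a) hy.
have h2 := pw_deriveZ (D / (al - nu)) (pw_derive_exp a t (al - nu) a).
have split_exp u : expR ((al - nu) * (u - a)) = expR (al * (u - a)) * expR (- nu * (u - a)).
  by rewrite -expRD; congr expR; ring.
have := pw_derive_le at_ h1 h2 _.
rewrite subrr !mulr0 expR0 mul1r mulr1 => h.
have {}h : expR (al * (t - a)) * y t - y a <=
    D / (al - nu) * expR ((al - nu) * (t - a)) - D / (al - nu).
  apply: h => u uat; have := hdy u uat; have := expR_ge0 (al * (u - a)).
  have -> : D / (al - nu) * ((al - nu) * expR ((al - nu) * (u - a))) =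
    D * expR ((al - nu) * (u - a)) by field; rewrite gt_eqF.
  rewrite split_exp; set E := expR (al * _); set F := expR _ => E0 h3.
  have := ler_wpM2l E0 h3; lra.
have Ea : expR (al * (t - a)) * expR (- al * (t - a)) = 1.
  by rewrite -expRD -[RHS]expR0; congr expR; ring.
have En : expR (- al * (t - a)) <= expR (- nu * (t - a)).
  by rewrite ler_expR !mulNr lerN2 ler_wpM2r ?subr_ge0// ltW.
rewrite split_exp in h; move: h Ea En (expR_gt0 (al * (t - a))).
set E := expR (al * _); set F := expR (- nu * _); set E' := expR _ => h Ea En Egt0.
have Dn : 0 <= D / (al - nu) by rewrite divr_ge0// ltW.
rewrite -(ler_pM2l Egt0).
have : y a * 1 <= y a * (E * F) by rewrite ler_wpM2l// -Ea ler_wpM2l// ltW.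
by lra.
Qed.

(** With [E] the tail integral of the bound, [|f t - f s| <= E s - E t], so the error bars
    [[f - E, f + E]] meet pairwise and [sandwich] provides a common point. *)
Lemma exp_decay_limit a f df C l : 0 < l -> 0 <= C ->
  (forall b, pw_derive a b f df) ->
  (forall t, a < t -> `|df t| <= C * expR (- l * (t - a))) ->
  exists L, forall t, a <= t -> `|f t - L| <= C / l * expR (- l * (t - a)).
Proof.
move=> l0 C0 hf hdf.
pose E t := C / l * expR (- l * (t - a)).
have E0 t : 0 <= E t by rewrite mulr_ge0 ?expR_ge0// divr_ge0// ltW.
have var s t : a <= s -> s <= t -> `|f t - f s| <= E s - E t.
  move=> as_ st; rewrite -mulrBr; apply: (exp_decay_variation l0 as_ st (hf t)).
  by move=> u /andP[au _]; exact: hdf.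
have [L hL] : exists L, forall t, [set t | a <= t] t -> f t - E t <= L <= f t + E t.
  apply: sandwich; first by exists a => /=.
  move=> s t /= as_ at_; have := E0 s; have := E0 t.
  have [st|/ltW ts] := leP s t.
    by have := var s t as_ st; rewrite ler_norml; lra.
  by have := var t s at_ ts; rewrite ler_norml; lra.
exists L => t at_; have := hL t at_; rewrite ler_norml -/(E t); lra.
Qed.

Lemma nondecreasing_limit a f M :
  (forall s t, a <= s -> s <= t -> f s <= f t) -> (forall t, a <= t -> f t <= M) ->
  exists L, (forall t, a <= t -> f t <= L) /\
    forall e, 0 < e -> exists2 T, a <= T & forall t, T <= t -> L - e < f t.
Proof.
move=> nd bd; pose A := f @` [set t | a <= t].
have hA : has_sup A.
  by split; [exists (f a), a => //=|exists M => _ [t at_ <-]; exact: bd].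
exists (sup A); split.
  by move=> t at_; apply: ub_le_sup; [case: hA|exists t].
move=> e e0; have [_ [T aT <-] hT] := sup_adherent e0 hA.
by exists T => // t Tt; rewrite (lt_le_trans hT)// nd.
Qed.

(** Since [m >= 0], the function [f - (B / l) E] is nondecreasing; it is bounded because
    [f ^ 2 <= c + B], so [f] has a limit [L]. If [L ^ 2 > c], then [m] would become negative; if
    [L ^ 2 < c], then [f'] would stay above a positive constant and [f] would be unbounded. The
    one-sided bound on [L] is kept because it later decides the sign of [L]. *)
Lemma riccati_limit a f m h B l c : 0 < l -> 0 <= B ->
  (forall b, pw_derive a b f (fun t => m t + h t)) ->
  (forall t, a <= t -> 0 <= m t) ->
  (forall t, a <= t -> `|h t| <= B * expR (- l * (t - a))) ->
  (forall t, a <= t -> `|m t + f t ^+ 2 - c| <= B * expR (- l * (t - a))) ->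
  exists L, [/\ L ^+ 2 = c,
    forall t, a <= t -> f t - B / l * expR (- l * (t - a)) <= L &
    forall e, 0 < e -> exists2 T, a <= T & forall t, T <= t -> `|f t - L| < e].
Proof.
move=> l0 B0 hf m0 hh hm.
pose E t := expR (- l * (t - a)).
have E0 t : 0 <= E t by exact: expR_ge0.
have E1 t : a <= t -> E t <= 1.
  move=> at_; rewrite -[leRHS]expR0 ler_expR mulNr oppr_le0 mulr_ge0 ?subr_ge0//.
  exact: ltW.
have hE b : pw_derive a b (fun t => B / l * E t) (fun t => B / l * (- l * E t)).
  by apply: pw_deriveZ; exact: pw_derive_exp.
have nd s t : a <= s -> s <= t -> f s - B / l * E s <= f t - B / l * E t.
  move=> as_ st.
  apply: (pw_derive_ndecr st (pw_derive_sub as_ (lexx t) (pw_deriveB (hf t) (hE t)))).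
  move=> u /andP[su ut]; have au : a <= u by rewrite (le_trans as_)// ltW.
  have -> : B / l * (- l * E u) = - (B * E u) by field; rewrite gt_eqF.
  by have := m0 u au; have := hh u au; rewrite ler_norml -/(E u); lra.
have f2 t : a <= t -> f t ^+ 2 <= c + B.
  move=> at_; have := m0 t at_; have := hm t at_; rewrite ler_norml -/(E t).
  by have := ler_wpM2l B0 (E1 t at_); lra.
have bd t : a <= t -> f t - B / l * E t <= c + B + 1.
  move=> at_; have := f2 t at_.
  have : 0 <= B / l * E t by rewrite mulr_ge0// divr_ge0// ltW.
  by nra.
have [L [hL1 hL2]] := nondecreasing_limit nd bd.
have lim e : 0 < e -> exists2 T, a <= T & forall t, T <= t -> `|f t - L| < e.
  move=> e0; have [T1 aT1 h1] := hL2 e e0.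
  have [T2 aT2 h2] := expN_lt a (B / l) l0 e0.
  exists (Num.max T1 T2); first by rewrite le_max aT1.
  move=> t; rewrite ge_max => /andP[t1 t2].
  have := h1 t t1; have := h2 t t2; have := hL1 t (le_trans aT1 t1).
  have : 0 <= B / l * E t by rewrite mulr_ge0// divr_ge0// ltW.
  by rewrite ltr_norml -/(E t); lra.
exists L; split=> //.
have Lc : L ^+ 2 <= c.
  (* A third of the gap: the error of [m + f ^ 2 - c] and that of [f ^ 2 - L ^ 2] cost [d] each,
     which leaves [m <= - d]. *)
  rewrite leNgt; apply/negP => cL; pose d := (L ^+ 2 - c) / 3.
  have d0 : 0 < d by rewrite divr_gt0// subr_gt0.
  pose e := Num.min 1 (d / (2 * `|L| + 1)).
  have L2 : 0 < 2 * `|L| + 1 by rewrite ltr_wpDl// mulr_ge0.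
  have e0 : 0 < e by rewrite lt_min ltr01 divr_gt0.
  have [T1 aT1 h1] := lim e e0; have [T2 aT2 h2] := expN_lt a B l0 d0.
  pose t := Num.max T1 T2; have t1 : T1 <= t by rewrite le_max lexx.
  have t2 : T2 <= t by rewrite le_max lexx orbT.
  have at_ := le_trans aT1 t1.
  have {}h1 := h1 t t1; have {}h2 := h2 t t2.
  have := hm t at_; have := m0 t at_.
  have : `|f t ^+ 2 - L ^+ 2| <= d.
    rewrite subr_sqr normrM.
    have e1 : e <= 1 by rewrite ge_min lexx.
    have : `|f t + L| <= 2 * `|L| + 1.
      have -> : f t + L = (f t - L) + 2 * L by ring.
      by rewrite (le_trans (ler_normD _ _))// normrM ger0_norm//; lra.
    move=> h3; apply: (le_trans (ler_pM (normr_ge0 _) (normr_ge0 _) (ltW h1) h3)).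
    by rewrite -ler_pdivlMr// ge_min lexx orbT.
  by rewrite !ler_norml /d; rewrite /d in h2; lra.
apply/eqP; rewrite eq_le Lc /= leNgt; apply/negP => cL.
(* A quarter of the gap: the errors of [m + f ^ 2 - c], of [f ^ 2 - L ^ 2] and of [h] cost [d] each,
   which leaves [f' >= d]. *)
pose d := (c - L ^+ 2) / 4.
have d0 : 0 < d by rewrite divr_gt0// subr_gt0.
pose e := Num.min 1 (d / (2 * `|L| + 1)).
have L2 : 0 < 2 * `|L| + 1 by rewrite ltr_wpDl// mulr_ge0.
have e0 : 0 < e by rewrite lt_min ltr01 divr_gt0.
have [T1 aT1 h1] := lim e e0; have [T2 aT2 h2] := expN_lt a B l0 d0.
pose T := Num.max T1 T2; have t1 : T1 <= T by rewrite le_max lexx.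
have t2 : T2 <= T by rewrite le_max lexx orbT.
have aT := le_trans aT1 t1.
have inc t : T <= t -> d <= m t + h t.
  move=> Tt; have at_ := le_trans aT Tt.
  have {}h1 := h1 t (le_trans t1 Tt); have {}h2 := h2 t (le_trans t2 Tt).
  have := hm t at_; have := hh t at_.
  have : `|f t ^+ 2 - L ^+ 2| <= d.
    rewrite subr_sqr normrM.
    have e1 : e <= 1 by rewrite ge_min lexx.
    have : `|f t + L| <= 2 * `|L| + 1.
      have -> : f t + L = (f t - L) + 2 * L by ring.
      by rewrite (le_trans (ler_normD _ _))// normrM ger0_norm//; lra.
    move=> h3; apply: (le_trans (ler_pM (normr_ge0 _) (normr_ge0 _) (ltW h1) h3)).
    by rewrite -ler_pdivlMr// ge_min lexx orbT.
  rewrite -/(E t) in h2 *.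
  by rewrite !ler_norml; rewrite /d in h2 *; lra.
have [T3 aT3 h3] := lim 1 ltr01.
pose S := Num.max T T3.
(* Over this time [f] gains at least 3, although both end values are within 1 of [L]. *)
pose t := S + 3 / d; have St : S <= t by rewrite lerDl divr_ge0// ltW.
have TS : T <= S by rewrite le_max lexx.
have := pw_derive_le St (pw_deriveZ d (pw_derive_id S t))
   (pw_derive_sub (le_trans aT TS) (lexx _) (hf t)) _.
have -> : d * t - d * S = 3 by rewrite /t; field; rewrite gt_eqF.
have S3 : T3 <= S by rewrite le_max lexx orbT.
have := h3 S S3; have := h3 t (le_trans S3 St).
rewrite !ltr_norml => a1 a2 a3.
suff : 3 <= f t - f S by lra.
by apply: a3 => u /andP[Su ut]; rewrite mulr1 inc// (le_trans TS)// ltW.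
Qed.

End PiecewiseDerivative.

(** * Linear differential equations with piecewise continuous coefficients *)

Section LinearODE.
Variable R : realType.
Implicit Types (a b t K S C x : R) (f : R -> R).
Notation mu := (@lebesgue_measure R).

Lemma measurable_fun_open_off_seq (U : set R) (D : seq R) f : open U ->
  (forall t, U t -> t \notin D -> {for t, continuous f}) -> measurable_fun U f.
Proof.
elim: D U => [|d D IH] U oU hf.
  apply: subspace_continuous_measurable_fun; first exact: open_measurable.
  rewrite continuous_open_subspace// => t; rewrite inE => Ut; exact: hf.
have oU' : open (U `&` ~` [set d]).
  by apply: openI => //; apply: closed_openC; exact/accessible_closed_set1/hausdorff_accessible/Rhausdorff.
have mU' : measurable_fun (U `&` ~` [set d]) f.
  apply: IH => // t [Ut /= td] tD; apply: hf => //.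
  by rewrite inE negb_or tD andbT; apply/eqP.
apply: (@measurable_funS _ _ _ _ ((U `&` ~` [set d]) `|` [set d])).
- by apply: measurableU => //; exact: open_measurable.
- by move=> t Ut; have [->|/eqP td] := eqVneq t d; [right|left].
- apply/measurable_funU => //; first exact: open_measurable.
  by split=> //; exact: measurable_fun_set1.
Qed.

Lemma pw_continuous_integrable a b (D : seq R) K f :
  (forall t, a < t < b -> t \notin D -> {for t, continuous f}) ->
  (forall t, a <= t <= b -> `|f t| <= K) ->
  mu.-integrable `[a, b] (EFin \o f).
Proof.
move=> hf hK; apply: measurable_bounded_integrable => //.
- rewrite /= lebesgue_measure_itv/=; case: ifP => // _; exact: ltry.
- apply: (@measurable_funS _ _ _ _ (`]a, b[ `|` ([set a] `|` [set b]))).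
  + by apply: measurableU => //; exact: measurableU.
  + move=> t /=; rewrite !in_itv/= => /andP[]; rewrite le_eqVlt => /orP[/eqP ->|at_].
      by right; left.
    by rewrite le_eqVlt => /orP[/eqP ->|->]; [right; right|left; rewrite at_].
  + apply/measurable_funU => //; first exact: measurableU.
    split.
      apply: (@measurable_fun_open_off_seq _ D); first exact: interval_open.
      by move=> t /=; rewrite in_itv/=; exact: hf.
    by apply/measurable_funU => //; split; exact: measurable_fun_set1.
- exists K; split; first exact: num_real.
  move=> M KM t /=; rewrite in_itv/= => tab.
  by rewrite (le_trans (hK t tab))// ltW.
Qed.

Definition primitive a f : R -> R := fun x => parameterized_integral mu a x f.

Lemma primitive_a a f : primitive a f a = 0.
Proof. by rewrite /primitive /parameterized_integral set_itv1 Rintegral_set1. Qed.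

Lemma primitive_continuous a b (D : seq R) K f :
  (forall t, a < t < b -> t \notin D -> {for t, continuous f}) ->
  (forall t, a <= t <= b -> `|f t| <= K) ->
  {within `[a, b], continuous (primitive a f)}.
Proof.
move=> hf hK; have [ab|ba] := leP a b; last first.
  by rewrite set_itv_ge ?bnd_simp -?ltNge//; exact: continuous_subspace0.
apply: parameterized_integral_continuous => //.
exact: pw_continuous_integrable hf hK.
Qed.

Lemma primitive_is_derive a b (D : seq R) K f :
  (forall t, a < t < b -> t \notin D -> {for t, continuous f}) ->
  (forall t, a <= t <= b -> `|f t| <= K) ->
  forall t, a < t < b -> {for t, continuous f} ->
  is_derive t 1 (primitive a f) (f t).
Proof.
move=> hf hK t /andP[at_ tb] ct.
have [h1 h2] := continuous_FTC1_closed tb (pw_continuous_integrable hf hK) at_ ct.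
by apply: DeriveDef; [exact: h1|rewrite -derive1E; exact: h2].
Qed.

Lemma primitive_pw_derive a b (D : seq R) K f :
  (forall t, a < t < b -> t \notin D -> {for t, continuous f}) ->
  (forall t, a <= t <= b -> `|f t| <= K) ->
  pw_derive a b (primitive a f) f.
Proof.
move=> hf hK; split; first exact: primitive_continuous hf hK.
exists D => t tab tD; apply: (primitive_is_derive hf hK) => //; exact: hf.
Qed.

Lemma within_continuous_at a b f t : {within `[a, b], continuous f} ->
  a < t < b -> {for t, continuous f}.
Proof.
move=> cf /andP[at_ tb]; have ab := lt_trans at_ tb.
by have /(continuous_within_itvP _ ab)[h _ _] := cf; apply: h; rewrite in_itv/= at_.
Qed.

Variables (I : finType) (a : R) (K : R) (M : I -> I -> R -> R) (y0 : I -> R).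
Hypothesis Mcont : forall b, exists D : seq R, forall t, a < t < b -> t \notin D ->
  forall i j, {for t, continuous (M i j)}.
Hypothesis Mbnd : forall i j t, a <= t -> `|M i j t| <= K.
Implicit Types (y z : I -> R -> R).

Let K1 := #|I|%:R * `|K| + 1.

Let K10 : 0 < K1. Proof. by rewrite ltr_wpDl// mulr_ge0. Qed.

(** The weight of a Bielecki norm: with an exponent twice the Lipschitz constant [K1], a Picard step
    halves weighted distances on the whole half-line, so solutions are global without any
    continuation argument. *)
Let E t := expR (2 * K1 * (t - a)).

Let E0 t : 0 <= E t. Proof. exact: expR_ge0. Qed.

Definition ode_rhs y : I -> R -> R := fun i t => \sum_j M i j t * y j t.

Definition picard y : I -> R -> R := fun i t => y0 i + primitive a (ode_rhs y i) t.

Let inv y := forall i b, {within `[a, b], continuous (y i)}.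

Let rhs_cont y i t : inv y -> a < t -> (forall j, {for t, continuous (M i j)}) ->
  {for t, continuous (ode_rhs y i)}.
Proof.
move=> hy at_ hM; rewrite /ode_rhs.
rewrite (_ : (fun t => _) = \sum_j (fun t => M i j t * y j t)); last first.
  by apply/funext => u; rewrite fct_sumE.
apply: (big_ind (fun g : R -> R => {for t, continuous g})).
- exact: cst_continuous.
- by move=> g h cg ch; exact: continuousD.
move=> j _; by apply: continuousM => //; apply: (within_continuous_at (hy j (t + 1))); rewrite at_ ltrDl/=.
Qed.

Let rhs_le y t S i : a <= t -> 0 <= S -> (forall j, `|y j t| <= S) ->
  `|ode_rhs y i t| <= K1 * S.
Proof.
move=> at_ S0 hy; rewrite (le_trans (ler_norm_sum _ _ _))//.
apply: (@le_trans _ _ (\sum_(j : I) `|K| * S)).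
  apply: ler_sum => j _; rewrite normrM ler_pM// (le_trans (Mbnd i j at_))//.
  exact: ler_norm.
rewrite sumr_const -mulr_natl mulrA.
by rewrite ler_wpM2r// lerDl.
Qed.

Let rhs_prim y i b : inv y ->
  exists2 D : seq R, (forall t, a < t < b -> t \notin D ->
    {for t, continuous (ode_rhs y i)}) &
  exists K', forall t, a <= t <= b -> `|ode_rhs y i t| <= K'.
Proof.
move=> hy; have [D hD] := Mcont b; exists D.
  move=> t tab tD; apply: rhs_cont => //; first by case/andP: tab.
  by move=> j; exact: hD.
have [B B0 hB] : exists2 B, 0 <= B & forall i t, a <= t <= b -> `|y i t| <= B.
  apply: (@fin_bound _ _ (fun i M => forall t, a <= t <= b -> `|y i t| <= M)).
    by move=> k M1 M2 h MM t /h /le_trans; apply.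
  by move=> k; apply: within_bounded; exact: hy.
exists (K1 * B) => t tab; apply: rhs_le => //; first by case/andP: tab.
by move=> j; exact: hB.
Qed.

Let picard_a y i : picard y i a = y0 i.
Proof. by rewrite /picard primitive_a addr0. Qed.

Let picard_pw y i b : inv y -> pw_derive a b (picard y i) (ode_rhs y i).
Proof.
move=> /(@rhs_prim _ i b)[D hD [K' hK]].
apply: pw_derive_ext (pw_deriveD (pw_derive_cst a b (y0 i)) (primitive_pw_derive hD hK)).
by move=> t _; rewrite add0r.
Qed.

Let picard_inv y : inv y -> inv (picard y).
Proof. by move=> hy i b; case: (picard_pw i b hy). Qed.

Let picard_contract y z S : inv y -> inv z -> 0 <= S ->
  (forall i t, a <= t -> `|y i t - z i t| <= S * E t) ->
  forall i t, a <= t -> `|picard y i t - picard z i t| <= S / 2 * E t.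
Proof.
move=> hy hz S0 h i t at_.
have hE : pw_derive a t (fun t => S / 2 * E t) (fun t => S / 2 * (2 * K1 * E t)).
  by apply: pw_deriveZ; exact: pw_derive_exp.
have := pw_derive_norm_le at_ (pw_deriveB (picard_pw i t hy) (picard_pw i t hz)) hE _.
rewrite !picard_a subrr subr0 => h'; apply: le_trans (h' _) _.
  move=> u /andP[/ltW au _].
  have -> : ode_rhs y i u - ode_rhs z i u = ode_rhs (fun i t => y i t - z i t) i u.
    by rewrite /ode_rhs -sumrB; apply: eq_bigr => j _; rewrite mulrBr.
  apply: le_trans (@rhs_le _ u (S * E u) i au _ _) _; first exact: mulr_ge0.
    by move=> j; exact: h.
  by apply: eq_ler; field.
by rewrite gerBl mulr_ge0// divr_ge0.
Qed.

(** Picard iterates from zero approach each other geometrically in the weighted norm; their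
    pointwise limit [y] is uniform on compact intervals, hence continuous, and is a fixed point. The
    equation is obtained at every later time at which the coefficients are continuous, as [solution]
    demands, and not merely off some finite list. *)
Lemma linear_ode : exists y,
  [/\ forall i, y i a = y0 i,
      forall i b, {within `[a, b], continuous (y i)} &
      forall i t, a < t -> (forall j, {for t, continuous (M i j)}) ->
        is_derive t 1 (y i) (\sum_j M i j t * y j t)].
Proof.
pose Y n := iter n picard (fun _ _ => 0).
have invY n : inv (Y n).
  elim: n => [|n IH]; last exact: picard_inv.
  by move=> i b; apply: continuous_subspaceT; exact: cst_continuous.
pose C : R := \sum_i `|y0 i|.
have C0 : 0 <= C by apply: sumr_ge0.
have E1 t : a <= t -> 1 <= E t.
  move=> ta; rewrite /E -[leLHS]expR0 ler_expR mulr_ge0// ?subr_ge0//.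
  by rewrite mulr_ge0// ltW.
have Ydiff n i t : a <= t -> `|Y n.+1 i t - Y n i t| <= C / 2 ^+ n * E t.
  elim: n i t => [|n IH] i t at_.
    have -> : Y 1%N i t = y0 i.
      rewrite -(picard_a (fun _ _ => 0) i); apply: (pw_derive0 at_ (picard_pw i t (invY 0%N))).
      by move=> u _; rewrite /ode_rhs big1// => j _; rewrite mulr0.
    rewrite subr0 expr0 divr1 (@le_trans _ _ C)//.
      by rewrite /C (bigD1 i)//= lerDl sumr_ge0.
    by rewrite ler_peMr// E1.
  have := @picard_contract (Y n.+1) (Y n) (C / 2 ^+ n) (invY _) (invY _) _ IH i t at_.
  rewrite exprS invfM mulrCA [2^-1 * _]mulrC; apply.
  by rewrite divr_ge0// exprn_ge0.
have Ydist n d i t : a <= t ->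
    `|Y (n + d)%N i t - Y n i t| <= 2 * C * E t * (2 ^- n - 2 ^- (n + d)).
  move=> at_; elim: d => [|d IH]; first by rewrite addn0 !subrr normr0 mulr0.
  rewrite addnS.
  have -> : Y (n + d).+1 i t - Y n i t =
    (Y (n + d).+1 i t - Y (n + d)%N i t) + (Y (n + d)%N i t - Y n i t) by ring.
  rewrite (le_trans (ler_normD _ _))//.
  rewrite (le_trans (lerD (Ydiff _ _ _ at_) IH))//.
  by apply: eq_ler; rewrite exprS invfM; field; rewrite !expf_neq0.
have [y hy] : exists y, forall i t n, a <= t ->
    `|Y n i t - y i t| <= 2 * C * E t / 2 ^+ n.
  suff /choice[y hy] : forall it : I * R, exists L, forall n, a <= it.2 ->
      `|Y n it.1 it.2 - L| <= 2 * C * E it.2 / 2 ^+ n.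
    by exists (fun i t => y (i, t)) => i t n at_; exact: hy (i, t) n at_.
  move=> [i t] /=; have [at_|ta] := leP a t; last by exists 0 => n.
  pose q n := 2 * C * E t / 2 ^+ n.
  have q0 n : 0 <= q n by rewrite divr_ge0 ?exprn_ge0// !mulr_ge0.
  have [L hL] : exists L, forall n, [set: nat] n -> Y n i t - q n <= L <= Y n i t + q n.
    apply: sandwich; first by exists 0%N.
    move=> m n _ _; have [mn|/ltnW mn] := leqP m n.
      have := Ydist m (n - m)%N i t at_; rewrite subnKC// mulrBr -/(q n) -/(q m).
      by have := q0 n; have := q0 m; rewrite ler_norml; lra.
    have := Ydist n (m - n)%N i t at_; rewrite subnKC// mulrBr -/(q n) -/(q m).
    by have := q0 n; have := q0 m; rewrite ler_norml; lra.
  by exists L => n _; have := hL n Logic.I; rewrite ler_norml -/(q n); lra.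
have invy : inv y.
  move=> i b; apply/subspace_continuousP => x /=; rewrite in_itv/= => /andP[ax xb].
  apply/cvgrPdist_le => e e0.
  have e3 : 0 < e / 3 by rewrite divr_gt0.
  have [n hn] := half_pow_lt (2 * C * E b) e3.
  have Yb t : a <= t <= b -> `|Y n i t - y i t| <= e / 3.
    move=> /andP[at_ tb]; apply: le_trans (hy i t n at_) _; apply: le_trans (ltW hn).
    rewrite ler_wpM2r ?invr_ge0 ?exprn_ge0// ler_wpM2l ?mulr_ge0//.
    rewrite /E ler_expR ler_wpM2l ?lerB//.
    by rewrite mulr_ge0// ltW.
  have /subspace_continuousP/(_ x) := invY n i b.
  rewrite /= in_itv/= ax xb => /(_ isT)/cvgrPdist_le/(_ _ e3) hc.
  near=> t.
  have tab : a <= t <= b.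
    by near: t; rewrite near_withinE; near=> t; rewrite /= in_itv.
  have h1 := Yb t tab; have h2 := Yb x; rewrite ax xb in h2; have {}h2 := h2 isT.
  have h3 : `|Y n i x - Y n i t| <= e / 3 by near: t.
  have tri (p q r u v : R) : `|p - q| <= v / 3 -> `|r - u| <= v / 3 ->
      `|r - p| <= v / 3 -> `|u - q| <= v by rewrite !ler_norml; lra.
  exact: tri h1 h2 h3.
(* It equals [y] from time [a] on, and is a primitive by construction. *)
exists (picard y).
have yE i t : a <= t -> picard y i t = y i t.
  move=> at_; apply/eqP; rewrite -subr_eq0 -normr_le0.
  apply: (@le_half_pow0 _ (2 * C * E t)) => n.
  have c : `|picard y i t - Y n.+1 i t| <= (2 * C / 2 ^+ n) / 2 * E t.
    apply: picard_contract => // [|j s as_].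
      by rewrite divr_ge0 ?exprn_ge0// mulr_ge0.
    by rewrite distrC (le_trans (hy j s n as_))//; apply: eq_ler; ring.
  have := hy i t n.+1 at_; move: c; rewrite exprS invfM !ler_norml.
  have -> : 2 * C * E t * (2^-1 / 2 ^+ n) = (2 * C * E t / 2 ^+ n) / 2.
    by field; rewrite expf_neq0.
  have -> : 2 * C / 2 ^+ n / 2 * E t = (2 * C * E t / 2 ^+ n) / 2.
    by field; rewrite expf_neq0.
  lra.
split.
- by move=> i; rewrite picard_a.
- exact: picard_inv.
- move=> i t at_ hM.
  have [D hD [K' hK]] := @rhs_prim y i (t + 1) invy.
  have -> : \sum_j M i j t * picard y j t = 0 + ode_rhs y i t.
    by rewrite add0r; apply: eq_bigr => j _; rewrite yE// ltW.
  rewrite [picard y i](_ : _ = cst (y0 i) + primitive a (ode_rhs y i))//.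
  apply: is_deriveD; apply: (primitive_is_derive hD hK).
    by rewrite at_ /= ltrDl.
  exact: rhs_cont.
Unshelve. all: by end_near. Qed.

End LinearODE.

(** * Vectors and rotations of three-space *)

Section Matrices.
Variable R : realType.

Lemma mxDE m n (M M' : 'M[R]_(m, n)) i j : (M + M') i j = M i j + M' i j.
Proof. by rewrite mxE. Qed.

Lemma mxBE m n (M M' : 'M[R]_(m, n)) i j : (M - M') i j = M i j - M' i j.
Proof. by rewrite !mxE. Qed.

Lemma mxZE m n (c : R) (M : 'M[R]_(m, n)) i j : (c *: M) i j = c * M i j.
Proof. by rewrite mxE. Qed.

Lemma mx_norm_ge m n (M : 'M[R]_(m, n)) i j : `|M i j| <= `|M|.
Proof.
rewrite [leRHS]/Num.Def.normr/= mx_normrE.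
exact: (le_bigmax _ (fun ij : 'I_m * 'I_n => `|M ij.1 ij.2|) (i, j)).
Qed.

Lemma mx_norm_le m n (M : 'M[R]_(m, n)) (e : R) : 0 <= e ->
  (forall i j, `|M i j| <= e) -> `|M| <= e.
Proof.
move=> e0 h; rewrite [leLHS]/Num.Def.normr/= mx_normrE.
by apply: bigmax_le => // -[i j] _ /=.
Qed.

(** The norm is the largest absolute entry, so a product costs its inner dimension: the origin of
    most factors 3 below. *)
Lemma mx_normM m n p (M : 'M[R]_(m, n)) (M' : 'M[R]_(n, p)) :
  `|M *m M'| <= n%:R * `|M| * `|M'|.
Proof.
apply: mx_norm_le => [|i j]; first by rewrite !mulr_ge0.
rewrite mxE (le_trans (ler_norm_sum _ _ _))//.
apply: (@le_trans _ _ (\sum_(k < n) `|M| * `|M'|)).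
  by apply: ler_sum => k _; rewrite normrM ler_pM// mx_norm_ge.
by rewrite sumr_const card_ord -mulrA mulr_natl.
Qed.

Lemma mx_norm_tr m n (M : 'M[R]_(m, n)) : `|M^T| = `|M|.
Proof.
apply/eqP; rewrite eq_le; apply/andP; split; apply: mx_norm_le => // i j.
  by rewrite mxE mx_norm_ge.
by have := mx_norm_ge M^T j i; rewrite mxE.
Qed.

Lemma sum3 (V : nmodType) (F : 'I_3 -> V) : \sum_i F i = F o0 + F o1 + F o2.
Proof.
rewrite !big_ord_recr big_ord0 /= add0r.
by congr (F _ + F _ + F _); apply/val_inj; rewrite /= inordK.
Qed.

Lemma ord3P (P : 'I_3 -> Prop) : P o0 -> P o1 -> P o2 -> forall i, P i.
Proof.
move=> h0 h1 h2 [[|[|[|//]]] hi].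
- by rewrite (_ : Ordinal hi = o0)//; apply/val_inj; rewrite /= inordK.
- by rewrite (_ : Ordinal hi = o1)//; apply/val_inj; rewrite /= inordK.
- by rewrite (_ : Ordinal hi = o2)//; apply/val_inj; rewrite /= inordK.
Qed.

Lemma o0E : 0 = o0.
Proof. by apply/val_inj; rewrite /= inordK. Qed.

Lemma cV3P (u v : 'cV[R]_3) :
  u o0 0 = v o0 0 -> u o1 0 = v o1 0 -> u o2 0 = v o2 0 -> u = v.
Proof.
by move=> h0 h1 h2; apply/matrixP => i j; rewrite (ord1 j); move: i; exact: ord3P.
Qed.

Lemma mx3P (M M' : 'M[R]_3) : (forall j, M o0 j = M' o0 j) ->
  (forall j, M o1 j = M' o1 j) -> (forall j, M o2 j = M' o2 j) -> M = M'.
Proof. by move=> h0 h1 h2; apply/matrixP => i j; move: i j; exact: ord3P. Qed.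

Lemma hatE (u : 'cV[R]_3) :
  (hat u o0 o0 = 0) * (hat u o0 o1 = - u o2 0) * (hat u o0 o2 = u o1 0) *
  (hat u o1 o0 = u o2 0) * (hat u o1 o1 = 0) * (hat u o1 o2 = - u o0 0) *
  (hat u o2 o0 = - u o1 0) * (hat u o2 o1 = u o0 0) * (hat u o2 o2 = 0).
Proof. by rewrite /hat !mxE !inordK. Qed.

Lemma ord3_neq : ((o0 == o1) = false) * ((o0 == o2) = false) * ((o1 == o0) = false) *
  ((o1 == o2) = false) * ((o2 == o0) = false) * ((o2 == o1) = false).
Proof. by rewrite -!val_eqE /= !inordK. Qed.

Lemma e1E : (e1 R o0 0 = 1) * (e1 R o1 0 = 0) * (e1 R o2 0 = 0).
Proof. by rewrite /e1 o0E !mxE !ord3_neq !eqxx. Qed.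

Lemma dotE (u v : 'cV[R]_3) : dot u v = u o0 0 * v o0 0 + u o1 0 * v o1 0 + u o2 0 * v o2 0.
Proof. by rewrite /dot mxE sum3 !mxE. Qed.

Lemma crossE (u v : 'cV[R]_3) :
  (cross u v o0 0 = u o1 0 * v o2 0 - u o2 0 * v o1 0) *
  (cross u v o1 0 = u o2 0 * v o0 0 - u o0 0 * v o2 0) *
  (cross u v o2 0 = u o0 0 * v o1 0 - u o1 0 * v o0 0).
Proof. by rewrite /cross !mxE !sum3 !hatE; split; [split|]; ring. Qed.

Lemma mulmxE3 m (M : 'M[R]_(m, 3)) n (M' : 'M[R]_(3, n)) i j :
  (M *m M') i j = M i o0 * M' o0 j + M i o1 * M' o1 j + M i o2 * M' o2 j.
Proof. by rewrite mxE sum3. Qed.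

Lemma dotBB (u v : 'cV[R]_3) : dot (u - v) (u - v) = dot u u + dot v v - 2 * dot u v.
Proof. by rewrite !dotE !mxBE; ring. Qed.

Lemma dotZ (a b : R) (u v : 'cV[R]_3) : dot (a *: u) (b *: v) = a * b * dot u v.
Proof. by rewrite !dotE !mxZE; ring. Qed.

Lemma dot_ge0 (u : 'cV[R]_3) : 0 <= dot u u.
Proof. by rewrite dotE; nra. Qed.

Lemma dot_gt0 (u : 'cV[R]_3) : u != 0 -> 0 < dot u u.
Proof.
move=> u0; rewrite lt_neqAle dot_ge0 andbT; apply: contraNneq u0.
rewrite dotE => h; apply/eqP/cV3P; rewrite mxE; nra.
Qed.

Lemma dot_mul (Q : 'M[R]_3) (u v : 'cV[R]_3) : Q^T *m Q = 1%:M ->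
  dot (Q *m u) (Q *m v) = dot u v.
Proof. by move=> h; rewrite /dot trmx_mul -mulmxA (mulmxA Q^T) h mul1mx. Qed.

Lemma dot_norm_le (u v : 'cV[R]_3) : `|dot u v| <= 3 * `|u| * `|v|.
Proof.
rewrite (le_trans (mx_norm_ge _ _ _))// (le_trans (mx_normM _ _))//.
by rewrite mx_norm_tr.
Qed.

Lemma norm_sqr_le_dot (u : 'cV[R]_3) : `|u| ^+ 2 <= dot u u.
Proof.
have h : `|u| <= Num.sqrt (dot u u).
  apply: mx_norm_le; first exact: sqrtr_ge0.
  move=> i j; rewrite (ord1 j) -sqrtr_sqr ler_wsqrtr// dotE.
  by move: i; apply: ord3P; nra.
by rewrite -(sqr_sqrtr (dot_ge0 u)) lerXn2r// nnegrE// sqrtr_ge0.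
Qed.

(** A matrix with three rows and two columns has a nonzero left kernel. Unlike the cross product,
    this also covers parallel [x] and [y], and [x = y]. *)
Lemma orthogonal_vector (x y : 'cV[R]_3) :
  exists v, [/\ v != 0, dot v x = 0 & dot v y = 0].
Proof.
pose M : 'M[R]_(3, 2) := row_mx x y.
have kM : kermx M != 0.
  rewrite -mxrank_eq0 mxrank_ker subn_eq0 -ltnNge.
  exact: leq_ltn_trans (rank_leq_col _) _.
have := nz_row_sub (kermx M); rewrite -nz_row_eq0 in kM.
rewrite sub_kermx => /eqP h.
have /eq_row_mx[hx hy] : row_mx (nz_row (kermx M) *m x) (nz_row (kermx M) *m y) = row_mx 0 0.
  by rewrite row_mx0 -mul_mx_row; exact: h.
exists (nz_row (kermx M))^T; split; first by rewrite trmx_eq0.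
  by rewrite /dot trmxK hx mxE.
by rewrite /dot trmxK hy mxE.
Qed.

Lemma det3 (M : 'M[R]_3) : \det M =
  M o0 o0 * (M o1 o1 * M o2 o2 - M o1 o2 * M o2 o1)
  - M o0 o1 * (M o1 o0 * M o2 o2 - M o1 o2 * M o2 o0)
  + M o0 o2 * (M o1 o0 * M o2 o1 - M o1 o1 * M o2 o0).
Proof.
rewrite (expand_det_row _ ord0) !big_ord_recl big_ord0 /cofactor.
rewrite !(expand_det_row _ ord0) !big_ord_recl !big_ord0 /cofactor !det_mx11 !mxE /=.
rewrite -[ord0]/(0 : 'I_3) o0E.
have h1 : lift o0 (ord0 : 'I_2) = o1 by apply/val_inj; rewrite /= !inordK.
have h2 : lift o0 (lift ord0 (ord0 : 'I_1)) = o2 by apply/val_inj; rewrite /= !inordK.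
have h3 : lift o1 (ord0 : 'I_2) = o0 by apply/val_inj; rewrite /= !inordK.
have h4 : lift o1 (lift ord0 (ord0 : 'I_1)) = o2 by apply/val_inj; rewrite /= !inordK.
have h5 : lift o2 (ord0 : 'I_2) = o0 by apply/val_inj; rewrite /= !inordK.
have h6 : lift o2 (lift ord0 (ord0 : 'I_1)) = o1 by apply/val_inj; rewrite /= !inordK.
have h7 : lift (lift ord0 ord0 : 'I_2) (0 : 'I_1) = ord0 by exact/val_inj.
rewrite ?h7 !(h1, h2, h3, h4, h5, h6) /=.
by rewrite /bump /= ?inordK//= ?addn0 ?add0n !(expr0, expr1, sqrrN, expr1n); ring.
Qed.

Lemma SO3_trmul (Q : 'M[R]_3) : SO3 Q -> Q^T *m Q = 1%:M.
Proof. by case. Qed.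

Lemma SO3_multr (Q : 'M[R]_3) : SO3 Q -> Q *m Q^T = 1%:M.
Proof. by move=> /SO3_trmul; exact: mulmx1C. Qed.

Lemma SO3_mul (Q Q' : 'M[R]_3) : SO3 Q -> SO3 Q' -> SO3 (Q *m Q').
Proof.
move=> [h d] [h' d']; split; last by rewrite det_mulmx d d' mulr1.
by rewrite trmx_mul -mulmxA (mulmxA Q^T) h mul1mx.
Qed.

Lemma SO3_norm_le (Q : 'M[R]_3) : SO3 Q -> `|Q| <= 1.
Proof.
move=> /SO3_trmul h; apply: mx_norm_le => // i j.
have := congr1 (fun M : 'M[R]_3 => M j j) h; rewrite mxE sum3 !mxE eqxx/=.
rewrite -(@expr_le1 _ 2)// real_normK ?num_real//.
by move: i; apply: ord3P; nra.
Qed.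

Lemma SO3_mul_norm m (Q : 'M[R]_3) (M : 'M[R]_(3, m)) : SO3 Q -> `|Q *m M| <= 3 * `|M|.
Proof.
move=> /SO3_norm_le h; apply: (le_trans (mx_normM _ _)).
by rewrite ler_wpM2r// ler_piMr.
Qed.

Lemma SO3_trmul_norm m (Q : 'M[R]_3) (M : 'M[R]_(3, m)) : SO3 Q -> `|Q^T *m M| <= 3 * `|M|.
Proof.
move=> /SO3_norm_le h; apply: (le_trans (mx_normM _ _)).
by rewrite ler_wpM2r// mx_norm_tr ler_piMr.
Qed.

(** Multiplying three vectors by [Q] multiplies their triple product by [\det Q]; entrywise this is
    a polynomial identity in the coefficients. *)
Lemma hat_conj (Q : 'M[R]_3) u : Q^T *m hat (Q *m u) *m Q = \det Q *: hat u.
Proof.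
by apply: mx3P; apply: ord3P; rewrite [RHS]mxE det3 hatE !mulmxE3 !hatE !mulmxE3 !mxE; ring.
Qed.

Lemma hat_rot (Q : 'M[R]_3) u : SO3 Q -> hat (Q *m u) *m Q = Q *m hat u.
Proof.
move=> hQ; have := hat_conj Q u; case: (hQ) => _ ->; rewrite scale1r => <-.
by rewrite !mulmxA SO3_multr// mul1mx.
Qed.

(** The rotation by pi about the axis [v]. It is rational in [v], so rotations can be built from it
    without angles or square roots. *)
Definition halfturn (v : 'cV[R]_3) : 'M[R]_3 := (2 / dot v v) *: (v *m v^T) - 1%:M.

Lemma halfturn_SO3 v : v != 0 -> SO3 (halfturn v).
Proof.
move=> /dot_gt0; rewrite dotE /halfturn => v0.
split; last first.
  by rewrite det3 !mxE !big_ord1 !mxE !ord3_neq !eqxx/= dotE; field; rewrite gt_eqF.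
by apply: mx3P; apply: ord3P; rewrite !mulmxE3 !mxE !big_ord1 !mxE ?ord3_neq ?eqxx/= dotE;
  field; rewrite gt_eqF.
Qed.

Lemma halfturnK v : v != 0 -> halfturn v *m halfturn v = 1%:M.
Proof.
move=> v0; rewrite -{1}[halfturn v]trmxK; have [<- _] := halfturn_SO3 v0.
congr (_ *m _); rewrite /halfturn linearB/= linearZ/= trmx_mul !trmxK trmx1.
by rewrite linearB/= linearZ/= trmx_mul trmxK trmx1.
Qed.

(* The product of the half-turns about [x + u] and about [x] takes [x] to [u]. *)
Lemma rotation_between (x u : 'cV[R]_3) (e : R) : dot x x = 1 -> dot u u = 1 ->
  `|x - u| <= e -> e <= 1 ->
  exists Q, [/\ SO3 Q, Q *m x = u & `|Q - 1%:M| <= 48 * e].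
Proof.
move=> hx hu xu e1.
have e0 : 0 <= e by exact: le_trans xu.
have d i : `|x i 0 - u i 0| <= e.
  by have := mx_norm_ge (x - u) i 0; rewrite !mxE => /le_trans; apply.
have hs : dot (x + u) (x + u) = 4 - dot (x - u) (x - u).
  have : 2 * dot x x + 2 * dot u u = 4 by rewrite hx hu; lra.
  by rewrite !dotE !mxE; lra.
have ds : dot (x - u) (x - u) <= 3 * e ^+ 2.
  rewrite dotE !mxE; have := d o0; have := d o1; have := d o2.
  rewrite !ler_norml => /andP[a1 a2] /andP[b1 b2] /andP[c1 c2]; nra.
have s1 : 1 <= dot (x + u) (x + u) by rewrite hs; nra.
have xu0 : x + u != 0.
  by apply/eqP => h; move: s1; rewrite h dotE !mxE !mulr0 !addr0 ler10.
have x0 : x != 0.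
  by apply/eqP => h; move: hx; rewrite h dotE !mxE !mulr0 !addr0 => /esym/eqP; rewrite oner_eq0.
exists (halfturn (x + u) *m halfturn x); split.
- by apply: SO3_mul; exact: halfturn_SO3.
- rewrite -mulmxA; have -> : halfturn x *m x = x.
    rewrite /halfturn mulmxBl mul1mx -scalemxAl -mulmxA hx.
    have -> : x^T *m x = 1%:M.
      by apply/matrixP => i j; rewrite !ord1 [RHS]mxE/=; exact: hx.
    by rewrite mulmx1 divr1 scaler_nat mulr2n addrK.
  rewrite /halfturn mulmxBl mul1mx -scalemxAl -mulmxA.
  have -> : (x + u)^T *m x = (dot (x + u) (x + u) / 2)%:M.
    apply/matrixP => i j; rewrite !ord1 [RHS]mxE/= mulr1n -[LHS]/(dot (x + u) x).
    have : dot x x + dot u u = 2 by rewrite hx hu; lra.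
    by move: hx; rewrite !dotE !mxE; lra.
  rewrite mul_mx_scalar scalerA (_ : 2 / _ * (_ / 2) = 1).
    by rewrite scale1r addrC addKr.
  by move: s1; set s := dot _ _ => s1; field; rewrite gt_eqF// (lt_le_trans _ s1).
(* Half-turns are involutions, so the product minus the identity is the difference of the two
   half-turns times [halfturn x]. The difference is at most [16 e] entrywise and the product costs
   3, whence 48. *)
- rewrite -(halfturnK x0) -mulmxBl.
  apply: (le_trans (mx_normM _ _)).
  have h1 := SO3_norm_le (halfturn_SO3 x0).
  suff h2 : `|halfturn (x + u) - halfturn x| <= 16 * e.
    apply: (@le_trans _ _ (3 * (16 * e) * 1)); last by lra.
    by rewrite ler_pM// ?mulr_ge0// ler_wpM2l.
  have xb i : `|x i 0| <= 1.
    rewrite -(@expr_le1 _ 2)// real_normK ?num_real//.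
    by move: hx; rewrite dotE; move: i; apply: ord3P; nra.
  apply: mx_norm_le; first by rewrite mulr_ge0.
  move=> i j; set s := dot (x + u) (x + u) in s1 hs *.
  have s0 : 0 < s by exact: lt_le_trans s1.
  rewrite /halfturn !mxE !big_ord1 !mxE -/s hx.
  have := d i; have := d j; have := xb i; have := xb j; move: ds hs.
  set D := dot _ _; have D0 : 0 <= D by exact: dot_ge0.
  set xi := x i 0; set xj := x j 0; set ui := u i 0; set uj := u j 0.
  set c := (i == j)%:R => De sD hxj hxi hdj hdi.
  have -> : 2 / s * ((xi + ui) * (xj + uj)) - c - (2 / 1 * (xi * xj) - c) =
    2 * (- 2 * (xi * (xj - uj)) - 2 * ((xi - ui) * xj) + (xi - ui) * (xj - uj) + D * (xi * xj)) / s.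
    by have -> : D = 4 - s; [lra|field; rewrite gt_eqF].
  rewrite normrM normfV (gtr0_norm s0) ler_pdivrMr//.
  apply: (@le_trans _ _ (16 * e)); last by rewrite ler_peMr// mulr_ge0.
  rewrite normrM (ger0_norm (ler0n _ 2)).
  have n1 : `|xi * (xj - uj)| <= e.
    by rewrite normrM -[e]mul1r ler_pM.
  have n2 : `|(xi - ui) * xj| <= e.
    by rewrite normrM -[e]mulr1 ler_pM.
  have n3 : `|(xi - ui) * (xj - uj)| <= e.
    by rewrite normrM -[e]mulr1 ler_pM// (le_trans hdj).
  have n4 : `|D * (xi * xj)| <= 3 * e.
    rewrite normrM (ger0_norm D0) -[3 * e]mulr1 ler_pM//; first nra.
    by rewrite normrM -[1]mulr1 ler_pM.
  suff : `|- 2 * (xi * (xj - uj)) - 2 * ((xi - ui) * xj) + (xi - ui) * (xj - uj)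
    + D * (xi * xj)| <= 8 * e by lra.
  rewrite !ler_norml in n1 n2 n3 n4 *; lra.
Qed.

(** Left composition of [Q] with the rotation taking [Q e_1] to [u]; the product raises 48 to
    144. *)
Lemma rotation_to (Q : 'M[R]_3) (u : 'cV[R]_3) (e : R) : SO3 Q -> dot u u = 1 ->
  `|Q *m e1 R - u| <= e -> e <= 1 ->
  exists Q', [/\ SO3 Q', Q' *m e1 R = u & `|Q' - Q| <= 144 * e].
Proof.
move=> hQ hu hd le1.
have h11 : dot (e1 R) (e1 R) = 1 by rewrite dotE !e1E; ring.
have [P [hP PQ Pd]] := rotation_between (etrans (dot_mul _ _ (SO3_trmul hQ)) h11) hu hd le1.
exists (P *m Q); split; first exact: SO3_mul.
  by rewrite -mulmxA.
have -> : P *m Q - Q = (P - 1%:M) *m Q by rewrite mulmxBl mul1mx.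
apply: (le_trans (mx_normM _ _)).
have e0 : 0 <= e by exact: le_trans hd.
apply: (@le_trans _ _ (3 * (48 * e) * 1)); last by lra.
by rewrite ler_pM// ?mulr_ge0// ?SO3_norm_le// ler_wpM2l.
Qed.

(** The exponential series stops after its linear term. The twist of a straight motion is of this
    kind, which makes [straight] an affine formula for the position and constancy of the
    attitude. *)
Lemma expmx_sqr0 (X : 'M[R]_(3 + 1)) : X *m X = 0 -> expmx X = 1%:M + X.
Proof.
move=> X0; rewrite /expmx; apply: norm_lim_near_cst; exists 2%N => // n /= n2.
rewrite seriesEnat/= -(subnKC n2) big_nat_recl// big_nat_recl//.
rewrite !expr0 !expr1 !fact0 !invr1 !scale1r big1 ?addr0//.
by move=> i _; rewrite !exprS mulrA -[X * X]/(X *m X) X0 mul0r scaler0.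
Qed.

Lemma hat0 : hat (0 : 'cV[R]_3) = 0.
Proof. by apply: mx3P; apply: ord3P; rewrite hatE !mxE ?oppr0. Qed.

Lemma straightE (Q : 'M[R]_3) (r : 'cV[R]_3) (t : R) :
  pose Q r *m expmx (t *: twist 0) = pose Q (r + t *: (Q *m e1 R)).
Proof.
rewrite expmx_sqr0; last first.
  rewrite /twist hat0 scale_block_mx !scaler0 mulmx_block.
  by rewrite !mul0mx !mulmx0 !addr0 block_mx0.
rewrite /twist hat0 scale_block_mx !scaler0 (@scalar_mx_block _ 3 1).
rewrite add_block_mx !addr0 add0r /pose mulmx_block !mulmx1 !mulmx0 !mul0mx !addr0 add0r.
by rewrite -scalemxAr addrC.
Qed.

Lemma pose_inj (Q Q' : 'M[R]_3) r r' : pose Q r = pose Q' r' -> Q = Q' /\ r = r'.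
Proof. by move=> /eq_block_mx[-> -> _ _]. Qed.

End Matrices.

(** * Exponential contraction in the consensus equation *)

Lemma connect_crossing (T : finType) (e : rel T) (S : {set T}) x y :
  connect e x y -> x \notin S -> y \in S ->
  exists u v, [/\ u \notin S, v \in S & e u v].
Proof.
move=> /connectP[p + ->]; elim: p x => [|z p IH] x /=.
  by move=> _ /negbTE ->.
move=> /andP[xz pz] xS lS; have [zS|zS] := boolP (z \in S); last exact: IH pz zS lS.
by exists x, z.
Qed.

Section Consensus.
Variables (R : realType) (N : nat) (eta gamma : R) (A : R -> 'M[R]_N).
Hypothesis hA : communication_graph eta gamma A.
Hypothesis hconn : uniformly_connected eta A.
Implicit Types (a b t m M : R) (y : 'I_N -> R -> R) (k i j : 'I_N).

Let G := N%:R * gamma.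

Lemma weight_bounds t k j : 0 <= t -> 0 <= A t k j <= gamma.
Proof.
case: hA => /andP[e0 eg] _ _ _ h t0.
have [->|/andP[h1 h2]] := h t k j t0; first by rewrite lexx (le_trans (ltW e0)).
by rewrite h2 andbT (le_trans (ltW e0)).
Qed.

Lemma gamma_gt0 : 0 < gamma.
Proof. by case: hA => /andP[e0 eg] _ _ _ _; exact: lt_le_trans eg. Qed.

Let G0 : 0 <= G. Proof. by rewrite mulr_ge0// ltW// gamma_gt0. Qed.

Lemma sum_weights_le t k : 0 <= t -> \sum_j A t k j <= G.
Proof.
move=> t0; apply: (@le_trans _ _ (\sum_(j < N) gamma)).
  by apply: ler_sum => j _; case/andP: (weight_bounds k j t0).
by rewrite sumr_const card_ord -mulr_natl.
Qed.

(** Here [y] is one scalar coordinate of the vectors [w_k]: the consensus equation does not couple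
    the three coordinates, and for scalars the spread is a difference of bounds. *)
Definition diffusion y : 'I_N -> R -> R :=
  fun k t => \sum_j A t k j * (y j t - y k t).

Definition consensus_dynamics a y := forall k b, pw_derive a b (y k) (diffusion y k).

Lemma consensus_dynamics_sub a a' y : a <= a' -> consensus_dynamics a y ->
  consensus_dynamics a' y.
Proof. by move=> aa h k b; exact: pw_derive_sub (h k b). Qed.

Lemma consensus_dynamicsN a y : consensus_dynamics a y ->
  consensus_dynamics a (fun k t => - y k t).
Proof.
move=> h k b; apply: pw_derive_ext (pw_deriveN (h k b)) => t _.
by rewrite /diffusion -sumrN; apply: eq_bigr => j _; ring.
Qed.

(* The weight [expR (G (t - a))] compensates the outflow, so that [z] obeys a
   linear system with nonnegative coefficients. *)
Let z a m y k t := expR (G * (t - a)) * (y k t - m).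

Let dz a m y k t :=
  \sum_j A t k j * z a m y j t + (G - \sum_j A t k j) * z a m y k t.

Let z_pw a a' m y k b : consensus_dynamics a' y ->
  pw_derive a' b (z a m y k) (dz a m y k).
Proof.
move=> h.
apply: pw_derive_ext (pw_deriveM (pw_derive_exp _ _ G a) (pw_deriveB (h k b) (pw_derive_cst _ _ m))).
move=> t _; rewrite /dz /z /diffusion subr0 mulr_sumr mulrBl mulr_suml.
set e := expR _; rewrite (eq_bigr (fun j => A t k j * (e * (y j t - m)) - A t k j * (e * (y k t - m)))); last first.
  by move=> j _; ring.
by rewrite sumrB; ring.
Qed.

Let z_ge0 a m y : 0 <= a -> consensus_dynamics a y -> (forall k, m <= y k a) ->
  forall k b, a <= b -> 0 <= z a m y k b.
Proof.
move=> a0 h hm k b ab; move: k.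
apply: (@cooperative_ge0 _ _ a b G (z a m y) (dz a m y)) => //.
- by move=> k; exact: z_pw.
- by move=> k; rewrite mulr_ge0 ?expR_ge0// subr_ge0.
- move=> t S /andP[at_ _] S0 hS k.
  have t0 : 0 <= t by rewrite (le_trans a0)// ltW.
  have h1 : - (\sum_j A t k j) * S <= \sum_j A t k j * z a m y j t.
    rewrite mulNr mulr_suml -sumrN; apply: ler_sum => j _.
    by rewrite -mulrN ler_wpM2l//; case/andP: (weight_bounds k j t0).
  have h2 : - (G - \sum_j A t k j) * S <= (G - \sum_j A t k j) * z a m y k t.
    by rewrite mulNr -mulrN ler_wpM2l// subr_ge0 sum_weights_le.
  by rewrite /dz; lra.
Qed.

Lemma consensus_lower a m y : 0 <= a -> consensus_dynamics a y ->
  (forall k, m <= y k a) -> forall k b, a <= b -> m <= y k b.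
Proof.
move=> a0 h hm k b ab; have := z_ge0 a0 h hm k ab.
by rewrite /z pmulr_rge0 ?expR_gt0// subr_ge0.
Qed.

Lemma consensus_upper a M y : 0 <= a -> consensus_dynamics a y ->
  (forall k, y k a <= M) -> forall k b, a <= b -> y k b <= M.
Proof.
move=> a0 h hM k b ab; rewrite -lerN2.
by apply: (consensus_lower a0 (consensus_dynamicsN h)) => // j; rewrite lerN2.
Qed.

Lemma consensus_norm_le a M y : 0 <= a -> consensus_dynamics a y ->
  (forall k, `|y k a| <= M) -> forall k b, a <= b -> `|y k b| <= M.
Proof.
move=> a0 h hM k b ab; rewrite ler_norml; apply/andP; split.
  by apply: (consensus_lower a0 h) => // j; have := hM j; rewrite ler_norml => /andP[].
by apply: (consensus_upper a0 h) => // j; have := hM j; rewrite ler_norml => /andP[].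
Qed.

Let dz_ge a m y k i t : 0 <= t -> (forall j, 0 <= z a m y j t) ->
  A t k i * z a m y i t <= dz a m y k t.
Proof.
move=> t0 hz; rewrite /dz (bigD1 i)//= -addrA lerDl addr_ge0//.
  by apply: sumr_ge0 => j _; rewrite mulr_ge0//; case/andP: (weight_bounds k j t0).
by rewrite mulr_ge0// subr_ge0 sum_weights_le.
Qed.

Let z_ndecr a m y : 0 <= a -> consensus_dynamics a y -> (forall k, m <= y k a) ->
  forall k s t, a <= s -> s <= t -> z a m y k s <= z a m y k t.
Proof.
move=> a0 h hm k s t as_ st.
apply: (pw_derive_ndecr st (z_pw a m k t (consensus_dynamics_sub as_ h))).
move=> u /andP[su _]; have au : a <= u by rewrite (le_trans as_)// ltW.
have u0 := le_trans a0 au.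
apply: le_trans (@dz_ge a m y k k u u0 _); last by move=> j; exact: z_ge0.
by rewrite mulr_ge0// ?z_ge0//; case/andP: (weight_bounds k k u0).
Qed.

Lemma weight_primitive k j a b : 0 <= a -> a <= b ->
  pw_derive a b (primitive a (fun t => A t k j)) (fun t => A t k j).
Proof.
move=> a0 ab; case: hA => _ /(_ k j)[/(_ b)[D hD] _ _] _ _ _.
apply: (@primitive_pw_derive _ a b D gamma).
  by move=> t /andP[at_ tb]; apply: hD; rewrite tb andbT (le_lt_trans a0).
move=> t /andP[at_ _]; have /andP[h1 h2] := weight_bounds k j (le_trans a0 at_).
by rewrite ger0_norm.
Qed.

(** Agent [j] listens to agent [i]: [z_j' >= a_ji z_i], where [z_i] is nondecreasing and [a_ji] has
    integral at least [delta] over the window. *)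
Let z_edge a m y delta T t j i : 0 <= a -> consensus_dynamics a y ->
  (forall k, m <= y k a) -> a <= t -> 0 <= T -> window_edge eta delta A t (t + T) j i ->
  delta * z a m y i t <= z a m y j (t + T).
Proof.
move=> a0 h hm at_ T0 /andP[_ hint].
have tT : t <= t + T by rewrite lerDl.
have t0 := le_trans a0 at_.
have zi0 : 0 <= z a m y i t by exact: z_ge0.
have := pw_derive_le tT (pw_deriveZ (z a m y i t) (weight_primitive j i t0 tT))
  (z_pw a m j (t + T) (consensus_dynamics_sub at_ h)) _.
rewrite primitive_a mulr0 subr0 => h1.
have {}h1 : z a m y i t * primitive t (fun t => A t j i) (t + T) <=
    z a m y j (t + T) - z a m y j t.
  apply: h1 => u /andP[tu _]; have au : a <= u by rewrite (le_trans at_)// ltW.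
  have u0 := le_trans a0 au.
  apply: le_trans (@dz_ge a m y j i u u0 _); last by move=> k; exact: z_ge0.
  rewrite mulrC ler_wpM2l//; first by case/andP: (weight_bounds j i u0).
  by apply: z_ndecr => //; exact: ltW.
have : z a m y i t * delta <= z a m y i t * primitive t (fun t => A t j i) (t + T).
  by rewrite ler_wpM2l.
have : 0 <= z a m y j t by exact: z_ge0.
by lra.
Qed.

(** A set of agents influenced by the root gains a member in each window, until it contains all of
    them: a path to the root from an agent outside has an edge entering the set, along which a
    fraction [delta] is passed on. The minimum with 1 makes the powers of the factor nonincreasing,
    so members recruited earlier keep their bound, and [N] windows reach everyone. *)
Let spread_from_root T delta k0 : 0 < T -> 0 < delta ->
  (forall t, 0 <= t -> forall j, j != k0 ->
     connect (window_edge eta delta A t (t + T)) j k0) ->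
  forall a m y, 0 <= a -> consensus_dynamics a y -> (forall k, m <= y k a) ->
  forall k, Num.min delta 1 ^+ N * z a m y k0 a <= z a m y k (a + N%:R * T).
Proof.
move=> T0 d0 hc a m y a0 h hm; set d := Num.min delta 1.
have dge0 : 0 <= d by rewrite le_min ltW//= ler01.
have d1 : d <= 1 by rewrite ge_min lexx orbT.
have dd : d <= delta by rewrite ge_min lexx.
have step n : a <= a + n%:R * T by rewrite lerDl mulr_ge0// ltW.
have zk0 k t : a <= t -> 0 <= z a m y k t by move=> at_; exact: z_ge0.
have claim (n : nat) : exists S : {set 'I_N},
    [/\ k0 \in S, (n < #|S|)%N \/ forall i, i \in S
      & forall i, i \in S -> d ^+ n * z a m y k0 a <= z a m y i (a + n%:R * T)].
  elim: n => [|n [S [k0S cS hS]]].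
    exists [set k0]%SET; rewrite cards1; split; [exact: set11|by left|].
    by move=> i /finset.set1P ->; rewrite expr0 mul1r mul0r addr0.
  have grow i : i \in S -> d ^+ n.+1 * z a m y k0 a <= z a m y i (a + n.+1%:R * T).
    move=> /hS hi; apply: (@le_trans _ _ (z a m y i (a + n%:R * T))).
      apply: le_trans hi; rewrite exprS -mulrA ler_piMl// mulr_ge0 ?exprn_ge0//.
      exact: zk0.
    by apply: z_ndecr => //; rewrite lerD2l ler_pM2r// ler_nat.
  have [/forallP E|] := boolP [forall x, x \in S].
    by exists S; split=> //; right.
  rewrite negb_forall => /existsP[x xS].
  have xk0 : x != k0 by apply: contraNneq xS => ->.
  have t0 : 0 <= a + n%:R * T by rewrite (le_trans a0).
  have [j [i [jS iS e]]] := connect_crossing (hc _ t0 _ xk0) xS k0S.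
  exists (j |: S); split.
  - by rewrite inE k0S orbT.
  - by case: cS => cS; [left; rewrite cardsU1 jS add1n ltnS|move: xS; rewrite cS].
  - move=> l /setU1P[->|]; last exact: grow.
    have := z_edge a0 h hm (step n) (ltW T0) e.
    have -> : a + n.+1%:R * T = a + n%:R * T + T by rewrite -natr1; ring.
    apply: le_trans.
    rewrite exprS -mulrA; apply: ler_pM => //; last exact: hS.
    by rewrite mulr_ge0 ?exprn_ge0// zk0.
have [S [_ cS hS]] := claim N.
move=> k; apply: hS; case: cS => // cS.
by have := max_card (mem S); rewrite card_ord leqNgt cS.
Qed.

(** If the root lies in the upper half of the interval, its influence raises the lower end for all
    agents; otherwise the same argument for [- y] lowers the upper end. The half-width gives
    [eps / 2], and [expR (- (G * tau))] undoes the weight in [z]. *)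
Lemma spread_contraction : exists tau q, [/\ 0 < tau, 0 < q < 1 &
  forall a y m M, 0 <= a -> consensus_dynamics a y ->
    (forall k, m <= y k a <= M) ->
    exists m' M', [/\ M' - m' = q * (M - m), m <= m', M' <= M
      & forall k, m' <= y k (a + tau) <= M']].
Proof.
have [T [delta [k0 [T0 d0 hc]]]] := hconn.
have N0 : 0 < N%:R :> R by rewrite ltr0n (leq_ltn_trans _ (ltn_ord k0)).
pose d := Num.min delta 1.
have dgt0 : 0 < d by rewrite lt_min d0 ltr01.
have d1 : d <= 1 by rewrite ge_min lexx orbT.
pose tau := N%:R * T; pose eps := expR (- (G * tau)) * d ^+ N.
have tau0 : 0 < tau by rewrite mulr_gt0.
have eps0 : 0 < eps by rewrite mulr_gt0 ?expR_gt0// exprn_gt0.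
have eps1 : eps <= 1.
  rewrite -[leRHS]mulr1 ler_pM ?expR_ge0 ?exprn_ge0 ?exprn_ile1// ?(ltW dgt0)//.
  by rewrite -[leRHS]expR0 ler_expR oppr_le0 mulr_ge0// ltW.
have low a y m : 0 <= a -> consensus_dynamics a y -> (forall k, m <= y k a) ->
    forall k, m + eps * (y k0 a - m) <= y k (a + tau).
  move=> a0 h hm k; have := spread_from_root T0 d0 hc a0 h hm k.
  rewrite /z subrr mulr0 expR0 mul1r addrAC subrr add0r -/tau -/d => h1.
  rewrite -lerBrDl /eps expRN -mulrA ler_pdivrMl ?expR_gt0//.
exists tau, (1 - eps / 2); split=> //; first by apply/andP; split; lra.
move=> a y m M a0 h hmM.
have hm k : m <= y k a by case/andP: (hmM k).
have hM k : y k a <= M by case/andP: (hmM k).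
have at_ : a <= a + tau by rewrite lerDl ltW.
have [hk|/ltW hk] := leP ((m + M) / 2) (y k0 a).
  exists (m + eps / 2 * (M - m)), M; split=> //; first by ring.
    by have := le_trans (hm k0) (hM k0); nra.
  move=> k; rewrite (consensus_upper a0 h)// andbT.
  by apply: le_trans (low _ _ _ a0 h hm k); nra.
exists m, (M - eps / 2 * (M - m)); split=> //; first by ring.
  by have := le_trans (hm k0) (hM k0); nra.
move=> k; rewrite (consensus_lower a0 h)//=.
have := low a (fun k t => - y k t) (- M) a0 (consensus_dynamicsN h) _ k.
have hN j : - M <= - y j a by rewrite lerN2.
by move=> /(_ hN); nra.
Qed.

Lemma exponential_consensus : exists C l, [/\ 0 < C, 0 < l &
  forall a y m M, 0 <= a -> consensus_dynamics a y ->
    (forall k, m <= y k a <= M) ->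
    forall t, a <= t -> forall k j,
      `|y k t - y j t| <= C * expR (- l * (t - a)) * (M - m)].
Proof.
have [tau [q [tau0 /andP[q0 q1] hq]]] := spread_contraction.
pose l := - ln q / tau.
have l0 : 0 < l by rewrite divr_gt0// oppr_gt0 ln_lt0// q0.
have expq : expR (- (l * tau)) = q.
  by rewrite /l divfK ?gt_eqF// opprK lnK.
(* The rate satisfies [expR (- l tau) = q], and the factor [q^-1] pays for the incomplete last
   window. *)
exists q^-1, l; split=> //; first by rewrite invr_gt0.
move=> a y m M a0 h hmM t at_ k j.
have iter n : exists m' M', [/\ M' - m' <= q ^+ n * (M - m) &
    forall k, m' <= y k (a + n%:R * tau) <= M'].
  elim: n => [|n [m1 [M1 [hs hb]]]].
    by exists m, M; rewrite expr0 mul1r mul0r addr0.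
  have an : a <= a + n%:R * tau by rewrite lerDl mulr_ge0// ltW.
  have [m2 [M2 [e _ _ hb2]]] := hq _ y m1 M1 (le_trans a0 an) (consensus_dynamics_sub an h) hb.
  exists m2, M2; split; first by rewrite e exprS -mulrA ler_wpM2l// ltW.
  by move=> i; rewrite -natr1 mulrDl mul1r addrA.
have s0 : 0 <= (t - a) / tau by rewrite divr_ge0 ?subr_ge0// ltW.
have /andP[n1 n2] := truncn_itv s0; set n := Num.truncn _ in n1 n2.
have [m' [M' [hs hb]]] := iter n.
rewrite ler_pdivlMr// in n1; rewrite ltr_pdivrMr// in n2.
have an : a <= a + n%:R * tau by rewrite lerDl mulr_ge0// ltW.
have nt : a + n%:R * tau <= t by lra.
have hn := consensus_dynamics_sub an h; have an0 := le_trans a0 an.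
have lo i : m' <= y i t by apply: (consensus_lower an0 hn) => // i'; case/andP: (hb i').
have up i : y i t <= M' by apply: (consensus_upper an0 hn) => // i'; case/andP: (hb i').
apply: (@le_trans _ _ (M' - m')).
  by have := lo k; have := lo j; have := up k; have := up j; rewrite ler_norml; lra.
apply: (le_trans hs); rewrite ler_wpM2r//.
  by have /andP[h1 h2] := hmM k; rewrite subr_ge0 (le_trans h1).
rewrite mulrC ler_pdivlMr// -exprSr -expq -expRM_natl ler_expR.
by rewrite mulrN !mulNr lerN2 mulrCA ler_pM2l// ltW.
Qed.

Lemma diffusion_le y t k (S : R) : 0 <= t -> (forall j, `|y j t - y k t| <= S) ->
  `|diffusion y k t| <= G * S.
Proof.
move=> t0 hS; rewrite /diffusion (le_trans (ler_norm_sum _ _ _))//.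
apply: (@le_trans _ _ (\sum_(j < N) gamma * S)).
  apply: ler_sum => j _; rewrite normrM; have /andP[h1 h2] := weight_bounds k j t0.
  by rewrite ler_pM// ger0_norm.
by rewrite sumr_const card_ord -[leLHS]mulr_natl mulrA.
Qed.

End Consensus.

(** * Entrywise calculus for matrix-valued functions *)

Section MatrixDerivatives.
Variable R : realType.

Lemma is_derive_mx_coord m n (F : R -> 'M[R]_(m, n)) dF (t : R) i j :
  is_derive t 1 F dF -> is_derive t 1 (fun x => F x i j) (dF i j).
Proof.
move=> [hF <-]; have h := (derivable_mxP F t 1).1 hF i j.
by apply: DeriveDef => //; rewrite derive_mx// mxE.
Qed.

Lemma is_derive_mx m n (F : R -> 'M[R]_(m, n)) (dF : 'M[R]_(m, n)) (t : R) :
  (forall i j, is_derive t 1 (fun x => F x i j) (dF i j)) -> is_derive t 1 F dF.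
Proof.
move=> h; have hF : derivable F t 1.
  by apply/derivable_mxP => i j; case: (h i j).
apply: DeriveDef => //; rewrite derive_mx//; apply/matrixP => i j.
by rewrite mxE; case: (h i j).
Qed.

Lemma is_derive_big (I : Type) (r : seq I) (f : I -> R -> R) (df : I -> R) (t : R) :
  (forall i, is_derive t 1 (f i) (df i)) ->
  is_derive t 1 (fun x => \sum_(i <- r) f i x) (\sum_(i <- r) df i).
Proof.
move=> h; elim: r => [|i r IH].
  rewrite big_nil (_ : (fun x => _) = cst 0); first exact: is_derive_cst.
  by apply/funext => x; rewrite big_nil.
rewrite big_cons (_ : (fun x => _) = f i + (fun x => \sum_(i <- r) f i x)).
  exact: is_deriveD.
by apply/funext => x; rewrite big_cons.
Qed.

Lemma is_derive_mulmx m n p (F : R -> 'M[R]_(m, n)) (G : R -> 'M[R]_(n, p)) dF dG (t : R) :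
  is_derive t 1 F dF -> is_derive t 1 G dG ->
  is_derive t 1 (fun x => F x *m G x) (dF *m G t + F t *m dG).
Proof.
move=> hF hG; apply: is_derive_mx => i j.
have -> : (fun x => (F x *m G x) i j) = (fun x => \sum_k F x i k * G x k j).
  by apply/funext => x; rewrite mxE.
rewrite !mxE -big_split; apply: is_derive_big => k.
have := is_deriveM (is_derive_mx_coord i k hF) (is_derive_mx_coord k j hG).
by rewrite /GRing.scale/= addrC (mulrC (G t k j)).
Qed.

Lemma is_derive_trmx m n (F : R -> 'M[R]_(m, n)) dF (t : R) :
  is_derive t 1 F dF -> is_derive t 1 (fun x => (F x)^T) dF^T.
Proof.
move=> hF; apply: is_derive_mx => i j.
have -> : (fun x => (F x)^T i j) = (fun x => F x j i) by apply/funext => x; rewrite mxE.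
by rewrite mxE; exact: is_derive_mx_coord.
Qed.

Lemma is_derive_line m n (M M' : 'M[R]_(m, n)) (a t : R) :
  is_derive t 1 (fun x => M + (x - a) *: M') M'.
Proof.
apply: is_derive_mx => i j.
have -> : (fun x => (M + (x - a) *: M') i j) =
    cst (M i j - a * M' i j) + cst (M' i j) * id.
  by apply/funext => x; rewrite mxDE mxZE -[RHS]/(M i j - a * M' i j + M' i j * x); ring.
rewrite -[X in is_derive _ _ _ X]add0r; apply: is_deriveD.
have := is_deriveM (is_derive_cst (M' i j) t 1) (is_derive_id t 1).
by rewrite /GRing.scale/= mulr0 addr0 mulr1.
Qed.

Definition mx_pw_derive m n (a b : R) (F dF : R -> 'M[R]_(m, n)) :=
  forall i j, pw_derive a b (fun t => F t i j) (fun t => dF t i j).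

Lemma mx_pw_derive_ext m n (a b : R) (F dF dF' : R -> 'M[R]_(m, n)) :
  (forall t, a < t < b -> dF t = dF' t) -> mx_pw_derive a b F dF ->
  mx_pw_derive a b F dF'.
Proof. by move=> e h i j; apply: pw_derive_ext (h i j) => t /e ->. Qed.

Lemma mx_pw_derive_cst m n (a b : R) (M : 'M[R]_(m, n)) :
  mx_pw_derive a b (fun=> M) (fun=> 0).
Proof. by move=> i j; apply: pw_derive_ext (pw_derive_cst _ _ _) => t _; rewrite mxE. Qed.

Lemma mx_pw_deriveB m n (a b : R) (F dF G dG : R -> 'M[R]_(m, n)) :
  mx_pw_derive a b F dF -> mx_pw_derive a b G dG ->
  mx_pw_derive a b (fun t => F t - G t) (fun t => dF t - dG t).
Proof.
move=> hF hG i j; apply: pw_derive_ext (pw_derive_eqf _ (pw_deriveB (hF i j) (hG i j)));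
by move=> t _; rewrite !mxE.
Qed.

Lemma mx_pw_derive_tr m n (a b : R) (F dF : R -> 'M[R]_(m, n)) :
  mx_pw_derive a b F dF -> mx_pw_derive a b (fun t => (F t)^T) (fun t => (dF t)^T).
Proof.
by move=> hF i j; apply: pw_derive_ext (pw_derive_eqf _ (hF j i)) => t _; rewrite mxE.
Qed.

Lemma mx_pw_deriveM m n p (a b : R) (F dF : R -> 'M[R]_(m, n)) (G dG : R -> 'M[R]_(n, p)) :
  mx_pw_derive a b F dF -> mx_pw_derive a b G dG ->
  mx_pw_derive a b (fun t => F t *m G t) (fun t => dF t *m G t + F t *m dG t).
Proof.
move=> hF hG i j.
have h k : xpredT k -> pw_derive a b (fun t => F t i k * G t k j)
    (fun t => dF t i k * G t k j + F t i k * dG t k j).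
  by move=> _; exact: pw_deriveM.
by apply: pw_derive_ext (pw_derive_eqf _ (pw_derive_sum (index_enum 'I_n) h));
  move=> t _; rewrite !mxE// big_split.
Qed.

Lemma mx_pw_derive0 m n (a b : R) (F dF : R -> 'M[R]_(m, n)) : a <= b ->
  mx_pw_derive a b F dF -> (forall t, a < t < b -> dF t = 0) -> F b = F a.
Proof.
move=> ab h h0; apply/matrixP => i j; apply: (pw_derive0 ab (h i j)) => t /h0 ->.
by rewrite mxE.
Qed.

Lemma linear_eq0_mx m n (I : finType) (a b K : R) (F dF : I -> R -> 'M[R]_(m, n)) :
  a <= b -> 0 <= K -> (forall k, mx_pw_derive a b (F k) (dF k)) ->
  (forall k, F k a = 0) ->
  (forall t S, a < t < b -> 0 <= S -> (forall k, `|F k t| <= S) ->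
    forall k, `|dF k t| <= K * S) ->
  forall k, F k b = 0.
Proof.
move=> ab K0 hF F0 hd k; apply/matrixP => i j; rewrite mxE.
apply: (@linear_eq0 _ [the finType of (I * ('I_m * 'I_n))%type] a b K
  (fun x t => F x.1 t x.2.1 x.2.2) (fun x t => dF x.1 t x.2.1 x.2.2) ab K0 _ _ _ (k, (i, j))) => /=.
- by move=> [k' [i' j']] /=; exact: hF.
- by move=> [k' [i' j']] /=; rewrite F0 mxE.
- move=> t S tab S0 hS [k' [i' j']] /=.
  apply: le_trans (mx_norm_ge _ _ _) _; apply: hd => // k2.
  by apply: mx_norm_le => // i2 j2; exact: (hS (k2, (i2, j2))).
Qed.

Lemma within_continuousD (I : set R) (f g : R -> R) : {within I, continuous f} ->
  {within I, continuous g} -> {within I, continuous (fun t => f t + g t)}.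
Proof. by move=> cf cg x; apply: continuousD; [exact: cf|exact: cg]. Qed.

Lemma within_continuousM (I : set R) (f g : R -> R) : {within I, continuous f} ->
  {within I, continuous g} -> {within I, continuous (fun t => f t * g t)}.
Proof. by move=> cf cg x; apply: continuousM; [exact: cf|exact: cg]. Qed.

Lemma within_mx m n (I : set R) (F : R -> 'M[R]_(m, n)) :
  (forall i j, {within I, continuous (fun t => F t i j)}) -> {within I, continuous F}.
Proof.
move=> h; apply/subspace_continuousP => x Ix; apply/cvgrPdist_le => e e0.
near=> t; apply: mx_norm_le => [|i j]; first exact: ltW.
rewrite !mxE; move: i j; near: t.
apply: filter_forall => i; apply: filter_forall => j.
have /subspace_continuousP/(_ x Ix)/cvgrPdist_le := h i j.
exact.
Unshelve. all: by end_near. Qed.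

Lemma within_mx_coord m n (I : set R) (F : R -> 'M[R]_(m, n)) i j :
  {within I, continuous F} -> {within I, continuous (fun t => F t i j)}.
Proof.
move=> h; apply/subspace_continuousP => x Ix; apply/cvgrPdist_le => e e0.
have /subspace_continuousP/(_ x Ix)/cvgrPdist_le/(_ e e0) := h.
apply: filterS => t; apply: le_trans.
by have := mx_norm_ge (F x - F t) i j; rewrite !mxE.
Qed.

Lemma within_ray (V : normedModType R) (a : R) (f : R -> V) (I : set R) :
  I `<=` [set t | a <= t] ->
  (forall b, {within `[a, b], continuous f}) -> {within I, continuous f}.
Proof.
move=> hI h; apply/subspace_continuousP => x Ix; apply/cvgrPdist_le => e e0.
have ax := hI _ Ix.
have /subspace_continuousP/(_ x) := h (x + 1).
rewrite /= in_itv/= ax lerDl ler01 => /(_ isT)/cvgrPdist_le/(_ e e0).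
rewrite !near_withinE => hn; near=> t => It.
have /= at_ := hI _ It.
have : t \in `[a, x + 1] -> `|f x - f t| <= e by near: t.
apply; rewrite in_itv/= at_/=.
have : t \in `](x - 1), (x + 1)[.
  by near: t; apply: near_in_itvoo; rewrite in_itv/= ltrBlDr !ltrDl ltr01.
by rewrite in_itv/= => /andP[_ /ltW].
Unshelve. all: by end_near. Qed.

End MatrixDerivatives.

(** * Algebra of the closed-loop vector field *)

Section ClosedLoopField.
Variables (R : realType) (N : nat).
Implicit Types (p : state R N) (A : R -> 'M[R]_N) (k j : 'I_N).

Lemma stateP p p' : (forall k, pos p k = pos p' k) -> (forall k, att p k = att p' k) ->
  (forall k, cons p k = cons p' k) -> p = p'.
Proof.
case: p => r Q b; case: p' => r' Q' b' /= h1 h2 h3.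
by congr State; apply/funext.
Qed.

Lemma hat_tr (u : 'cV[R]_3) : (hat u)^T = - hat u.
Proof. by apply: mx3P; apply: ord3P; rewrite [LHS]mxE [RHS]mxE !hatE ?oppr0 ?opprK. Qed.

Lemma laplacian_sum (W : 'M[R]_N) k (w : 'I_N -> 'cV[R]_3) : W k k = 0 ->
  \sum_j laplacian W k j *: w j = - \sum_j W k j *: (w j - w k).
Proof.
move=> Wk; rewrite (bigD1 k)//= mxE eqxx -sumrN [RHS](bigD1 k)//= subrr scaler0 oppr0 add0r.
rewrite (bigD1 k)//= Wk add0r scaler_suml -big_split/=; apply: eq_bigr => j jk.
by rewrite mxE (negbTE jk) scalerBr scaleNr opprB.
Qed.

Definition cons_abs_rate A t p k : 'cV[R]_3 :=
  \sum_j A t k j *: (cons_abs p j - cons_abs p k).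

Lemma att_mulK p k m (M : 'M[R]_(3, m)) : rotations p ->
  att p k *m ((att p k)^T *m M) = M.
Proof. by move=> hp; rewrite mulmxA (SO3_multr (hp k)) mul1mx. Qed.

Lemma att_trmulK p k m (M : 'M[R]_(3, m)) : rotations p ->
  (att p k)^T *m (att p k *m M) = M.
Proof. by move=> hp; rewrite mulmxA (SO3_trmul (hp k)) mul1mx. Qed.

Lemma field_cons A t p k : A t k k = 0 ->
  cons (field A t p) k =
  (hat (control p k))^T *m cons p k + (att p k)^T *m cons_abs_rate A t p k.
Proof.
move=> Ak /=; congr (_ + _); rewrite -[RHS]opprK -mulmxN /cons_abs_rate.
rewrite -(laplacian_sum (cons_abs p) Ak) mulmx_sumr; congr (- _); apply: eq_bigr => j _.
by rewrite -scalemxAr mulmxA.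
Qed.

(** The rotation of the frame contributes [R_k hat(u_k) b_k] and the transport term of the control
    law contributes its opposite, [hat] being skew; only the coupling survives. *)
Lemma cons_abs_fieldE A t p k : A t k k = 0 -> rotations p ->
  cons_abs_field A t p k = cons_abs_rate A t p k.
Proof.
move=> Ak hp; rewrite /cons_abs_field field_cons// mulmxDr att_mulK// addrA.
by rewrite /= hat_tr mulNmx mulmxN mulmxA subrr add0r.
Qed.

Lemma control_E p k : (control p k o0 0 = 0) * (control p k o1 0 = - cons p k o2 0) *
  (control p k o2 0 = cons p k o1 0).
Proof. by rewrite /control !crossE !e1E; split; [split|]; ring. Qed.

Lemma hat_control_cons p k : let v := (hat (control p k))^T *m cons p k in
  (v o0 0 = cons p k o1 0 ^+ 2 + cons p k o2 0 ^+ 2) *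
  (v o1 0 = - cons p k o0 0 * cons p k o1 0) *
  (v o2 0 = - cons p k o0 0 * cons p k o2 0).
Proof.
have trE (i j : 'I_3) : (hat (control p k))^T i j = hat (control p k) j i by rewrite mxE.
by rewrite /= !mulmxE3 !trE !hatE !control_E; split; [split|]; ring.
Qed.

Lemma hat_control_e1 p k : hat (control p k) *m e1 R = cons p k - cons p k o0 0 *: e1 R.
Proof.
by apply: cV3P; rewrite mxBE mxZE mulmxE3 !hatE !control_E !e1E; ring.
Qed.

Lemma vel_rate p k : att p k *m hat (control p k) *m e1 R =
  cons_abs p k - cons p k o0 0 *: vel p k.
Proof. by rewrite -mulmxA hat_control_e1 mulmxBr -scalemxAr. Qed.

Lemma dot_vel_cons p k : rotations p -> dot (vel p k) (cons_abs p k) = cons p k o0 0.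
Proof.
by move=> hp; rewrite dot_mul ?SO3_trmul// dotE !e1E; ring.
Qed.

Lemma dot_vel p k : rotations p -> dot (vel p k) (vel p k) = 1.
Proof. by move=> hp; rewrite dot_mul ?SO3_trmul// dotE !e1E; ring. Qed.

Lemma vel_norm_le p k : rotations p -> `|vel p k| <= 1.
Proof.
move=> hp; rewrite -(@expr_le1 _ 2)//; apply: (le_trans (norm_sqr_le_dot _)).
by rewrite dot_vel.
Qed.

Lemma dot_cons_abs p k : rotations p ->
  dot (cons_abs p k) (cons_abs p k) = dot (cons p k) (cons p k).
Proof. by move=> hp; rewrite dot_mul// SO3_trmul. Qed.

(** The corner entry of a relative attitude is the cosine of the angle between two velocities: the
    observable of the shape by which the instability proofs detect departure from a limit set. *)
Lemma rel_att_dot p k j : rel_att p k j 0 0 = dot (vel p k) (vel p j).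
Proof.
rewrite /dot /vel trmx_mul -mulmxA (mulmxA (att p k)^T) -/(rel_att p k j).
by rewrite /e1 trmx_delta -rowE -colE !mxE.
Qed.

Lemma hatB (u v : 'cV[R]_3) : hat (u - v) = hat u - hat v.
Proof.
by apply: mx3P; apply: ord3P; rewrite mxBE !hatE ?mxBE; ring.
Qed.

Lemma norm_hat_le (u : 'cV[R]_3) : `|hat u| <= `|u|.
Proof.
apply: mx_norm_le => // i j; move: i j; apply: ord3P; apply: ord3P;
by rewrite hatE ?normr0 ?normrN ?mx_norm_ge.
Qed.

Lemma norm_cross_e1_le (u : 'cV[R]_3) : `|cross (e1 R) u| <= `|u|.
Proof.
apply: mx_norm_le => // i j; rewrite (ord1 j); move: i; apply: ord3P;
rewrite crossE !e1E ?mul0r ?mul1r ?subr0 ?sub0r ?normr0 ?normrN// mx_norm_ge//.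
Qed.

End ClosedLoopField.

(** * Existence and uniqueness of closed-loop solutions *)

Section Solutions.
Variables (R : realType) (N : nat) (eta gamma : R) (A : R -> 'M[R]_N).
Hypothesis hA : communication_graph eta gamma A.
Implicit Types (s : R -> state R N) (t b W : R) (k : 'I_N).

Lemma weight_diag t k : 0 <= t -> A t k k = 0.
Proof. by case: hA => _ _ _ h _; exact: h. Qed.

Lemma switching_times b : exists D : seq R, forall t, 0 < t < b -> t \notin D ->
  forall i j, {for t, continuous (fun x => A x i j)}.
Proof.
case: hA => _ h _ _ _.
have /choice[F hF] : forall ij : 'I_N * 'I_N, exists D : seq R, forall t, 0 < t < b ->
    t \notin D -> {for t, continuous (fun x => A x ij.1 ij.2)}.
  by move=> ij; case: (h ij.1 ij.2) => /(_ b).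
exists (flatten [seq F ij | ij <- enum {: 'I_N * 'I_N}]) => t tb tD i j.
apply: (hF (i, j)) => //; apply: contra tD => tF; apply/flatten_mapP.
by exists (i, j) => //; rewrite mem_enum.
Qed.

Lemma solution_pw s t0 (tau : \bar R) b k : 0 <= t0 -> solution A t0 tau s ->
  (b%:E < tau)%E ->
  [/\ mx_pw_derive t0 b (fun t => pos (s t) k) (fun t => pos (field A t (s t)) k),
      mx_pw_derive t0 b (fun t => att (s t) k) (fun t => att (field A t (s t)) k)
    & mx_pw_derive t0 b (fun t => cons (s t) k) (fun t => cons (field A t (s t)) k)].
Proof.
move=> t00 [hr hc hd] btau; have [D hD] := switching_times b.
have sub : `[t0, b] `<=` [set t | t0 <= t /\ (t%:E < tau)%E].
  move=> t /=; rewrite in_itv/= => /andP[-> tb]; split=> //.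
  by rewrite (le_lt_trans _ btau)// lee_fin.
have [c1 c2 c3] := hc k.
have d t : t0 < t < b -> t \notin D ->
  [/\ is_derive t 1 (fun x => pos (s x) k) (pos (field A t (s t)) k),
      is_derive t 1 (fun x => att (s x) k) (att (field A t (s t)) k)
    & is_derive t 1 (fun x => cons (s x) k) (cons (field A t (s t)) k)].
  move=> /andP[tt tb] tD; apply: hd => //.
    by apply: sub; rewrite /= in_itv/= !ltW.
  by apply: hD => //; rewrite tb andbT (le_lt_trans t00).
split=> i l; split.
- by apply: within_mx_coord; apply: continuous_subspaceW c1.
- by exists D => t tb tD; apply: is_derive_mx_coord; case: (d t tb tD).
- by apply: within_mx_coord; apply: continuous_subspaceW c2.
- by exists D => t tb tD; apply: is_derive_mx_coord; case: (d t tb tD).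
- by apply: within_mx_coord; apply: continuous_subspaceW c3.
- by exists D => t tb tD; apply: is_derive_mx_coord; case: (d t tb tD).
Qed.

Lemma solution_rotations s t0 tau t : solution A t0 tau s -> t0 <= t -> (t%:E < tau)%E ->
  rotations (s t).
Proof. by move=> [h _ _] t0t ttau; exact: h. Qed.

Lemma solution_cons_abs s t0 tau b k : 0 <= t0 -> solution A t0 tau s ->
  (b%:E < tau)%E ->
  mx_pw_derive t0 b (fun t => cons_abs (s t) k) (fun t => cons_abs_rate A t (s t) k).
Proof.
move=> t00 hs btau; have [_ h2 h3] := solution_pw k t00 hs btau.
apply: mx_pw_derive_ext (mx_pw_deriveM h2 h3) => t /andP[tt tb].
rewrite -[LHS]/(cons_abs_field A t (s t) k) cons_abs_fieldE//.
  by rewrite weight_diag// (le_trans t00)// ltW.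
by apply: (solution_rotations hs); rewrite ?ltW// (lt_trans _ btau)// lte_fin.
Qed.

Lemma solution_vel s t0 tau b k : 0 <= t0 -> solution A t0 tau s ->
  (b%:E < tau)%E ->
  mx_pw_derive t0 b (fun t => vel (s t) k)
    (fun t => cons_abs (s t) k - cons (s t) k o0 0 *: vel (s t) k).
Proof.
move=> t00 hs btau; have [_ h2 _] := solution_pw k t00 hs btau.
apply: mx_pw_derive_ext (mx_pw_deriveM h2 (mx_pw_derive_cst _ _ (e1 R))) => t _.
by rewrite mulmx0 addr0 /= vel_rate.
Qed.

Lemma cons_abs_rateE t p k i : cons_abs_rate A t p k i 0 =
  \sum_j A t k j * (cons_abs p j i 0 - cons_abs p k i 0).
Proof. by rewrite summxE; apply: eq_bigr => j _; rewrite !mxE. Qed.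

Lemma solution_consensus s t0 i : 0 <= t0 -> solution A t0 +oo%E s ->
  consensus_dynamics A t0 (fun k t => cons_abs (s t) k i 0).
Proof.
move=> t00 hs k b; apply: pw_derive_ext (solution_cons_abs k t00 hs (ltry b) i 0).
by move=> t _; rewrite cons_abs_rateE.
Qed.

Lemma solution_cons s t0 tau b k : 0 <= t0 -> solution A t0 tau s ->
  (b%:E < tau)%E -> let e t := (att (s t) k)^T *m cons_abs_rate A t (s t) k in
  [/\ pw_derive t0 b (fun t => cons (s t) k o0 0)
        (fun t => cons (s t) k o1 0 ^+ 2 + cons (s t) k o2 0 ^+ 2 + e t o0 0),
      pw_derive t0 b (fun t => cons (s t) k o1 0)
        (fun t => - cons (s t) k o0 0 * cons (s t) k o1 0 + e t o1 0) &
      pw_derive t0 b (fun t => cons (s t) k o2 0)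
        (fun t => - cons (s t) k o0 0 * cons (s t) k o2 0 + e t o2 0)].
Proof.
move=> t00 hs btau e; have [_ _ h3] := solution_pw k t00 hs btau.
have ex t : t0 < t < b -> A t k k = 0.
  by move=> /andP[tt _]; rewrite weight_diag// (le_trans t00)// ltW.
by split; [apply: pw_derive_ext (h3 o0 0)|apply: pw_derive_ext (h3 o1 0)
  |apply: pw_derive_ext (h3 o2 0)] => t /ex Ak; rewrite field_cons// [LHS]mxE hat_control_cons.
Qed.

(** Gronwall arguments in triangular order. The [w_k] obey a linear equation of their own; once they
    agree, both attitude equations involve the same bounded [w_k], and the control, a function of
    [R_k^T w_k], is Lipschitz in [R_k]. Then [b_k = R_k^T w_k] agrees, and positions are integrals
    of velocities. *)
Lemma solution_unique s s' t0 tau b : 0 <= t0 -> t0 <= b -> (b%:E < tau)%E ->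
  solution A t0 tau s -> solution A t0 tau s' -> s t0 = s' t0 -> s b = s' b.
Proof.
move=> t00 t0b btau hs hs' e0.
have lt t : t <= b -> (t%:E < tau)%E.
  by move=> tb; rewrite (le_lt_trans _ btau)// lee_fin.
have G0 : 0 <= N%:R * gamma by rewrite mulr_ge0// ltW// (gamma_gt0 hA).
have wE t k : t0 <= t <= b -> cons_abs (s t) k = cons_abs (s' t) k.
  move=> /andP[t0t tb]; apply/eqP; rewrite -subr_eq0; apply/eqP; move: k.
  apply: (@linear_eq0_mx _ _ _ _ t0 t (N%:R * gamma * 2)
    (fun k t => cons_abs (s t) k - cons_abs (s' t) k)
    (fun k t => cons_abs_rate A t (s t) k - cons_abs_rate A t (s' t) k)) => //.
  - by rewrite mulr_ge0.
  - by move=> k; apply: mx_pw_deriveB; [apply: solution_cons_abs hs _|apply: solution_cons_abs hs' _]; rewrite ?lt.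
  - by move=> k; rewrite e0 subrr.
  - move=> u S /andP[tu _] S0 hS k.
    have u0 : 0 <= u by rewrite (le_trans t00)// ltW.
    apply: mx_norm_le => [|i j]; first by rewrite mulr_ge0// mulr_ge0.
    rewrite (ord1 j) -mulrA.
    have -> : (cons_abs_rate A u (s u) k - cons_abs_rate A u (s' u) k) i 0 =
       diffusion A (fun k t => (cons_abs (s t) k - cons_abs (s' t) k) i 0) k u.
      rewrite mxE [X in _ + X]mxE !cons_abs_rateE -sumrB; apply: eq_bigr => l _.
      by rewrite !mxE; ring.
    apply: (diffusion_le hA) => // l.
    rewrite (le_trans (ler_normB _ _))// mulr_natl mulr2n lerD//.
      exact: le_trans (mx_norm_ge _ _ _) (hS l).
    exact: le_trans (mx_norm_ge _ _ _) (hS k).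
have [W W0 hW] : exists2 W, 0 <= W & forall k t, t0 <= t <= b -> `|cons_abs (s t) k| <= W.
  apply: (@fin_bound _ _ (fun k M => forall t, t0 <= t <= b -> `|cons_abs (s t) k| <= M)).
    by move=> k M M' h MM t /h /le_trans; apply.
  move=> k.
  have [W W0 hW] : exists2 W, 0 <= W & forall i t, t0 <= t <= b -> `|cons_abs (s t) k i 0| <= W.
    apply: (@fin_bound _ _ (fun i M => forall t, t0 <= t <= b -> `|cons_abs (s t) k i 0| <= M)).
      by move=> i M M' h MM t /h /le_trans; apply.
    move=> i; apply: within_bounded.
    by case: (solution_cons_abs k t00 hs btau i 0).
  exists W => t tb; apply: mx_norm_le => // i j; rewrite (ord1 j); exact: hW.
have RE t k : t0 <= t <= b -> att (s t) k = att (s' t) k.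
  move=> /andP[t0t tb]; apply/eqP; rewrite -subr_eq0; apply/eqP; move: k.
  (* The difference of the two fields splits into one term with [Q - Q'] outside the control and one
     with it inside; each is at most [9 W S]. *)
  apply: (@linear_eq0_mx _ _ _ _ t0 t (18 * W)
    (fun k t => att (s t) k - att (s' t) k)
    (fun k t => att (field A t (s t)) k - att (field A t (s' t)) k)) => //.
  - by rewrite mulr_ge0.
  - move=> k; have [_ h2 _] := solution_pw k t00 hs (lt _ tb).
    have [_ h2' _] := solution_pw k t00 hs' (lt _ tb).
    exact: mx_pw_deriveB.
  - by move=> k; rewrite e0 subrr.
  - move=> u S /andP[tu ut] S0 hS k.
    have tub : t0 <= u <= b by rewrite (ltW tu) (le_trans (ltW ut)).
    have hr : rotations (s u) by apply: (solution_rotations hs); rewrite ?(ltW tu) ?lt//; case/andP: tub.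
    have hr' : rotations (s' u) by apply: (solution_rotations hs'); rewrite ?(ltW tu) ?lt//; case/andP: tub.
    have bE (p : state R N) : rotations p -> cons p k = (att p k)^T *m cons_abs p k.
      by move=> hp; rewrite att_trmulK.
    set Q := att (s u) k; set Q' := att (s' u) k; set w := cons_abs (s u) k.
    have -> : att (field A u (s u)) k - att (field A u (s' u)) k =
       (Q - Q') *m hat (control (s u) k) +
       Q' *m (hat (cross (e1 R) ((Q - Q')^T *m w))).
      suff -> : hat (cross (e1 R) ((Q - Q')^T *m w)) =
          hat (control (s u) k) - hat (control (s' u) k).
        by rewrite mulmxBl mulmxBr addrA subrK.
      rewrite -hatB -mulmxBr; congr (hat (_ *m _)).
      rewrite [(Q - Q')^T]linearB/= mulmxBl; congr (_ - _); first by rewrite -bE.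
      by rewrite /w wE// -bE.
    have hQ' : SO3 Q' by exact: hr'.
    have hQ : SO3 Q by exact: hr.
    have n1 : `|hat (control (s u) k)| <= 3 * W.
      apply: le_trans (norm_hat_le _) _; apply: le_trans (norm_cross_e1_le _) _.
      rewrite bE//; apply: le_trans (SO3_trmul_norm _ hQ) _.
      by rewrite ler_wpM2l// hW.
    have n2 : `|hat (cross (e1 R) ((Q - Q')^T *m w))| <= 3 * S * W.
      apply: le_trans (norm_hat_le _) _; apply: le_trans (norm_cross_e1_le _) _.
      apply: le_trans (mx_normM _ _) _; rewrite mx_norm_tr.
      by rewrite ler_pM ?mulr_ge0// ?hW// ler_wpM2l// hS.
    rewrite (le_trans (ler_normD _ _))//.
    have := SO3_mul_norm (hat (cross (e1 R) ((Q - Q')^T *m w))) hQ'.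
    have := mx_normM (Q - Q') (hat (control (s u) k)).
    have : 3 * `|Q - Q'| * `|hat (control (s u) k)| <= 3 * S * (3 * W).
      by rewrite ler_pM ?mulr_ge0// ler_wpM2l// hS.
    lra.
have bE k : cons (s b) k = cons (s' b) k.
  have tb : t0 <= b <= b by rewrite t0b lexx.
  have hr : rotations (s b) by exact: (solution_rotations hs).
  have hr' : rotations (s' b) by exact: (solution_rotations hs').
  by rewrite -(att_trmulK k (cons (s b) k) hr) -(att_trmulK k (cons (s' b) k) hr')
    -!/(cons_abs _ _) wE// RE.
apply: stateP => // k; last by apply: RE; rewrite t0b lexx.
have [h1 _ _] := solution_pw k t00 hs btau.
have [h1' _ _] := solution_pw k t00 hs' btau.
apply/eqP; rewrite -subr_eq0; apply/eqP.
have -> : 0 = pos (s t0) k - pos (s' t0) k by rewrite e0 subrr.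
apply: (mx_pw_derive0 t0b (mx_pw_deriveB h1 h1')) => t /andP[t1 t2].
by rewrite /= /vel RE ?subrr// !ltW.
Qed.

Section Existence.
Variable t0 : R.
Hypothesis t00 : 0 <= t0.

Lemma consensus_exists (c0 : 'I_N -> R) : exists y : 'I_N -> R -> R,
  [/\ forall k, y k t0 = c0 k, forall k b, {within `[t0, b], continuous (y k)},
      forall k t, t0 < t -> (forall i j, {for t, continuous (fun x => A x i j)}) ->
        is_derive t 1 (y k) (diffusion A y k t)
    & consensus_dynamics A t0 y].
Proof.
(* Minus the Laplacian, up to the diagonal weights, which vanish for nonnegative times. *)
pose M k j t := A t k j - (k == j)%:R * \sum_i A t k i.
have Mc t : (forall i j, {for t, continuous (fun x => A x i j)}) ->
    forall k j, {for t, continuous (M k j)}.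
  move=> hc k j; apply: continuousB; first exact: hc.
  apply: continuousM; first exact: cst_continuous.
  rewrite (_ : (fun x => _) = \sum_i (fun x => A x k i)); last first.
    by apply/funext => u; rewrite fct_sumE.
  apply: (big_ind (fun g : R -> R => {for t, continuous g})) => [|g h cg ch|i _].
  - exact: cst_continuous.
  - exact: continuousD.
  - exact: hc.
have Mcont b : exists D : seq R, forall t, t0 < t < b -> t \notin D ->
    forall k j, {for t, continuous (M k j)}.
  have [D hD] := switching_times b; exists D => t /andP[tt tb] tD.
  by apply: Mc; apply: hD; rewrite ?tb ?(le_lt_trans t00).
have Mbnd k j t : t0 <= t -> `|M k j t| <= gamma + N%:R * gamma.
  move=> t0t; have tt := le_trans t00 t0t.
  have /andP[h1 h2] := weight_bounds hA k j tt.
  have h3 := sum_weights_le hA k tt.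
  have h4 : 0 <= \sum_i A t k i.
    by apply: sumr_ge0 => i _; case/andP: (weight_bounds hA k i tt).
  rewrite /M (le_trans (ler_normB _ _))// lerD ?ger0_norm// ?mulr_ge0//.
  by case: eqP => _; rewrite ?mul1r// mul0r (le_trans h4).
have [y [h1 h2 h3]] := linear_ode c0 Mcont Mbnd.
have dE k t : \sum_j M k j t * y j t = diffusion A y k t.
  rewrite /diffusion /M (eq_bigr (fun j => A t k j * y j t -
    (k == j)%:R * ((\sum_i A t k i) * y j t))); last by move=> j _; ring.
  rewrite sumrB (_ : \sum_j (k == j)%:R * ((\sum_i A t k i) * y j t) =
    (\sum_i A t k i) * y k t); last first.
    rewrite (bigD1 k)//= eqxx mul1r [X in _ + X]big1 ?addr0// => j.
    by rewrite eq_sym => /negbTE ->; rewrite mul0r.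
  by rewrite mulr_suml -sumrB; apply: eq_bigr => j _; ring.
exists y; split=> //.
  by move=> k t t0t hc; rewrite -dE; apply: h3 => // j; exact: Mc.
move=> k b; split=> //; have [D hD] := Mcont b; exists D => t tb tD.
by rewrite -dE; apply: h3; [case/andP: tb|move=> j; exact: hD].
Qed.

Variables (w : R -> 'cV[R]_3) (W : R).
Hypothesis wc : forall i b, {within `[t0, b], continuous (fun t => w t i 0)}.
Hypothesis wW : forall t, t0 <= t -> `|w t| <= W.

Let wi t i : t0 <= t -> `|w t i 0| <= W.
Proof. by move=> t0t; rewrite (le_trans (mx_norm_ge _ _ _))// wW. Qed.

Let wct i t : t0 < t -> {for t, continuous (fun t => w t i 0)}.
Proof.
by move=> t0t; apply: (@within_continuous_at _ t0 (t + 1) (fun t => w t i 0)) => //; rewrite t0t ltrDl/=.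
Qed.

Let W0 : 0 <= W. Proof. exact: le_trans (wW (lexx t0)). Qed.

(* [x' = w - (x . w) x] is the projection [x = v / rho] of the linear system
   [v' = rho w], [rho' = w . v] on the light cone [v . v = rho ^ 2]. *)
Lemma heading_exists (x0 : 'cV[R]_3) : dot x0 x0 = 1 -> exists x : R -> 'cV[R]_3,
  [/\ x t0 = x0, forall t, t0 <= t -> dot (x t) (x t) = 1 &
      forall b, mx_pw_derive t0 b x (fun t => w t - dot (x t) (w t) *: x t)].
Proof.
move=> hx0.
(* Index [ord0] carries [rho] and the lifted indices carry [v]. The matrix has [w] in its first row
   and first column and zeros elsewhere: the generator of a Lorentz boost, which preserves
   [v . v - rho ^ 2]. *)
pose M (i j : 'I_4) t : R :=
  match unlift ord0 i, unlift ord0 j with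
  | Some i, None => w t i 0 | None, Some j => w t j 0 | _, _ => 0 end.
have Mc i j t : t0 < t -> {for t, continuous (M i j)}.
  move=> t0t; rewrite /M; case: unliftP => [i' _|_]; case: unliftP => [j' _|_];
  by [exact: cst_continuous|exact: wct].
have Mcont b : exists D : seq R, forall t, t0 < t < b -> t \notin D ->
    forall i j, {for t, continuous (M i j)}.
  by exists [::] => t /andP[tt _] _ i j; exact: Mc.
have Mbnd i j t : t0 <= t -> `|M i j t| <= W.
  move=> t0t; rewrite /M; case: unliftP => [i' _|_]; case: unliftP => [j' _|_];
  by rewrite ?normr0// wi.
pose y0 (i : 'I_4) : R := if unlift ord0 i is Some i then x0 i 0 else 1.
have [y [h1 h2 h3]] := linear_ode y0 Mcont Mbnd.
pose rho := y ord0; pose v i := y (lift ord0 i).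
have rho_a : rho t0 = 1 by rewrite /rho h1 /y0 unlift_none.
have v_a i : v i t0 = x0 i 0 by rewrite /v h1 /y0 liftK.
have rho_pw b : pw_derive t0 b rho (fun t => w t o0 0 * v o0 t + w t o1 0 * v o1 t + w t o2 0 * v o2 t).
  split; first exact: h2.
  exists [::] => t /andP[tt _] _.
  have := h3 ord0 t tt (fun j => Mc _ _ _ tt).
  rewrite big_ord_recl {1}/M unlift_none mul0r add0r sum3.
  by rewrite /M !liftK unlift_none.
have v_pw i b : pw_derive t0 b (v i) (fun t => w t i 0 * rho t).
  split; first exact: h2.
  exists [::] => t /andP[tt _] _.
  have := h3 (lift ord0 i) t tt (fun j => Mc _ _ _ tt).
  rewrite big_ord_recl {1}/M unlift_none liftK big1 ?addr0// => j _.
  by rewrite /M !liftK mul0r.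
have cone t : t0 <= t -> v o0 t ^+ 2 + v o1 t ^+ 2 + v o2 t ^+ 2 = rho t ^+ 2.
  move=> t0t; apply/eqP; rewrite -subr_eq0; apply/eqP.
  have sq i := pw_deriveM (v_pw i t) (v_pw i t).
  rewrite (pw_derive0 t0t (pw_deriveB (pw_deriveD (pw_deriveD (sq o0) (sq o1)) (sq o2))
    (pw_deriveM (rho_pw t) (rho_pw t)))); last by move=> u _; ring.
  by rewrite !v_a rho_a; move: hx0; rewrite dotE => ->; rewrite mulr1 subrr.
(* On the cone each [|v_i|] is at most [|rho|], hence [|rho'| <= 3 W |rho|], and [rho ^ 2] weighted
   by [expR (6 W (t - t0))] is nondecreasing from the value 1. *)
have rho0 t : t0 <= t -> rho t != 0.
  move=> t0t.
  have := pw_derive_ndecr t0t (pw_deriveM (pw_derive_exp t0 t (6 * W) t0)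
    (pw_deriveM (rho_pw t) (rho_pw t))) _.
  rewrite subrr mulr0 expR0 rho_a !mul1r => h.
  suff : 1 <= expR (6 * W * (t - t0)) * (rho t * rho t).
    by apply: contraTneq => ->; rewrite !mulr0 ler10.
  apply: h => u /andP[/ltW t0u _].
  have vr i : `|v i u| <= `|rho u|.
    rewrite -ler_sqr ?nnegrE// !real_normK ?num_real// -cone//.
    by move: i; apply: ord3P; nra.
  have wv i : `|w u i 0 * v i u| <= W * `|rho u| by rewrite normrM ler_pM ?wi.
  set g := w u o0 0 * v o0 u + _ + _.
  have gW : `|g| <= 3 * W * `|rho u|.
    have := wv o0; have := wv o1; have := wv o2; rewrite /g !ler_norml; lra.
  have gr : - (3 * W * rho u ^+ 2) <= g * rho u.
    rewrite lerNl -mulNr (le_trans (ler_norm _))// normrM normrN.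
    by rewrite -[rho u ^+ 2]real_normK ?num_real// expr2 mulrA ler_wpM2r.
  set e := expR _; have e0 : 0 <= e by exact: expR_ge0.
  have -> : 6 * W * e * (rho u * rho u) + e * (g * rho u + rho u * g) =
    2 * e * (3 * W * rho u ^+ 2 + g * rho u) by ring.
  by rewrite !mulr_ge0//; lra.
exists (fun t => \col_i (v i t / rho t)); split.
- by apply/matrixP => i j; rewrite !mxE (ord1 j) v_a rho_a divr1.
- move=> t t0t; rewrite dotE !mxE; have := cone t t0t; have := rho0 t t0t.
  set r := rho t => r0 hr.
  have -> : v o0 t / r * (v o0 t / r) + v o1 t / r * (v o1 t / r) + v o2 t / r * (v o2 t / r)
    = (v o0 t ^+ 2 + v o1 t ^+ 2 + v o2 t ^+ 2) / r ^+ 2 by field.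
  by rewrite hr divff// expf_neq0.
- move=> b i j; rewrite (ord1 j).
  have hr t : t0 <= t <= b -> rho t != 0 by move=> /andP[t0t _]; exact: rho0.
  apply: pw_derive_ext (pw_derive_eqf _ (pw_deriveM (v_pw i b) (pw_deriveV hr (rho_pw b)))).
    move=> t /andP[/ltW t0t _]; rewrite dotE !mxE; have := rho0 t t0t.
    by move=> r0; field.
  by move=> t _; rewrite mxE.
Qed.

(** In the inertial frame the angular velocity is [x cross w], where [x = Q e_1]. With [x] taken
    from [heading_exists] this is a known function of time and the equation for [Q] is linear; it
    remains to check that the first column of its solution is indeed [x]. *)
Lemma frame_exists (Q0 : 'M[R]_3) : SO3 Q0 -> exists Q : R -> 'M[R]_3,
  [/\ Q t0 = Q0, forall t, t0 <= t -> SO3 (Q t),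
      forall i j b, {within `[t0, b], continuous (fun t => Q t i j)} &
      forall t, t0 < t ->
        is_derive t 1 Q (hat (cross (Q t *m e1 R) (w t)) *m Q t)].
Proof.
move=> hQ0.
have h11 : dot (Q0 *m e1 R) (Q0 *m e1 R) = 1.
  by rewrite dot_mul ?SO3_trmul// dotE !e1E; ring.
have [x [xa x1 xpw]] := heading_exists h11.
have xc i t : t0 < t -> {for t, continuous (fun t => x t i 0)}.
  move=> t0t; case: (xpw (t + 1) i 0) => hc _; apply: (within_continuous_at hc).
  by rewrite t0t ltrDl/=.
have x_le i t : t0 <= t -> `|x t i 0| <= 1.
  move=> t0t; rewrite -(@expr_le1 _ 2)// real_normK ?num_real//.
  by have := x1 t t0t; rewrite dotE; move: i; apply: ord3P; nra.
pose M i j t := hat (cross (x t) (w t)) i j.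
have cc (k l : 'I_3) t : t0 < t -> {for t, continuous (fun t => x t k 0 * w t l 0)}.
  by move=> t0t; apply: continuousM; [exact: xc|exact: wct].
have Mc t : t0 < t -> forall i j, {for t, continuous (M i j)}.
  move=> t0t; have c3 (k l k' l' : 'I_3) : {for t, continuous (fun t => x t k 0 * w t l 0 - x t k' 0 * w t l' 0)}.
    by apply: continuousB; exact: cc.
  have c3N (k l k' l' : 'I_3) : {for t, continuous (fun t => - (x t k 0 * w t l 0 - x t k' 0 * w t l' 0))}.
    exact: continuousN.
  have ME i j f : (forall t, M i j t = f t) -> {for t, continuous f} -> {for t, continuous (M i j)}.
    by move=> /funext ->.
  apply: ord3P; apply: ord3P; (apply: ME => [u|];
    [rewrite /M hatE ?crossE; reflexivity|]);
  by [exact: cst_continuous|exact: c3|exact: c3N].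
have Mcont b : exists D : seq R, forall t, t0 < t < b -> t \notin D ->
    forall i j, {for t, continuous (M i j)}.
  by exists [::] => t /andP[tt _] _; exact: Mc.
have Mbnd i j t : t0 <= t -> `|M i j t| <= 2 * W.
  move=> t0t; apply: le_trans (mx_norm_ge _ _ _) _; apply: le_trans (norm_hat_le _) _.
  have b2 (k l k' l' : 'I_3) : `|x t k 0 * w t l 0 - x t k' 0 * w t l' 0| <= 2 * W.
    rewrite (le_trans (ler_normB _ _))// mulr_natl mulr2n lerD// normrM -[W]mul1r ler_pM//;
    by rewrite ?x_le ?wi.
  apply: mx_norm_le => [|i' l]; first by rewrite mulr_ge0.
  by rewrite (ord1 l); move: i'; apply: ord3P; rewrite crossE.
have /choice[Y hY] : forall l : 'I_3, exists y : 'I_3 -> R -> R,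
    [/\ forall i, y i t0 = Q0 i l, forall i b, {within `[t0, b], continuous (y i)} &
      forall i t, t0 < t -> is_derive t 1 (y i) (\sum_j M i j t * y j t)].
  move=> l; have [y [h1 h2 h3]] := linear_ode (fun i => Q0 i l) Mcont Mbnd.
  by exists y; split=> // i t t0t; apply: h3 => // j; exact: Mc.
pose Q t : 'M[R]_3 := \matrix_(i, l) Y l i t.
have QE i l : (fun t => Q t i l) = Y l i by apply/funext => t; rewrite mxE.
have Qa : Q t0 = Q0.
  by apply/matrixP => i l; rewrite mxE; case: (hY l) => ->.
have Qc i l b : {within `[t0, b], continuous (fun t => Q t i l)}.
  by rewrite QE; case: (hY l).
have Qd t : t0 < t -> is_derive t 1 Q (hat (cross (x t) (w t)) *m Q t).
  move=> t0t; apply: is_derive_mx => i l; rewrite QE.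
  have [_ _ /(_ i t t0t)] := hY l; rewrite mxE.
  move=> h; apply: is_derive_eq h _; apply: eq_bigr => j _; congr (_ * _).
  by rewrite mxE.
have Qpw b : mx_pw_derive t0 b Q (fun t => hat (cross (x t) (w t)) *m Q t).
  move=> i l; split=> //; exists [::] => t /andP[t0t _] _.
  exact: is_derive_mx_coord (Qd t t0t).
have QO t : t0 <= t -> (Q t)^T *m Q t = 1%:M.
  move=> t0t; rewrite -(SO3_trmul hQ0) -Qa.
  apply: (mx_pw_derive0 t0t (mx_pw_deriveM (mx_pw_derive_tr (Qpw t)) (Qpw t))).
  by move=> u _; rewrite trmx_mul hat_tr mulmxN mulNmx mulmxA addNr.
(* The determinant is continuous with square 1 and starts at 1; reaching -1 would force a zero in
   between. *)
have Qdet t : t0 <= t -> \det (Q t) = 1.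
  move=> t0t.
  have d2 u : t0 <= u -> \det (Q u) ^+ 2 = 1.
    by move=> /QO /(congr1 determinant); rewrite det_mulmx det_tr det1.
  have [D [dc _]] : exists dD, pw_derive t0 t (fun t => \det (Q t)) dD.
    eexists; apply: pw_derive_eqf; first by move=> u _; rewrite det3.
    have q i j := Qpw t i j.
    have m2 i j i' j' := pw_deriveM (q i j) (q i' j').
    have m3 i j i' j' (k l k' l' : 'I_3) := pw_deriveB (m2 i j i' j') (m2 k l k' l').
    exact: (pw_deriveD (pw_deriveB (pw_deriveM (q o0 o0) (m3 o1 o1 o2 o2 o1 o2 o2 o1))
      (pw_deriveM (q o0 o1) (m3 o1 o0 o2 o2 o1 o2 o2 o0)))
      (pw_deriveM (q o0 o2) (m3 o1 o0 o2 o1 o1 o1 o2 o0))).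
  have da : \det (Q t0) = 1 by rewrite Qa; case: hQ0.
  have /eqP := d2 t t0t; rewrite sqrf_eq1 => /orP[/eqP//|/eqP dt].
  have [|c] := @IVT _ _ _ _ 0 t0t dc.
    by rewrite da dt ge_min le_max ler01 lerN10 orbT.
  rewrite in_itv/= => /andP[t0c _] c0.
  by have := d2 c t0c; rewrite c0 expr0n/= => /esym/eqP; rewrite oner_eq0.
(* Both sides solve the same linear equation, because [(x cross w) cross x = w - (x . w) x] for a
   unit vector [x]. *)
have Qe1 t : t0 <= t -> Q t *m e1 R = x t.
  move=> t0t; apply/eqP; rewrite -subr_eq0; apply/eqP.
  apply: (@linear_eq0_mx _ _ _ unit t0 t (18 * W) (fun _ t => Q t *m e1 R - x t)
    (fun _ t => hat (cross (x t) (w t)) *m (Q t *m e1 R - x t)) t0t _ _ _ _ tt).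
  - by rewrite mulr_ge0.
  - move=> _; apply: mx_pw_derive_ext (mx_pw_deriveB (mx_pw_deriveM (Qpw t)
      (mx_pw_derive_cst _ _ (e1 R))) (xpw t)).
    move=> u /andP[/ltW t0u _]; rewrite mulmx0 addr0 mulmxBr mulmxA; congr (_ - _).
    have := x1 u t0u; rewrite !dotE => hx.
    apply: cV3P; rewrite mulmxE3 !hatE !crossE !mxE;
    by rewrite -[X in X - _ = _]mulr1 -hx; ring.
  - by move=> _; rewrite Qa xa subrr.
  - move=> u S /andP[/ltW t0u _] S0 hS _; apply: le_trans (mx_normM _ _) _.
    have : `|hat (cross (x u) (w u))| <= 2 * W.
      by apply: mx_norm_le => [|i j]; [rewrite mulr_ge0|exact: Mbnd].
    move=> hh; apply: (@le_trans _ _ (3 * (2 * W) * S)).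
      by rewrite ler_pM ?mulr_ge0// ?ler_wpM2l// hS.
    by rewrite ler_wpM2r// mulrA ler_wpM2r// -natrM ler_nat.
exists Q; split=> //.
- by move=> t t0t; split; [exact: QO|exact: Qdet].
- by move=> t t0t; rewrite Qe1 ?ltW//; exact: Qd.
Qed.

End Existence.

Lemma solution_exists t0 (p0 : state R N) : 0 <= t0 -> rotations p0 ->
  exists s, solution A t0 +oo%E s /\ s t0 = p0.
Proof.
move=> t00 hp0.
have /choice[Y hY] := fun i : 'I_3 => consensus_exists t00 (fun k => cons_abs p0 k i 0).
pose w k t : 'cV[R]_3 := \col_i Y i k t.
have wa k : w k t0 = cons_abs p0 k.
  by apply/matrixP => i j; rewrite mxE (ord1 j); case: (hY i) => ->.
have wE k i : (fun t => w k t i 0) = Y i k by apply/funext => t; rewrite mxE.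
have wc k i b : {within `[t0, b], continuous (fun t => w k t i 0)}.
  by rewrite wE; case: (hY i).
have [W W0 hW] : exists2 W, 0 <= W & forall i k, `|cons_abs p0 k i 0| <= W.
  apply: (@fin_bound _ _ (fun i M => forall k, `|cons_abs p0 k i 0| <= M)).
    by move=> i M M' h MM k; rewrite (le_trans (h k)).
  move=> i; have [B _ hB] : exists2 B, 0 <= B & forall k, `|cons_abs p0 k i 0| <= B.
    apply: (@fin_bound _ _ (fun k M => `|cons_abs p0 k i 0| <= M)).
      by move=> k M M' h; exact: le_trans.
    by move=> k; exists `|cons_abs p0 k i 0|.
  by exists B.
have wW k t : t0 <= t -> `|w k t| <= W.
  move=> t0t; apply: mx_norm_le => // i j; rewrite mxE.
  have [ya _ _ yd] := hY i; apply: (consensus_norm_le hA t00 yd) => // l.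
  by rewrite ya.
have /choice[Q hQ] := fun k => frame_exists (wc k) (wW k) (hp0 k).
pose x k t i := (Q k t *m e1 R) i 0.
have xc k i b : {within `[t0, b], continuous (fun t => x k t i)}.
  have [_ _ qc _] := hQ k.
  have -> : (fun t => x k t i) = (fun t => Q k t i 0).
    by apply/funext => t; rewrite /x /e1 -colE mxE.
  exact: qc.
have xct k i t : t0 < t -> {for t, continuous (fun t => x k t i)}.
  by move=> t0t; apply: (within_continuous_at (xc k i (t + 1))); rewrite t0t ltrDl/=.
have xle k i t b : t0 <= t <= b -> `|x k t i| <= 3.
  move=> /andP[t0t _]; have [_ /(_ t t0t) q _ _] := hQ k.
  apply: le_trans (mx_norm_ge _ _ _) _; apply: le_trans (SO3_mul_norm _ q) _.
  rewrite -[leRHS]mulr1 ler_wpM2l//; apply: mx_norm_le => // i' j'.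
  by rewrite (ord1 j'); move: i'; apply: ord3P; rewrite e1E ?normr0 ?normr1.
have xD k i b t : t0 < t < b -> t \notin [::] -> {for t, continuous (fun t => x k t i)}.
  by move=> /andP[t0t _] _; exact: xct.
pose r k t : 'cV[R]_3 := \col_i (pos p0 k i 0 + primitive t0 (fun t => x k t i) t).
have rE k i : (fun t => r k t i 0) = cst (pos p0 k i 0) + primitive t0 (fun t => x k t i).
  by apply/funext => t; rewrite mxE.
pose s t := State (fun k => r k t) (fun k => Q k t) (fun k => (Q k t)^T *m w k t).
have hr t : t0 <= t -> rotations (s t).
  by move=> t0t k; case: (hQ k) => _ /(_ t t0t).
have sw t k : t0 <= t -> cons_abs (s t) k = w k t.
  by move=> t0t; have := att_mulK k (w k t) (hr t t0t).
have I0 : [set t | t0 <= t /\ (t%:E < +oo)%E] `<=` [set t | t0 <= t] by move=> t [].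
have Qc k b : {within `[t0, b], continuous (Q k)}.
  by apply: within_mx => i j; case: (hQ k).
exists s; split; last first.
  apply: stateP => k /=.
  - by apply/matrixP => i j; rewrite mxE primitive_a addr0 (ord1 j).
  - by case: (hQ k).
  - by have [-> _ _ _] := hQ k; rewrite wa /cons_abs att_trmulK.
split.
- by move=> t [t0t _]; exact: hr.
- move=> k; split; apply: within_ray I0 _ => b.
  + apply: within_mx => i j; rewrite (ord1 j) rE.
    have pc := primitive_continuous (@xD k i b) (@xle k i ^~ b).
    apply: within_continuousD; last exact: pc.
    by apply: continuous_subspaceT; exact: cst_continuous.
  + exact: Qc.
  + apply: within_mx => i j /=.
    have -> : (fun t => ((Q k t)^T *m w k t) i j) =
        (fun t => Q k t o0 i * w k t o0 0 + Q k t o1 i * w k t o1 0 + Q k t o2 i * w k t o2 0).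
      by apply/funext => t; rewrite mulmxE3 !(ord1 j) !mxE.
    have [_ _ qc _] := hQ k.
    by apply: within_continuousD; [apply: within_continuousD|];
      apply: within_continuousM; exact: qc || exact: wc.
move=> t [t0t' _] t0t hc k; have t0t1 := ltW t0t; have tt := le_trans t00 t0t1.
have [_ hSO _ qd] := hQ k; have hQt := hSO t t0t1.
have qE : hat (cross (Q k t *m e1 R) (w k t)) *m Q k t = Q k t *m hat (control (s t) k).
  rewrite -hat_rot//; congr (hat _ *m _).
  have -> : w k t = Q k t *m cons (s t) k by rewrite -sw.
  rewrite /control /cross mulmxA hat_rot//.
  by rewrite -mulmxA.
have wd : is_derive t 1 (w k) (cons_abs_rate A t (s t) k).
  apply: is_derive_mx => i j; rewrite (ord1 j) wE cons_abs_rateE.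
  have [_ _ /(_ k t t0t hc) h _] := hY i.
  apply: is_derive_eq h _; apply: eq_bigr => l _.
  by rewrite !sw// !mxE.
split.
- apply: is_derive_mx => i j; rewrite (ord1 j) rE -[X in is_derive _ _ _ X]add0r.
  apply: is_deriveD; apply: (primitive_is_derive (@xD k i (t + 1)) (@xle k i ^~ (t + 1))).
    by rewrite t0t ltrDl/=.
  exact: xct.
- by have := qd t t0t; rewrite qE.
- rewrite field_cons ?weight_diag//.
  have := is_derive_mulmx (is_derive_trmx (qd t t0t)) wd.
  by rewrite qE trmx_mul -mulmxA.
Qed.

End Solutions.

(** * Convergence of every solution to straight motions *)

Section Asymptotics.
Variables (R : realType) (N : nat) (eta gamma : R) (A : R -> 'M[R]_N).
Hypothesis hA : communication_graph eta gamma A.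
Hypothesis hconn : uniformly_connected eta A.
Implicit Types (s : R -> state R N) (p q : state R N) (t b : R) (k j : 'I_N).

Lemma cV_e1P (u : 'cV[R]_3) : u o1 0 = 0 -> u o2 0 = 0 -> u = u o0 0 *: e1 R.
Proof. by move=> h1 h2; apply: cV3P; rewrite [RHS]mxE e1E ?mulr1 ?mulr0. Qed.

Lemma control_eq0 p k : control p k = 0 -> cons p k = cons p k o0 0 *: e1 R.
Proof.
move=> h; have hE i : control p k i 0 = 0 by rewrite h mxE.
apply: cV_e1P; first by have := hE o2; rewrite control_E.
by have := hE o1; rewrite control_E => /eqP; rewrite oppr_eq0 => /eqP.
Qed.

Lemma cons_e1_control p k (L : R) : cons p k = L *: e1 R -> control p k = 0.
Proof.
by move=> h; apply: cV3P; rewrite control_E ?h ?mxZE ?e1E ?mulr0 ?oppr0 [RHS]mxE.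
Qed.

Lemma cons_e1_abs p k (L : R) : cons p k = L *: e1 R -> cons_abs p k = L *: vel p k.
Proof. by move=> h; rewrite /cons_abs h -scalemxAr. Qed.

Lemma SO3_entry_le m (Q : 'M[R]_3) (u : 'M[R]_(3, m)) i (j : 'I_m) : SO3 Q ->
  `|(Q^T *m u) i j| <= 3 * `|u|.
Proof. by move=> hQ; apply: le_trans (mx_norm_ge _ _ _) _; exact: SO3_trmul_norm. Qed.

(** The bounds are proportional to the initial disagreement [S], with constants common to all
    starting times and solutions; the stability proof rests on this proportionality. In each
    coordinate the initial values lie within [S] of that of agent [k], whence the width [2 S]. *)
Lemma consensus_rate : exists C l, [/\ 0 < C, 0 < l & forall t0 s S, 0 <= t0 ->
  solution A t0 +oo%E s -> 0 <= S ->
  (forall k j, `|cons_abs (s t0) k - cons_abs (s t0) j| <= S) ->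
  forall t, t0 <= t -> forall k,
    `|cons_abs_rate A t (s t) k| <= C * S * expR (- l * (t - t0)) /\
    forall j, `|cons_abs (s t) k - cons_abs (s t) j| <= C * S * expR (- l * (t - t0))].
Proof.
have [C [l [C0 l0 h]]] := exponential_consensus hA hconn.
have G0 : 0 <= N%:R * gamma by rewrite mulr_ge0// ltW// (gamma_gt0 hA).
exists (2 * C * (1 + N%:R * gamma)), l; split=> //.
  by rewrite !mulr_gt0// ltr_wpDr.
move=> t0 s S t00 hs S0 hS t t0t k.
have t00t := le_trans t00 t0t.
have E0 : 0 <= expR (- l * (t - t0)) by exact: expR_ge0.
set E := expR _ in E0 *.
have dev i (a b : 'I_N) : `|cons_abs (s t) a i 0 - cons_abs (s t) b i 0| <= 2 * C * S * E.
  have := h t0 (fun k t => cons_abs (s t) k i 0) (cons_abs (s t0) k i 0 - S)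
    (cons_abs (s t0) k i 0 + S) t00 (solution_consensus hA i t00 hs) _ t t0t a b.
  have -> : cons_abs (s t0) k i 0 + S - (cons_abs (s t0) k i 0 - S) = 2 * S by ring.
  rewrite -/E => h'; apply: (le_trans (h' _)); last by apply: eq_ler; ring.
  move=> c; have := le_trans (mx_norm_ge _ i 0) (hS c k).
  by rewrite !mxBE ler_norml; lra.
have CSE : 0 <= 2 * C * S * E by rewrite !mulr_ge0// ltW.
split.
  apply: mx_norm_le => [|i j].
    by rewrite !mulr_ge0// ?addr_ge0// ltW.
  rewrite (ord1 j) cons_abs_rateE.
  apply: (le_trans (@diffusion_le _ _ _ _ _ hA (fun k t => cons_abs (s t) k i 0) t k
     (2 * C * S * E) t00t _)); first by move=> c; exact: dev.
  have -> : 2 * C * (1 + N%:R * gamma) * S * E = 2 * C * S * E + N%:R * gamma * (2 * C * S * E).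
    by ring.
  by rewrite lerDr.
move=> j; apply: mx_norm_le => [|i l'].
  by rewrite !mulr_ge0// ?addr_ge0// ltW.
rewrite (ord1 l') mxBE; apply: (le_trans (dev i k j)).
have -> : 2 * C * (1 + N%:R * gamma) * S * E = 2 * C * S * E + N%:R * gamma * (2 * C * S * E).
  by ring.
by rewrite lerDl mulr_ge0.
Qed.

Lemma consensus_constant t0 s (w : 'cV[R]_3) : 0 <= t0 -> solution A t0 +oo%E s ->
  (forall k, cons_abs (s t0) k = w) -> forall t k, t0 <= t -> cons_abs (s t) k = w.
Proof.
move=> t00 hs hw t k t0t; apply/matrixP => i j; rewrite (ord1 j).
have hc := solution_consensus hA i t00 hs.
apply/eqP; rewrite eq_le; apply/andP; split.
  by apply: (consensus_upper hA t00 hc) => // c; rewrite hw.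
by apply: (consensus_lower hA t00 hc) => // c; rewrite hw.
Qed.

Lemma cons_abs_rate_eq0 p t : (forall k j, cons_abs p k = cons_abs p j) ->
  forall k, cons_abs_rate A t p k = 0.
Proof.
move=> h k; rewrite /cons_abs_rate big1// => j _.
by rewrite (h j k) subrr scaler0.
Qed.

(** The rate of change of one agent is exponentially small, so its vector converges, and the decay
    of the disagreement carries the others along. Connectivity supplies the agent [k0]. *)
Lemma consensus_limit t0 s : 0 <= t0 -> solution A t0 +oo%E s ->
  exists w B l, [/\ 0 < l, 0 <= B & forall t, t0 <= t -> forall k,
    [/\ `|cons_abs (s t) k - w| <= B * expR (- l * (t - t0)),
        `|cons_abs_rate A t (s t) k| <= B * expR (- l * (t - t0)) &
        forall j, `|cons_abs (s t) k - cons_abs (s t) j| <= B * expR (- l * (t - t0))]].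
Proof.
move=> t00 hs; have [C [l [C0 l0 h]]] := consensus_rate.
have [T [delta [k0 _]]] := hconn.
have [S S0 hS] : exists2 S, 0 <= S &
    forall k, forall j, `|cons_abs (s t0) k - cons_abs (s t0) j| <= S.
  apply: (@fin_bound _ _ (fun k S => forall j, `|cons_abs (s t0) k - cons_abs (s t0) j| <= S)).
    by move=> k M M' hM MM j; exact: le_trans (hM j) MM.
  move=> k; have [M _ hM] : exists2 M, 0 <= M & forall j, `|cons_abs (s t0) k - cons_abs (s t0) j| <= M.
    apply: (@fin_bound _ _ (fun j M => `|cons_abs (s t0) k - cons_abs (s t0) j| <= M)).
      by move=> j M M'; exact: le_trans.
    by move=> j; exists `|cons_abs (s t0) k - cons_abs (s t0) j|.
  by exists M.
have {}h := h t0 s S t00 hs S0 hS.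
have CS : 0 <= C * S by rewrite mulr_ge0// ltW.
have /choice[L hL] : forall i : 'I_3, exists L : R, forall t, t0 <= t ->
    `|cons_abs (s t) k0 i 0 - L| <= C * S / l * expR (- l * (t - t0)).
  move=> i; apply: (@exp_decay_limit _ t0 (fun t => cons_abs (s t) k0 i 0)
    (fun t => cons_abs_rate A t (s t) k0 i 0)) => //.
    by move=> b; exact: (solution_cons_abs hA k0 t00 hs (ltry b)).
  move=> t /ltW t0t; apply: le_trans (mx_norm_ge _ _ _) _.
  by case: (h t t0t k0).
exists (\col_i L i), (C * S / l + C * S), l; split=> //.
  by rewrite addr_ge0// divr_ge0// ltW.
move=> t t0t k; have E0 : 0 <= expR (- l * (t - t0)) by exact: expR_ge0.
set E := expR _ in E0 *; rewrite mulrDl.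
have CE : 0 <= C * S * E by rewrite mulr_ge0.
have CE' : 0 <= C * S / l * E by rewrite mulr_ge0// divr_ge0// ltW.
have [hk hd] := h t t0t k.
split.
- apply: mx_norm_le => [|i j]; first by rewrite addr_ge0.
  rewrite (ord1 j) mxBE [X in _ - X]mxE.
  have -> : cons_abs (s t) k i 0 - L i =
    (cons_abs (s t) k0 i 0 - L i) + (cons_abs (s t) k i 0 - cons_abs (s t) k0 i 0) by ring.
  apply: (le_trans (ler_normD _ _)); apply: lerD; first exact: hL.
  by have := le_trans (mx_norm_ge _ i 0) (hd k0); rewrite mxBE.
- by apply: (le_trans hk); rewrite lerDr.
- by move=> j; apply: (le_trans (hd j)); rewrite lerDr.
Qed.

(** [riccati_limit] applied to [f = a] and [m = b'^2 + b''^2], whose sum [m + f ^ 2] is [|w_k|^2]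
    because [R_k] is an isometry. As [L ^ 2 = |w|^2], the transverse part [m = |w_k|^2 - a^2] tends
    to zero, and [b_k] tends to [L e_1]. *)
Lemma cons_limit t0 s w B l k : 0 <= t0 -> solution A t0 +oo%E s -> 0 < l -> 0 <= B ->
  (forall t, t0 <= t -> `|cons_abs (s t) k - w| <= B * expR (- l * (t - t0)) /\
        `|cons_abs_rate A t (s t) k| <= B * expR (- l * (t - t0))) ->
  exists L, [/\ L ^+ 2 = dot w w,
    forall t, t0 <= t -> cons (s t) k o0 0 -
      (9 * (2 * `|w| + B + 1) * B) / l * expR (- l * (t - t0)) <= L &
    forall e, 0 < e -> exists2 T, t0 <= T & forall t, T <= t ->
      `|cons (s t) k - L *: e1 R| < e].
Proof.
move=> t00 hs l0 B0 hw.
pose B' := 9 * (2 * `|w| + B + 1) * B.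
pose m t := cons (s t) k o1 0 ^+ 2 + cons (s t) k o2 0 ^+ 2.
pose h t := ((att (s t) k)^T *m cons_abs_rate A t (s t) k) o0 0.
have E1 t : t0 <= t -> expR (- l * (t - t0)) <= 1.
  move=> t0t; rewrite -[leRHS]expR0 ler_expR mulNr oppr_le0 mulr_ge0 ?subr_ge0//.
  exact: ltW.
have hr t : t0 <= t -> rotations (s t).
  by move=> t0t; apply: (solution_rotations hs) => //; exact: ltry.
have B'0 : 0 <= B' by rewrite !mulr_ge0// !addr_ge0// mulr_ge0.
have BB' : 3 * B <= B'.
  by rewrite /B' ler_wpM2r//; have := normr_ge0 w; lra.
have dd t : t0 <= t -> `|dot (cons_abs (s t) k) (cons_abs (s t) k) - dot w w| <= B' * expR (- l * (t - t0)).
  move=> t0t; have [h1 _] := hw t t0t; set E := expR _ in h1 *.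
  have E0 : 0 <= E by exact: expR_ge0.
  have -> : dot (cons_abs (s t) k) (cons_abs (s t) k) - dot w w =
     dot (cons_abs (s t) k - w) (cons_abs (s t) k - w + (w + w)) by rewrite !dotE ?(mxBE, mxDE, mxZE); ring.
  apply: le_trans (dot_norm_le _ _) _.
  have : `|cons_abs (s t) k - w + (w + w)| <= 2 * `|w| + B + 1.
    apply: (le_trans (ler_normD _ _)); have := ler_normD w w.
    have := ler_wpM2l B0 (E1 t t0t); rewrite -/E mulr1; lra.
  move=> h3; have BE : 0 <= B * E by rewrite mulr_ge0.
  apply: (@le_trans _ _ (3 * (B * E) * (2 * `|w| + B + 1))).
    by rewrite ler_pM// ?mulr_ge0// ler_wpM2l.
  have -> : B' * E = 9 * (B * E) * (2 * `|w| + B + 1) by rewrite /B'; ring.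
  by rewrite ler_wpM2r ?addr_ge0 ?mulr_ge0// ler_wpM2r// ler_nat.
have mE t : t0 <= t -> m t + cons (s t) k o0 0 ^+ 2 = dot (cons_abs (s t) k) (cons_abs (s t) k).
  by move=> /hr hp; rewrite dot_cons_abs// dotE /m; ring.
have := @riccati_limit _ t0 (fun t => cons (s t) k o0 0) m h B' l (dot w w) l0 B'0.
case.
- by move=> b; have [] := solution_cons hA k t00 hs (ltry b).
- by move=> t _; rewrite addr_ge0// sqr_ge0.
- move=> t t0t; rewrite /h; apply: le_trans (SO3_entry_le _ _ _ (hr t t0t k)) _.
  have [_ h2] := hw t t0t; apply: (@le_trans _ _ (3 * (B * expR (- l * (t - t0))))).
    by rewrite ler_wpM2l.
  by rewrite mulrA ler_wpM2r// expR_ge0.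
- by move=> t t0t; rewrite mE//; exact: dd.
move=> L [L2 Lt hL]; exists L; split=> // e e0.
(* The error of [a ^ 2] is at most [d (2 |L| + 1)] and that of [|w_k|^2] is below [d]; together they
   stay below [e ^ 2], so that [m < e ^ 2]. *)
pose d := Num.min 1 (e ^+ 2 / (2 * `|L| + 3)).
have c0 : 0 < 2 * `|L| + 3 by rewrite ltr_wpDl// mulr_ge0.
have d0 : 0 < d by rewrite lt_min ltr01 divr_gt0// exprn_gt0.
pose d' := Num.min d (e / 2).
have d'0 : 0 < d' by rewrite lt_min d0 divr_gt0.
have [T1 t0T1 h1] := hL d' d'0; have [T2 _ h2] := expN_lt t0 B' l0 d0.
exists (Num.max T1 T2); first by rewrite le_max t0T1.
move=> t; rewrite ge_max => /andP[T1t T2t].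
have t0t := le_trans t0T1 T1t.
have {}h1 := h1 t T1t; have {}h2 := h2 t T2t.
have dd' : d' <= d by rewrite ge_min lexx.
have de : d' <= e / 2 by rewrite ge_min lexx orbT.
have d1 : d <= 1 by rewrite ge_min lexx.
have hm : m t < e ^+ 2.
  have := dd t t0t; rewrite -mE// -L2.
  have := h1; set a := cons (s t) k o0 0 => h1' h3.
  have aL : `|a ^+ 2 - L ^+ 2| <= d * (2 * `|L| + 1).
    rewrite subr_sqr normrM ler_pM// ?(ltW (lt_le_trans h1' dd'))//.
    have -> : a + L = (a - L) + 2 * L by ring.
    rewrite (le_trans (ler_normD _ _))// normrM ger0_norm//.
    by have := lt_le_trans h1' (le_trans dd' d1); lra.
  have : d * (2 * `|L| + 3) <= e ^+ 2 by rewrite -ler_pdivlMr// ge_min lexx orbT.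
  move: h3 aL; rewrite !ler_norml; lra.
have ent i : `|(cons (s t) k - L *: e1 R) i 0| < e.
  move: i; apply: ord3P; rewrite mxBE mxZE ?e1E ?mulr1 ?mulr0 ?subr0.
  - by apply: (lt_le_trans h1); lra.
  - rewrite -ltr_sqr ?nnegrE ?(ltW e0)// real_normK ?num_real//.
    by apply: le_lt_trans hm; rewrite /m lerDl sqr_ge0.
  - rewrite -ltr_sqr ?nnegrE ?(ltW e0)// real_normK ?num_real//.
    by apply: le_lt_trans hm; rewrite /m lerDr sqr_ge0.
rewrite [ltLHS]/Num.Def.normr/= mx_normrE.
by apply: bigmax_lt => // -[i j] _ /=; rewrite (ord1 j).
Qed.

Lemma equilibrium_solution t0 p : 0 <= t0 -> rotations p ->
  (forall k, control p k = 0) -> (forall k j, cons_abs p k = cons_abs p j) ->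
  let s t := State (fun k => pos p k + (t - t0) *: vel p k) (att p) (cons p) in
  [/\ solution A t0 +oo%E s, straight t0 s, consensus t0 s & s t0 = p].
Proof.
move=> t00 hp hc hw s; split.
- split.
  + by move=> t _.
  + move=> k; split; apply: continuous_subspaceT; last 2 first.
    * exact: cst_continuous.
    * exact: cst_continuous.
    move=> t; apply/differentiable_continuous/derivable1_diffP.
    by case: (is_derive_line (pos p k) (vel p k) t0 t).
  + move=> t [t0t' _] t0t _ k; split.
    * exact: is_derive_line.
    * rewrite /= [control _ _](_ : _ = control p k)// hc hat0 mulmx0.
      exact: is_derive_cst.
    * rewrite field_cons; last by rewrite (weight_diag hA)// (le_trans t00)// ltW.
      rewrite [control _ _](_ : _ = control p k)// hc hat0 trmx0 mul0mx add0r.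
      by rewrite cons_abs_rate_eq0 ?mulmx0//; exact: is_derive_cst.
- by move=> k t t0t; rewrite straightE /= subrr scale0r addr0.
- by move=> k j t _; exact: hw.
- by apply: stateP => k //=; rewrite subrr scale0r addr0.
Qed.

Lemma Sigma0_CbI t0 p : 0 <= t0 -> rotations p -> (forall k, control p k = 0) ->
  (forall k j, cons_abs p k = cons_abs p j) -> Sigma0_Cb A t0 p.
Proof.
move=> t00 hp hc hw; have [h1 h2 h3 h4] := equilibrium_solution t00 hp hc hw.
by exists (fun t => State (fun k => pos p k + (t - t0) *: vel p k) (att p) (cons p)), t0.
Qed.

(** Reduces a set of solutions to algebraic conditions on a state. Straightness freezes the
    attitudes and consensus freezes the [w_k], so the velocity and its rate [w_k - a x_k] are
    constant; the rate must then vanish, which puts [b_k] along [e_1] and makes the control zero. *)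
Lemma E0_CbP t0 p : 0 <= t0 -> (E0_Cb A t0 p <->
  [/\ rotations p, forall k, control p k = 0, forall k j, cons_abs p k = cons_abs p j
    & forall k j, vel p k = vel p j]).
Proof.
move=> t00; split=> [[s [t [hs [hst hpar] hcons t0t <-]]]|[hp hc hw hv]]; last first.
  have [h1 h2 h3 h4] := equilibrium_solution t00 hp hc hw.
  exists (fun t => State (fun k => pos p k + (t - t0) *: vel p k) (att p) (cons p)), t0.
  by split=> //; split=> // k j t _; exact: hv.
have hr u : t0 <= u -> rotations (s u).
  by move=> t0u; apply: (solution_rotations hs) => //; exact: ltry.
have attE k u : t0 <= u -> att (s u) k = att (s t0) k.
  by move=> t0u; have := hst k u t0u; rewrite straightE => /pose_inj[].
have wE k u : t0 <= u -> cons_abs (s u) k = cons_abs (s t0) k.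
  move=> t0u; apply: (consensus_constant t00 hs) => // j.
  exact: hcons.
split; [exact: hr|move=> k|move=> k j; exact: hcons|move=> k j; exact: hpar].
pose D := cons_abs (s t0) k - cons (s t0) k o0 0 *: vel (s t0) k.
have consE u : t0 <= u -> cons (s u) k = cons (s t0) k.
  move=> t0u; rewrite -(att_trmulK k (cons (s u) k) (hr u t0u)).
  by rewrite -/(cons_abs (s u) k) wE// attE// att_trmulK//; exact: hr.
have velE u : t0 <= u -> vel (s u) k = vel (s t0) k by move=> t0u; rewrite /vel attE.
have t01 : t0 <= t0 + 1 by rewrite lerDl.
have D0 : D = 0.
  apply/matrixP => i j; rewrite (ord1 j).
  have h := solution_vel hA k t00 hs (ltry (t0 + 1)) i 0.
  have h2 : vel (s (t0 + 1)) k i 0 - D i 0 * (t0 + 1) = vel (s t0) k i 0 - D i 0 * t0.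
    apply: (pw_derive0 t01 (pw_deriveB h (pw_deriveZ (D i 0) (pw_derive_id t0 (t0 + 1))))).
    by move=> u /andP[/ltW t0u _]; rewrite mulr1 wE// consE// velE// subrr.
  by rewrite [RHS]mxE; move: h2; rewrite velE//; lra.
have {D0} hb : cons (s t0) k = cons (s t0) k o0 0 *: e1 R.
  have : cons_abs (s t0) k = cons (s t0) k o0 0 *: vel (s t0) k.
    by apply/eqP; rewrite -subr_eq0; exact/eqP.
  move=> /(congr1 (mulmx (att (s t0) k)^T)); rewrite /cons_abs att_trmulK; last exact: hr.
  by rewrite -scalemxAr att_trmulK//; exact: hr.
apply: (@cons_e1_control _ _ (cons (s t0) k o0 0)); rewrite consE//.
Qed.

(* States with the positions of [s t] and attitudes rotated so that the velocities
   lie exactly along the limit consensus vector. *)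
Lemma aligned_states t0 s w B l (L : 'I_N -> R) : 0 <= t0 -> solution A t0 +oo%E s ->
  0 < l -> 0 <= B -> 0 < dot w w ->
  (forall t, t0 <= t -> forall k, `|cons_abs (s t) k - w| <= B * expR (- l * (t - t0))) ->
  (forall k, L k ^+ 2 = dot w w) ->
  (forall k e, 0 < e -> exists2 T, t0 <= T & forall t, T <= t ->
      `|cons (s t) k - L k *: e1 R| < e) ->
  forall e, 0 < e -> exists2 T, t0 <= T & forall t, T <= t ->
    exists p, [/\ rotations p, pos p = pos (s t), forall k, cons_abs p k = w,
      forall k, cons p k = L k *: e1 R
      & forall k, `|att p k - att (s t) k| < e /\ `|cons p k - cons (s t) k| < e].
Proof.
move=> t00 hs l0 B0 c0 hw L2 hL e e0.
(* [rotation_to] costs a factor 144 and yields a weak inequality; 145 makes it strict. *)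
pose e1' := Num.min 1 (e / 145).
have e1'0 : 0 < e1' by rewrite lt_min ltr01 divr_gt0.
have e1'1 : e1' <= 1 by rewrite ge_min lexx.
have e1'e : e1' <= e / 145 by rewrite ge_min lexx orbT.
have hr t : t0 <= t -> rotations (s t).
  by move=> t0t; apply: (solution_rotations hs) => //; exact: ltry.
have Lk0 k : L k != 0.
  by apply/eqP => h; move: c0; rewrite -(L2 k) h expr0n/= ltxx.
pose u k := (L k)^-1 *: w.
have uu k : dot (u k) (u k) = 1.
  rewrite dotZ -expr2.
  by rewrite -(L2 k) -exprMn mulVf// expr1n.
have uw k : w = L k *: u k by rewrite /u scalerA divff// scale1r.
have key k : exists2 T, t0 <= T & forall t, T <= t ->
   `|vel (s t) k - u k| <= e1' /\ `|cons (s t) k - L k *: e1 R| < e.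
  pose M := `|(L k)^-1|.
  have Mgt0 : 0 < M by rewrite normr_gt0 invr_eq0.
  (* Makes [x . u] differ from 1 by at most [e1' ^ 2 / 2], so that [|x - u|^2 = 2 - 2 x . u] is at
     most [e1' ^ 2]. *)
  pose d := e1' ^+ 2 / (8 * M).
  have d0 : 0 < d by rewrite divr_gt0 ?exprn_gt0// mulr_gt0.
  pose d' := Num.min d e; have d'0 : 0 < d' by rewrite lt_min d0.
  have [T1 t0T1 h1] := hL k d' d'0.
  have [T2 _ h2] := expN_lt t0 B l0 d0.
  exists (Num.max T1 T2); first by rewrite le_max t0T1.
  move=> t; rewrite ge_max => /andP[T1t T2t]; have t0t := le_trans t0T1 T1t.
  have {}h1 := h1 t T1t; have {}h2 := h2 t T2t.
  split; last by apply: (lt_le_trans h1); rewrite ge_min lexx orbT.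
  have hp := hr t t0t.
  have a1 : `|cons (s t) k o0 0 - L k| <= d.
    have := mx_norm_ge (cons (s t) k - L k *: e1 R) o0 0.
    rewrite mxBE mxZE e1E mulr1 => /le_trans; apply; apply: ltW.
    by apply: (lt_le_trans h1); rewrite ge_min lexx.
  have xw : `|dot (vel (s t) k) w - L k| <= 4 * d.
    have -> : dot (vel (s t) k) w - L k = (cons (s t) k o0 0 - L k)
        - dot (vel (s t) k) (cons_abs (s t) k - w).
      by rewrite -dot_vel_cons// !dotE !mxE; ring.
    rewrite (le_trans (ler_normB _ _))//.
    have : `|dot (vel (s t) k) (cons_abs (s t) k - w)| <= 3 * d.
      apply: (le_trans (dot_norm_le _ _)).
      have v1 : `|vel (s t) k| <= 1 by exact: vel_norm_le.
      have := le_lt_trans (hw t t0t k) h2 => /ltW h3.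
      by rewrite -mulrA ler_wpM2l// -[leRHS]mul1r ler_pM.
    by lra.
  have xu : dot (vel (s t) k) (u k) = (L k)^-1 * dot (vel (s t) k) w.
    by rewrite !dotE ?(mxBE, mxDE, mxZE); ring.
  have xu1 : `|dot (vel (s t) k) (u k) - 1| <= e1' ^+ 2 / 2.
    have -> : dot (vel (s t) k) (u k) - 1 = (L k)^-1 * (dot (vel (s t) k) w - L k).
      by rewrite xu mulrBr mulVf.
    rewrite normrM -/M.
    apply: (@le_trans _ _ (M * (4 * d))); first by rewrite ler_wpM2l// ltW.
    by apply: eq_ler; rewrite /d; field; rewrite gt_eqF.
  rewrite -ler_sqr ?nnegrE ?(ltW e1'0)//; apply: (le_trans (norm_sqr_le_dot _)).
  rewrite dotBB dot_vel// uu.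
  by move: xu1; rewrite ler_norml; lra.
have [T t0T hT] : exists2 T, t0 <= T & forall k t, T <= t ->
   `|vel (s t) k - u k| <= e1' /\ `|cons (s t) k - L k *: e1 R| < e.
  have [T _ hT] : exists2 T, 0 <= T & forall k, t0 <= T /\ forall t, T <= t ->
   `|vel (s t) k - u k| <= e1' /\ `|cons (s t) k - L k *: e1 R| < e.
    apply: (@fin_bound _ _ (fun k T => t0 <= T /\ forall t, T <= t ->
       `|vel (s t) k - u k| <= e1' /\ `|cons (s t) k - L k *: e1 R| < e)).
      move=> k M M' [h1 h2] MM; split; first exact: le_trans MM.
      by move=> t M't; apply: h2; exact: le_trans M't.
    by move=> k; have [T] := key k; exists T.
  exists (Num.max T t0); first by rewrite le_max lexx orbT.
  move=> k t; rewrite ge_max => /andP[Tt _]; case: (hT k) => _; exact.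
exists T => // t Tt; have t0t := le_trans t0T Tt.
have /choice[Q hQ] : forall k, exists Q, [/\ SO3 Q, Q *m e1 R = u k
    & `|Q - att (s t) k| <= 144 * e1'].
  by move=> k; apply: rotation_to => //; [exact: hr|case: (hT k t Tt)].
exists (State (pos (s t)) Q (fun k => L k *: e1 R)); split=> //.
- by move=> k; case: (hQ k).
- by move=> k; rewrite /cons_abs /= -scalemxAr; case: (hQ k) => _ -> _; rewrite -uw.
- move=> k; split; last by rewrite distrC; case: (hT k t Tt).
  case: (hQ k) => _ _ /le_lt_trans; apply.
  by apply: (@le_lt_trans _ _ (144 * (e / 145))); [rewrite ler_wpM2l|lra].
Qed.

(** The approximating state shares the positions of [s t], so no convergence of positions enters.
    For [w] nonzero its velocities are aligned with [w]; for [w = 0] there is no direction to align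
    with, and it suffices to keep the attitudes and set every [b_k] to zero. *)
Lemma converges_to_Sigma0_Cb t0 s : 0 <= t0 -> solution A t0 +oo%E s ->
  converges_to (@state_close R N) s (Sigma0_Cb A t0).
Proof.
move=> t00 hs e e0.
have [w [B [l [l0 B0 hw]]]] := consensus_limit t00 hs.
have hr t : t0 <= t -> rotations (s t).
  by move=> t0t; apply: (solution_rotations hs) => //; exact: ltry.
have [c0|c0] := eqVneq (dot w w) 0; last first.
  have {}c0 : 0 < dot w w by rewrite lt_neqAle eq_sym c0 dot_ge0.
  have /choice[L hL] : forall k, exists L, L ^+ 2 = dot w w /\
      forall e, 0 < e -> exists2 T, t0 <= T & forall t, T <= t ->
      `|cons (s t) k - L *: e1 R| < e.
    move=> k; have [L [h1 _ h2]] := @cons_limit t0 s w B l k t00 hs l0 B0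
      (fun t t0t => let: And3 a b _ := hw t t0t k in conj a b).
    by exists L.
  have [T t0T hT] := aligned_states t00 hs l0 B0 c0
    (fun t t0t k => let: And3 a _ _ := hw t t0t k in a)
    (fun k => proj1 (hL k)) (fun k => proj2 (hL k)) e0.
  exists T => t /hT[p [hp hpos hpw hpc hpa]]; exists p.
    apply: Sigma0_CbI => //; last by move=> k j; rewrite !hpw.
    by move=> k; exact: cons_e1_control (hpc k).
  move=> k; split; first by rewrite hpos subrr normr0.
    by rewrite distrC; case: (hpa k).
  by rewrite distrC; case: (hpa k).
have w0 : w = 0.
  by apply/eqP; apply: contraT => /dot_gt0; rewrite c0 ltxx.
have [T t0T hT] := expN_lt t0 (3 * B) l0 e0.
exists T => t Tt; have t0t := le_trans t0T Tt.
have hp := hr t t0t.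
exists (State (pos (s t)) (att (s t)) (fun=> 0)).
  apply: Sigma0_CbI => //=.
  - by move=> k; rewrite /control /cross mulmx0.
  - by move=> k j; rewrite /cons_abs !mulmx0.
move=> k /=; split; rewrite ?subrr ?normr0// subr0.
rewrite -(att_trmulK k (cons (s t) k) hp); apply: le_lt_trans (SO3_trmul_norm _ (hp k)) _.
have [h1 _ _] := hw t t0t k; rewrite w0 subr0 in h1.
by apply: le_lt_trans (hT t Tt); rewrite -mulrA ler_wpM2l.
Qed.

End Asymptotics.

(** * Neighborhoods in the extended shape space *)

Section ShapeSpace.
Variables (R : realType) (N : nat).
Implicit Types (p q r : state R N) (e : R).

Lemma attitude_close_refl e p : 0 < e -> attitude_close e p p.
Proof. by move=> e0; split=> *; rewrite subrr normr0. Qed.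

Lemma shape_close_refl e p : 0 < e -> shape_close e p p.
Proof. by move=> e0; split; [exact: attitude_close_refl|move=> *; rewrite subrr normr0]. Qed.

Lemma shape_close_sym e p q : shape_close e p q -> shape_close e q p.
Proof. by move=> [[h1 h2] h3]; split; [split|] => *; rewrite distrC. Qed.

Lemma shape_close_trans e e' p q r : shape_close e p q -> shape_close e' q r ->
  shape_close (e + e') p r.
Proof.
have tri m n (M1 M2 M3 : 'M[R]_(m, n)) : `|M1 - M2| < e -> `|M2 - M3| < e' ->
    `|M1 - M3| < e + e'.
  move=> h1 h2; have -> : M1 - M3 = (M1 - M2) + (M2 - M3) by rewrite addrA subrK.
  by rewrite (le_lt_trans (ler_normD _ _))// ltrD.
move=> [[h1 h2] h3] [[h1' h2'] h3']; split; [split|] => [k j|k|k j].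
- exact: tri (h1 k j) (h1' k j).
- exact: tri (h2 k) (h2' k).
- exact: tri (h3 k j) (h3' k j).
Qed.

Lemma shape_close_le e e' p q : e <= e' -> shape_close e p q -> shape_close e' p q.
Proof.
move=> ee [[h1 h2] h3]; split; [split|] => [k j|k|k j].
- exact: lt_le_trans (h1 k j) ee.
- exact: lt_le_trans (h2 k) ee.
- exact: lt_le_trans (h3 k j) ee.
Qed.

(** Applied to the set of all initial states with the wanted behavior, it gives the open
    neighborhood required by the definitions; what is left to prove is a ball around each point, of
    a radius depending on the point. *)
Definition shape_interior (P : set (state R N)) : set (state R N) :=
  [set p | exists2 e, 0 < e & forall q, shape_close e p q -> P q].

Lemma shape_interior_open P : open_for (@shape_close R N) (shape_interior P).
Proof.
move=> p [e e0 h]; exists (e / 2); first by rewrite divr_gt0.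
move=> q pq; exists (e / 2); first by rewrite divr_gt0.
move=> r qr; apply: h; apply: shape_close_le (shape_close_trans pq qr).
by rewrite -splitr.
Qed.

Lemma shape_interior_sub P : shape_interior P `<=` P.
Proof. by move=> p [e e0 h]; apply: h; exact: shape_close_refl. Qed.

Lemma rel_att_SO3 p k j : rotations p -> SO3 (rel_att p k j).
Proof.
move=> hp; have [h1 d1] := hp k; have [h2 d2] := hp j; split.
  rewrite /rel_att trmx_mul trmxK -mulmxA (mulmxA (att p k)).
  by rewrite (SO3_multr (hp k)) mul1mx.
by rewrite /rel_att det_mulmx det_tr d1 d2 mulr1.
Qed.

Lemma rel_att_diff p q k j : rotations p -> rotations q ->
  `|rel_att p k j - rel_att q k j| <= 3 * `|att p k - att q k| + 3 * `|att p j - att q j|.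
Proof.
move=> hp hq.
have -> : rel_att p k j - rel_att q k j =
    (att p k - att q k)^T *m att p j + (att q k)^T *m (att p j - att q j).
  by rewrite [(_ - _)^T]linearB/= mulmxBl mulmxBr addrA subrK.
apply: (le_trans (ler_normD _ _)); rewrite lerD ?SO3_trmul_norm//.
apply: (le_trans (mx_normM _ _)); rewrite mx_norm_tr -[leRHS]mulr1.
by rewrite ler_wpM2l ?mulr_ge0// SO3_norm_le.
Qed.

End ShapeSpace.

(** * Stability estimate near a parallel motion *)

Section ParallelStability.
Variables (R : realType) (N : nat) (eta gamma : R) (A : R -> 'M[R]_N).
Hypothesis hA : communication_graph eta gamma A.
Hypothesis hconn : uniformly_connected eta A.
Implicit Types (s : R -> state R N) (p q : state R N).

Lemma pos_diff_bound p k j : rotations p ->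
  `|pos p j - pos p k| <= 3 * `|rel_pos p k j|.
Proof.
move=> hp; rewrite -(att_mulK k (pos p j - pos p k) hp).
exact: SO3_mul_norm.
Qed.

(** Turns small misalignments and disagreement into a small difference of velocities, which is then
    integrated to control relative positions. The bounded vector is [b y - a x] with [x], [y] unit
    vectors; pairing it with [b y + a x] yields [b^2 - a^2], so [a - b] is small, and then so is
    [a (x - y)]. *)
Lemma vel_diff_bound p k j (beta e : R) : rotations p -> 0 < beta ->
  beta <= cons p k o0 0 -> beta <= cons p j o0 0 ->
  `|(cons_abs p j - cons p j o0 0 *: vel p j) -
    (cons_abs p k - cons p k o0 0 *: vel p k) - (cons_abs p j - cons_abs p k)| <= e ->
  `|vel p j - vel p k| <= 4 / beta * e.
Proof.
move=> hp b0 hk hj; set a := cons p j o0 0 in hj *; set b := cons p k o0 0 in hk *.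
set x := vel p j; set y := vel p k.
have a0 : 0 < a by exact: lt_le_trans hj.
have b0' : 0 < b by exact: lt_le_trans hk.
have -> : cons_abs p j - a *: x - (cons_abs p k - b *: y) - (cons_abs p j - cons_abs p k)
    = b *: y - a *: x.
  by apply/matrixP => i l; rewrite !(mxBE, mxZE); ring.
move=> h.
have vle k' : `|vel p k'| <= 1 by exact: vel_norm_le.
have e0 : 0 <= e by exact: le_trans h.
have ab : `|a - b| <= 3 * e.
  have d1 : `|dot (b *: y - a *: x) x| <= 3 * e.
    apply: (le_trans (dot_norm_le _ _)); rewrite -mulrA ler_wpM2l// -[leRHS]mulr1 ler_pM// ?vle//.
  have d2 : `|dot (b *: y - a *: x) y| <= 3 * e.
    apply: (le_trans (dot_norm_le _ _)); rewrite -mulrA ler_wpM2l// -[leRHS]mulr1 ler_pM// ?vle//.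
  have ab0 : 0 < a + b by rewrite addr_gt0.
  rewrite -(ler_pM2r ab0) -{1}(gtr0_norm ab0) -normrM.
  have -> : (a - b) * (a + b) = - (b * dot (b *: y - a *: x) y + a * dot (b *: y - a *: x) x).
    have hx : dot x x = 1 by exact: dot_vel.
    have hy : dot y y = 1 by exact: dot_vel.
    rewrite (_ : dot (b *: y - a *: x) y = b * dot y y - a * dot x y); last first.
      by rewrite !dotE !(mxBE, mxZE); ring.
    rewrite (_ : dot (b *: y - a *: x) x = b * dot x y - a * dot x x); last first.
      by rewrite !dotE !(mxBE, mxZE); ring.
    by rewrite hx hy; ring.
  rewrite normrN (le_trans (ler_normD _ _))// !normrM (gtr0_norm a0) (gtr0_norm b0').
  have := ler_wpM2l (ltW a0) d1; have := ler_wpM2l (ltW b0') d2; lra.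
have h4 : `|a *: (x - y)| <= 4 * e.
  have -> : a *: (x - y) = - (b *: y - a *: x) - (a - b) *: y.
    by rewrite opprB scalerBr scalerBl opprB -addrA addKr.
  rewrite (le_trans (ler_normB _ _))// normrN.
  have : `|(a - b) *: y| <= 3 * e.
    apply: mx_norm_le => [|i l]; first by rewrite mulr_ge0.
    rewrite mxZE normrM -[leRHS]mulr1 ler_pM// (le_trans (mx_norm_ge _ _ _))//.
    exact: vle.
  by lra.
apply: mx_norm_le => [|i l]; first by rewrite mulr_ge0// divr_ge0// ltW.
have := le_trans (mx_norm_ge _ i l) h4; rewrite mxZE normrM (gtr0_norm a0) => h5.
have -> : 4 / beta * e = 4 * e / beta by ring.
rewrite ler_pdivlMr//; apply: le_trans h5; rewrite mulrC ler_wpM2r//.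
Qed.

(** Half of the damping [beta x^2] absorbs the cross term, by Young's inequality
    [2 x y <= (beta / 2) x^2 + (2 / beta) y^2]. *)
Lemma young_step (beta a x y e : R) : 0 < beta -> beta / 2 <= a -> `|y| <= e ->
  (- a * x + y) * x + x * (- a * x + y) <= - (beta / 2) * (x * x) + 2 / beta * e ^+ 2.
Proof.
move=> b0 ba ye.
have h1 : 0 <= beta / 2 * (x - 2 / beta * y) ^+ 2 by rewrite mulr_ge0 ?sqr_ge0// divr_ge0// ltW.
have h2 : beta / 2 * (x - 2 / beta * y) ^+ 2 = beta / 2 * (x * x) - 2 * (x * y) + 2 / beta * y ^+ 2.
  by field; rewrite gt_eqF.
have h3 : 2 / beta * y ^+ 2 <= 2 / beta * e ^+ 2.
  rewrite ler_wpM2l ?divr_ge0 ?(ltW b0)// -[y ^+ 2]real_normK ?num_real//.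
  by rewrite lerXn2r// nnegrE// (le_trans _ ye).
have h4 : beta / 2 * (x * x) <= a * (x * x) by rewrite ler_wpM2r// -expr2 sqr_ge0.
by lra.
Qed.

(* As long as the first component of [b_k] stays above [beta / 2], the two others
   decay exponentially; the relative variables then vary by the integral of an
   exponential whose amplitude is proportional to the initial deviation [d]. *)
Lemma parallel_stable t0 p (beta : R) : 0 <= t0 -> rotations p -> 0 < beta ->
  (forall k, cons p k = beta *: e1 R) -> (forall k j, vel p k = vel p j) ->
  exists K d0, [/\ 0 < K, 0 < d0 & forall d s, 0 < d -> d <= d0 ->
    solution A t0 +oo%E s -> shape_close d (s t0) p ->
    forall t, t0 <= t -> shape_close (K * d) (s t) p].
Proof.
move=> t00 hp b0 hb hv.
have [C [l [C0 l0 hcr]]] := consensus_rate hA hconn.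
(* Per unit of [d], these constants bound: [K1] the initial disagreement of the [w_k], [K2] the
   coupling term in the body equations, [K3] the transverse parts of [b_k], [K4] the variation of
   the attitudes, [K5] the input of [vel_diff_bound], [K6] the variation of position differences,
   [K7] that of the first component of [b_k], [K8] that of the body-frame relative positions. *)
pose K1 := 3 * (4 + 3 * beta).
have K10 : 0 < K1 by rewrite mulr_gt0// ltr_wpDr// mulr_ge0// ltW.
pose K2 := 3 * (C * K1); have K20 : 0 < K2 by rewrite mulr_gt0// mulr_gt0.
(* The decay rate of the squared transverse part: no faster than the squared coupling term, and
   strictly below the damping [beta / 2] left by [young_step]. The amplitude decays at half this
   rate, [mu]. *)
pose nu := Num.min (2 * l) (beta / 4).
have nu0 : 0 < nu by rewrite lt_min mulr_gt0//= divr_gt0.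
pose mu := nu / 2; have mu0 : 0 < mu by rewrite divr_gt0.
have mul : mu <= l by rewrite ler_pdivrMr// mulrC ge_min lexx.
have nub : nu <= beta / 4 by rewrite ge_min lexx orbT.
pose K3 := 2 + 4 / beta * K2.
have K30 : 0 < K3 by rewrite ltr_wpDr// mulr_ge0 ?divr_ge0// ltW.
pose K4 := 3 * K3 / mu; have K40 : 0 < K4 by rewrite divr_gt0// mulr_gt0.
pose K5 := C * K1 + 6 * K3; have K50 : 0 < K5 by rewrite addr_gt0// mulr_gt0.
pose K6 := (8 / beta * K5) / mu.
have K60 : 0 < K6 by rewrite divr_gt0// mulr_gt0// divr_gt0.
pose K7 := (K3 ^+ 2 + K2) / mu.
have K70 : 0 < K7 by rewrite divr_gt0// addr_gt0// exprn_gt0.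
have [P P0 hP] : exists2 P, 0 <= P & forall kj : 'I_N * 'I_N, `|rel_pos p kj.1 kj.2| <= P.
  apply: (@fin_bound _ _ (fun kj P => `|rel_pos p kj.1 kj.2| <= P)).
    by move=> kj M M'; exact: le_trans.
  by move=> kj; exists `|rel_pos p kj.1 kj.2|.
pose K8 := 3 * K4 * (3 * (P + 1) + K6) + 3 * K6.
have K80 : 0 < K8.
  apply: addr_gt0; last by rewrite mulr_gt0.
  apply: mulr_gt0; first by rewrite mulr_gt0.
  by apply: addr_gt0 => //; rewrite mulr_gt0// ltr_wpDl.
pose K := 1 + (6 * K4 + (2 * K3 + K7) + K8).
(* The initial deviation [d] plus the integrated coupling term [K2 d / l] must not exceed
   [beta / 2]. *)
pose d0 := Num.min 1 ((beta / 2) / (1 + K2 / l)).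
have Kl : 0 < 1 + K2 / l by rewrite addr_gt0// divr_gt0.
exists K, d0; split.
- by rewrite /K; lra.
- by rewrite lt_min ltr01 !divr_gt0.
move=> d s dgt0 dd0 hs [[hQ hc] hr] t t0t.
have d1 : d <= 1 by rewrite (le_trans dd0)// ge_min lexx.
have dK : d * (1 + K2 / l) <= beta / 2.
  by rewrite -ler_pdivlMr// (le_trans dd0)// ge_min lexx orbT.
have hrot u : t0 <= u -> rotations (s u).
  by move=> t0u; apply: (solution_rotations hs) => //; exact: ltry.
have hr0 := hrot t0 (lexx t0).
have dge0 := ltW dgt0.
pose E u := expR (- l * (u - t0)); pose F u := expR (- mu * (u - t0)).
have E0 u : 0 <= E u by exact: expR_ge0.
have F0 u : 0 <= F u by exact: expR_ge0.
have EF u : t0 <= u -> E u <= F u.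
  by move=> t0u; rewrite ler_expR !mulNr lerN2 ler_wpM2r ?subr_ge0.
have F1 u : t0 <= u -> F u <= 1.
  move=> t0u; rewrite -[leRHS]expR0 ler_expR mulNr oppr_le0 mulr_ge0 ?subr_ge0//.
  exact: ltW.
have hS k j : `|cons_abs (s t0) k - cons_abs (s t0) j| <= K1 * d.
  set Q := rel_att (s t0) k j.
  have QSO : SO3 Q by exact: rel_att_SO3.
  (* At the parallel motion the relative attitudes fix [e_1]; so equal [b_k = beta e_1] and nearby
     relative attitudes give nearby [w_k]. *)
  have Qe1 : rel_att p k j *m e1 R = e1 R.
    rewrite /rel_att -mulmxA -[att p j *m e1 R]/(vel p j) (hv j k).
    exact: att_trmulK.
  have -> : cons_abs (s t0) k - cons_abs (s t0) j = att (s t0) k *m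
      ((cons (s t0) k - beta *: e1 R) - Q *m (cons (s t0) j - beta *: e1 R)
        - beta *: ((Q - rel_att p k j) *m e1 R)).
    rewrite mulmxBl Qe1 (mulmxBr Q) -scalemxAr scalerBr.
    rewrite (_ : _ - _ - _ = cons (s t0) k - Q *m cons (s t0) j); last first.
      by apply/matrixP => i m; rewrite !(mxBE, mxZE); ring.
    by rewrite mulmxBr /Q /rel_att -mulmxA att_mulK.
  apply: le_trans (SO3_mul_norm _ (hr0 k)) _; rewrite /K1 -mulrA ler_wpM2l//.
  have n1 : `|cons (s t0) k - beta *: e1 R| <= d by rewrite -(hb k) ltW.
  have n2 : `|Q *m (cons (s t0) j - beta *: e1 R)| <= 3 * d.
    apply: le_trans (SO3_mul_norm _ QSO) _; rewrite ler_wpM2l// -(hb j) ltW//.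
  have n3 : `|beta *: ((Q - rel_att p k j) *m e1 R)| <= 3 * beta * d.
    apply: mx_norm_le => [|i m]; first by rewrite !mulr_ge0// ltW.
    rewrite mxZE normrM (gtr0_norm b0) [3 * beta]mulrC -mulrA ler_wpM2l// ?(ltW b0)//.
    apply: le_trans (mx_norm_ge _ _ _) _; apply: le_trans (mx_normM _ _) _.
    rewrite -[leRHS]mulr1 ler_pM ?mulr_ge0//; first by rewrite ler_wpM2l// ltW//; exact: hQ.
    apply: mx_norm_le => // i' j'; rewrite (ord1 j'); move: i'.
    by apply: ord3P; rewrite e1E ?normr0 ?normr1.
  rewrite (le_trans (ler_normB _ _))//.
  by have := ler_normB (cons (s t0) k - beta *: e1 R) (Q *m (cons (s t0) j - beta *: e1 R)); lra.
have K1d : 0 <= K1 * d by rewrite mulr_ge0// ltW.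
have rate u k : t0 <= u -> `|cons_abs_rate A u (s u) k| <= C * K1 * d * E u.
  move=> t0u; have [h _] := hcr t0 s (K1 * d) t00 hs K1d hS u t0u k.
  by rewrite mulrA in h.
have disag u k j : t0 <= u -> `|cons_abs (s u) j - cons_abs (s u) k| <= C * K1 * d * E u.
  move=> t0u; have [_ h] := hcr t0 s (K1 * d) t00 hs K1d hS u t0u j.
  by have := h k; rewrite mulrA.
have dist u k i : t0 <= u ->
    `|((att (s u) k)^T *m cons_abs_rate A u (s u) k) i 0| <= K2 * d * E u.
  move=> t0u; apply: le_trans (SO3_entry_le _ _ _ (hrot u t0u k)) _.
  by have := rate u k t0u; rewrite /K2; lra.
have c0 k i : `|cons (s t0) k i 0 - beta * e1 R i 0| <= d.
  have := mx_norm_ge (cons (s t0) k - beta *: e1 R) i 0; rewrite mxBE mxZE.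
  by move=> /le_trans; apply; rewrite -(hb k) ltW.
have K2d : 0 <= K2 * d by rewrite mulr_ge0// ltW.
(* The quadratic terms only increase this component, so the integral of the coupling term bounds its
   decrease for all times directly, without a continuation argument. *)
have a_low u k : t0 <= u -> beta / 2 <= cons (s u) k o0 0.
  move=> t0u.
  have [h _ _] := solution_cons hA k t00 hs (ltry u).
  have hE : pw_derive t0 u (fun u => K2 * d / l * E u) (fun u => K2 * d / l * (- l * E u)).
    by apply: pw_deriveZ; exact: pw_derive_exp.
  have := pw_derive_le t0u hE h _.
  have -> : E t0 = 1 by rewrite /E subrr mulr0 expR0.
  rewrite mulr1 => h'.
  have {}h' : K2 * d / l * E u - K2 * d / l <= cons (s u) k o0 0 - cons (s t0) k o0 0.
    apply: h' => v /andP[/ltW t0v _]; have := dist v k o0 t0v; rewrite ler_norml => /andP[h2 _].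
    have -> : K2 * d / l * (- l * E v) = - (K2 * d * E v) by field; rewrite gt_eqF.
    have := sqr_ge0 (cons (s v) k o1 0); have := sqr_ge0 (cons (s v) k o2 0); lra.
  have := c0 k o0; rewrite e1E mulr1 ler_norml => /andP[h3 _].
  have : 0 <= K2 * d / l * E u by rewrite mulr_ge0// divr_ge0// ltW.
  have : K2 * d / l = d * (K2 / l) by ring.
  lra.
pose m u k := cons (s u) k o1 0 ^+ 2 + cons (s u) k o2 0 ^+ 2.
have m_le u k : t0 <= u -> m u k <= (K3 * d * F u) ^+ 2.
  move=> t0u; have [_ h1 h2] := solution_cons hA k t00 hs (ltry u).
  have hm := pw_deriveD (pw_deriveM h1 h1) (pw_deriveM h2 h2).
  pose D := 4 / beta * (K2 * d) ^+ 2.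
  have D0 : 0 <= D by rewrite mulr_ge0 ?sqr_ge0// divr_ge0// ltW.
  have nb : nu < beta / 2 by apply: (le_lt_trans nub); lra.
  have ma : 0 <= cons (s t0) k o1 0 * cons (s t0) k o1 0 + cons (s t0) k o2 0 * cons (s t0) k o2 0.
    by rewrite addr_ge0// -expr2 sqr_ge0.
  have E2 v : t0 <= v -> E v ^+ 2 <= expR (- nu * (v - t0)).
    move=> t0v; rewrite /E expr2 -expRD ler_expR.
    have : nu * (v - t0) <= 2 * l * (v - t0) by rewrite ler_wpM2r ?subr_ge0// ge_min lexx.
    by lra.
  have := exp_decay_bound t0u nb D0 ma hm _.
  rewrite -!expr2 -/(m u k) -/(m t0 k) => h.
  have FE : F u ^+ 2 = expR (- nu * (u - t0)).
    by rewrite /F expr2 -expRD; congr expR; rewrite /mu; field.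
  rewrite exprMn FE; apply: le_trans (h _) _; last first.
    rewrite ler_wpM2r ?expR_ge0//.
    have m0 : m t0 k <= 2 * d ^+ 2.
      have := c0 k o1; have := c0 k o2; rewrite !e1E !mulr0 !subr0 => h3 h4.
      have sq x : `|x| <= d -> x ^+ 2 <= d ^+ 2.
        by move=> hx; rewrite -real_normK ?num_real// lerXn2r// nnegrE.
      by have := sq _ h3; have := sq _ h4; rewrite /m; lra.
    have q1 : D / (beta / 2 - nu) <= D / (beta / 4).
      rewrite ler_wpM2l// lef_pV2 ?posrE ?subr_gt0//; first lra.
      by rewrite divr_gt0.
    have q2 : D / (beta / 4) = (4 / beta * K2) ^+ 2 * d ^+ 2.
      by rewrite /D; field; rewrite gt_eqF.
    have q3 : K3 ^+ 2 = 4 + 4 * (4 / beta * K2) + (4 / beta * K2) ^+ 2 by rewrite /K3; ring.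
    have X0 : 0 <= (2 + 4 * (4 / beta * K2)) * d ^+ 2.
      by rewrite mulr_ge0 ?sqr_ge0// addr_ge0// mulr_ge0// mulr_ge0 ?divr_ge0// ltW.
    rewrite exprMn q3; apply: (le_trans (lerD m0 (le_trans q1 (eq_ler q2)))).
    by rewrite -subr_ge0; apply: (le_trans X0); apply: eq_ler; ring.
  move=> v /andP[/ltW t0v _].
  have e1b := dist v k o1 t0v; have e2b := dist v k o2 t0v.
  have := young_step (cons (s v) k o1 0) b0 (a_low v k t0v) e1b.
  have := young_step (cons (s v) k o2 0) b0 (a_low v k t0v) e2b.
  have : D * E v ^+ 2 <= D * expR (- nu * (v - t0)) by rewrite ler_wpM2l// E2.
  have -> : D * E v ^+ 2 = 2 / beta * (K2 * d * E v) ^+ 2 + 2 / beta * (K2 * d * E v) ^+ 2.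
    by rewrite /D; ring.
  lra.
have K3dF u : 0 <= K3 * d * F u by rewrite !mulr_ge0// ltW.
have b1_le u k : t0 <= u -> `|cons (s u) k o1 0| <= K3 * d * F u.
  move=> t0u; rewrite -ler_sqr ?nnegrE// real_normK ?num_real//.
  by apply: le_trans (m_le u k t0u); rewrite lerDl sqr_ge0.
have b2_le u k : t0 <= u -> `|cons (s u) k o2 0| <= K3 * d * F u.
  move=> t0u; rewrite -ler_sqr ?nnegrE// real_normK ?num_real//.
  by apply: le_trans (m_le u k t0u); rewrite lerDr sqr_ge0.
have ctl u k : t0 <= u -> `|control (s u) k| <= K3 * d * F u.
  move=> t0u; apply: mx_norm_le => // i j; rewrite (ord1 j); move: i.
  by apply: ord3P; rewrite control_E ?normr0 ?normrN ?b1_le ?b2_le.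
have att_var k : `|att (s t) k - att (s t0) k| <= K4 * d.
  have [_ h _] := solution_pw hA k t00 hs (ltry t).
  apply: mx_norm_le => [|i j]; first by rewrite mulr_ge0// ltW.
  have -> : K4 * d = 3 * K3 * d / mu by rewrite /K4; ring.
  rewrite mxBE; apply: (exp_decay_variation0 mu0 _ t0t (h i j)).
    by rewrite !mulr_ge0// ltW.
  move=> u /andP[/ltW t0u _]; apply: le_trans (mx_norm_ge _ _ _) _.
  apply: le_trans (SO3_mul_norm _ (hrot u t0u k)) _.
  have := le_trans (norm_hat_le _) (ctl u k t0u); rewrite -/(F u); lra.
have a_var k : `|cons (s t) k o0 0 - cons (s t0) k o0 0| <= K7 * d.
  have [h _ _] := solution_cons hA k t00 hs (ltry t).
  have -> : K7 * d = (K3 ^+ 2 + K2) * d / mu by rewrite /K7; ring.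
  apply: (exp_decay_variation0 mu0 _ t0t h).
    by rewrite mulr_ge0// addr_ge0 ?sqr_ge0// ltW.
  move=> u /andP[/ltW t0u _]; have := m_le u k t0u; have := dist u k o0 t0u.
  rewrite -/(F u) => h1 h2; rewrite (le_trans (ler_normD _ _))//.
  rewrite -/(m u k) (ger0_norm (addr_ge0 (sqr_ge0 _) (sqr_ge0 _))) !mulrDl lerD//.
    apply: (le_trans h2).
    have -> : (K3 * d * F u) ^+ 2 = K3 ^+ 2 * (d * d) * (F u * F u) by ring.
    apply: ler_pM; [by rewrite mulr_ge0 ?sqr_ge0// mulr_ge0|by rewrite mulr_ge0| |].
      by rewrite ler_wpM2l ?sqr_ge0// ler_piMl.
    by rewrite ler_piMl// F1.
  by apply: (le_trans h1); rewrite ler_wpM2l// EF.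
have cons_var k : `|cons (s t) k - cons (s t0) k| <= (2 * K3 + K7) * d.
  have K3d : 0 <= K3 * d by rewrite mulr_ge0// ltW.
  have K7d : 0 <= K7 * d by rewrite mulr_ge0// ltW.
  have KF u : t0 <= u -> K3 * d * F u <= K3 * d by move=> t0u; rewrite ler_piMr// F1.
  have Kd : 0 <= (2 * K3 + K7) * d by lra.
  apply: mx_norm_le => // i j; rewrite (ord1 j) mxBE; move: i; apply: ord3P.
  - by apply: (le_trans (a_var k)); lra.
  - rewrite (le_trans (ler_normB _ _))//.
    have := le_trans (b1_le t k t0t) (KF t t0t).
    have := le_trans (b1_le t0 k (lexx t0)) (KF t0 (lexx t0)); lra.
  - rewrite (le_trans (ler_normB _ _))//.
    have := le_trans (b2_le t k t0t) (KF t t0t).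
    have := le_trans (b2_le t0 k (lexx t0)) (KF t0 (lexx t0)); lra.
have hrt := hrot t t0t.
have rel_att_var k j : `|rel_att (s t) k j - rel_att (s t0) k j| <= 6 * K4 * d.
  apply: (le_trans (rel_att_diff k j hrt hr0)).
  by have := att_var k; have := att_var j; lra.
have vel_le u k j : t0 <= u -> `|vel (s u) j - vel (s u) k| <= 8 / beta * K5 * d * F u.
  move=> t0u; have hu := hrot u t0u.
  have nk i : `|cons_abs (s u) i - cons (s u) i o0 0 *: vel (s u) i| <= 3 * K3 * d * F u.
    have -> : cons_abs (s u) i - cons (s u) i o0 0 *: vel (s u) i =
       att (s u) i *m (cons (s u) i - cons (s u) i o0 0 *: e1 R).
      by rewrite mulmxBr -scalemxAr.
    apply: le_trans (SO3_mul_norm _ (hu i)) _; rewrite -!mulrA ler_wpM2l// mulrA.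
    apply: mx_norm_le => // i' j'; rewrite (ord1 j') mxBE mxZE; move: i'.
    by apply: ord3P; rewrite e1E ?mulr1 ?mulr0 ?subrr ?subr0 ?normr0 ?b1_le ?b2_le.
  have b20 : 0 < beta / 2 by rewrite divr_gt0.
  have := @vel_diff_bound (s u) k j (beta / 2) (K5 * d * F u) hu b20 (a_low u k t0u) (a_low u j t0u).
  have -> : 4 / (beta / 2) * (K5 * d * F u) = 8 / beta * K5 * d * F u by field; rewrite gt_eqF.
  apply; rewrite (le_trans (ler_normB _ _))//.
  have := ler_normB (cons_abs (s u) j - cons (s u) j o0 0 *: vel (s u) j)
     (cons_abs (s u) k - cons (s u) k o0 0 *: vel (s u) k).
  have := nk j; have := nk k; have := disag u k j t0u.
  have : C * K1 * d * E u <= C * K1 * d * F u.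
    by rewrite ler_wpM2l ?EF// -mulrA mulr_ge0// ltW.
  by rewrite /K5; lra.
have pos_var k j : `|(pos (s t) j - pos (s t) k) - (pos (s t0) j - pos (s t0) k)| <= K6 * d.
  have [hj _ _] := solution_pw hA j t00 hs (ltry t).
  have [hk _ _] := solution_pw hA k t00 hs (ltry t).
  apply: mx_norm_le => [|i l']; first by rewrite mulr_ge0// ltW.
  have -> : K6 * d = 8 / beta * K5 * d / mu by rewrite /K6; ring.
  rewrite mxBE; apply: (exp_decay_variation0 mu0 _ t0t (mx_pw_deriveB hj hk i l')).
    by rewrite !mulr_ge0 ?invr_ge0// ltW.
  move=> u /andP[/ltW t0u _]; apply: le_trans (mx_norm_ge _ _ _) _; exact: vel_le.
have rel_pos_var k j : `|rel_pos (s t) k j - rel_pos (s t0) k j| <= K8 * d.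
  set rt := pos (s t) j - pos (s t) k; set r0 := pos (s t0) j - pos (s t0) k.
  have -> : rel_pos (s t) k j - rel_pos (s t0) k j =
    (att (s t) k - att (s t0) k)^T *m rt + (att (s t0) k)^T *m (rt - r0).
    by rewrite [(_ - _)^T]linearB/= mulmxBl (mulmxBr _ rt) addrA subrK.
  rewrite (le_trans (ler_normD _ _))//.
  have h1 := SO3_trmul_norm (rt - r0) (hr0 k).
  have h2 := mx_normM (att (s t) k - att (s t0) k)^T rt.
  have r0b : `|r0| <= 3 * (P + 1).
    apply: (le_trans (pos_diff_bound k j hr0)); rewrite ler_wpM2l//.
    have := ltW (hr k j); have := hP (k, j) => /= h3 h4.
    have : `|rel_pos (s t0) k j| <= `|rel_pos p k j| + `|rel_pos (s t0) k j - rel_pos p k j|.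
      by rewrite -{1}(subrK (rel_pos p k j) (rel_pos (s t0) k j)) addrC ler_normD.
    by lra.
  have rtb : `|rt| <= 3 * (P + 1) + K6.
    rewrite -(subrK r0 rt) (le_trans (ler_normD _ _))// addrC lerD//.
    by apply: (le_trans (pos_var k j)); rewrite ler_piMr// ltW.
  have h3 : 3 * `|(att (s t) k - att (s t0) k)^T| * `|rt| <= 3 * (K4 * d) * (3 * (P + 1) + K6).
    by rewrite mx_norm_tr ler_pM ?mulr_ge0// ler_wpM2l// att_var.
  have := pos_var k j; rewrite -/rt -/r0 /K8; lra.
have key e : 0 <= e -> e <= 6 * K4 + (2 * K3 + K7) + K8 -> forall m n (M1 M2 M3 : 'M[R]_(m, n)),
    `|M1 - M2| <= e * d -> `|M2 - M3| < d -> `|M1 - M3| < K * d.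
  move=> e0 eK m' n' M1 M2 M3 h1 h2; have -> : M1 - M3 = (M1 - M2) + (M2 - M3) by rewrite addrA subrK.
  rewrite (le_lt_trans (ler_normD _ _))//.
  have : e * d <= (6 * K4 + (2 * K3 + K7) + K8) * d by rewrite ler_wpM2r.
  by rewrite /K; lra.
split; [split|] => [k j|k|k j].
- by apply: (key (6 * K4)) (rel_att_var k j) (hQ k j); lra.
- by apply: (key (2 * K3 + K7)) (cons_var k) (hc k); lra.
- by apply: (key K8) (rel_pos_var k j) (hr k j); lra.
Qed.

End ParallelStability.

(** * Asymptotic stability of parallel motions *)

Section ParallelAsymptoticStability.
Variables (R : realType) (N : nat) (eta gamma : R) (A : R -> 'M[R]_N).
Hypothesis hA : communication_graph eta gamma A.
Hypothesis hconn : uniformly_connected eta A.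
Implicit Types (s : R -> state R N) (p q : state R N).

Lemma E0_headingP t0 p : 0 <= t0 -> (E0_Cb A t0 `&` @heading R N) p ->
  exists beta : R, [/\ rotations p, 0 < beta, forall k, cons p k = beta *: e1 R
    & forall k j, vel p k = vel p j].
Proof.
move=> t00 [/(E0_CbP hA p t00)[hp hc hw hv] hh].
have [T [delta [k0 _]]] := hconn.
exists (cons p k0 o0 0); split=> //; first by rewrite -dot_vel_cons.
move=> k; rewrite {1}(control_eq0 (hc k)); congr (_ *: _).
by rewrite -!dot_vel_cons// (hv k k0) (hw k k0).
Qed.

Lemma E0_headingI t0 p (beta : R) : 0 <= t0 -> rotations p -> 0 < beta ->
  (forall k, cons p k = beta *: e1 R) -> (forall k j, vel p k = vel p j) ->
  (E0_Cb A t0 `&` @heading R N) p.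
Proof.
move=> t00 hp b0 hc hv; split.
  apply/(E0_CbP hA p t00); split=> // [k|k j]; first exact: cons_e1_control (hc k).
  by rewrite (cons_e1_abs (hc k)) (cons_e1_abs (hc j)) (hv k j).
by move=> k; rewrite /heading/= dot_vel_cons// hc mxZE e1E mulr1.
Qed.

Lemma stable_parallel t0 : 0 <= t0 ->
  stable (@shape_close R N) A t0 (E0_Cb A t0 `&` @heading R N).
Proof.
move=> t00 U [Uo MU].
exists (shape_interior [set q | forall s, solution A t0 +oo%E s -> s t0 = q ->
    forall t, t0 <= t -> U (s t)]); last first.
  by move=> s hs /shape_interior_sub h; exact: h.
split; first exact: shape_interior_open.
move=> p Mp; have [beta [hp b0 hc hv]] := E0_headingP t00 Mp.
have [K [d0 [K0 d00 h]]] := parallel_stable hA hconn t00 hp b0 hc hv.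
have [e e0 hU] := Uo p (MU p Mp).
have dp : 0 < Num.min d0 (e / K) by rewrite lt_min d00 divr_gt0.
exists (Num.min d0 (e / K)) => // q pq s hs sq t t0t.
apply/hU/shape_close_sym; apply: (@shape_close_le _ _ (K * Num.min d0 (e / K))).
  by rewrite mulrC -ler_pdivlMr// ge_min lexx orbT.
apply: h => //; first by rewrite ge_min lexx.
by rewrite sq; exact: shape_close_sym.
Qed.

(** Staying within [beta / 2] of [p] keeps the first component of every [b_k] above [beta / 2],
    hence all limits [L k] are positive. As they have the same square they coincide, and the aligned
    states have equal velocities. These states share the positions of [s t], so their body-frame
    relative positions differ only through the attitudes, by an amount proportional to the bound
    [P]. *)
Lemma attractive_parallel t0 : 0 <= t0 ->
  attractive (@shape_close R N) A t0 (E0_Cb A t0 `&` @heading R N).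
Proof.
move=> t00.
exists (shape_interior [set q | forall s, solution A t0 +oo%E s -> s t0 = q ->
    converges_to (@shape_close R N) s (E0_Cb A t0 `&` @heading R N)]); last first.
  by move=> s hs /shape_interior_sub h; exact: h.
split; first exact: shape_interior_open.
move=> p Mp; have [beta [hp b0 hc hv]] := E0_headingP t00 Mp.
have [K [d0 [K0 d00 h]]] := parallel_stable hA hconn t00 hp b0 hc hv.
pose d := Num.min d0 (beta / 2 / K).
have dp : 0 < d by rewrite lt_min d00 !divr_gt0.
exists d => // q pq s hs sq.
have {}h t : t0 <= t -> shape_close (beta / 2) (s t) p.
  move=> t0t; apply: (@shape_close_le _ _ (K * d)).
    by rewrite mulrC -ler_pdivlMr// ge_min lexx orbT.
  apply: h => //; first by rewrite ge_min lexx.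
  by rewrite sq; exact: shape_close_sym.
have hr t : t0 <= t -> rotations (s t).
  by move=> t0t; apply: (solution_rotations hs) => //; exact: ltry.
have a_low t k : t0 <= t -> beta / 2 < cons (s t) k o0 0.
  move=> /h[[_ /(_ k) hk] _]; have := le_lt_trans (mx_norm_ge _ o0 0) hk.
  by rewrite hc mxBE mxZE e1E mulr1 ltr_norml; lra.
have [P P0 hP] : exists2 P, 0 <= P & forall (kj : 'I_N * 'I_N) t, t0 <= t ->
    `|rel_pos (s t) kj.1 kj.2| <= P.
  apply: (@fin_bound _ _ (fun kj P => forall t, t0 <= t -> `|rel_pos (s t) kj.1 kj.2| <= P)).
    by move=> kj M M' hM MM t t0t; exact: le_trans (hM t t0t) MM.
  move=> [k j]; exists (beta / 2 + `|rel_pos p k j|) => t /h[_ /(_ k j) hkj] /=.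
  rewrite -(subrK (rel_pos p k j) (rel_pos (s t) k j)) (le_trans (ler_normD _ _))//.
  by rewrite lerD2r ltW.
have [w [B [l [l0 B0 hw]]]] := consensus_limit hA hconn t00 hs.
have /choice[L hL] : forall k, exists L, [/\ L ^+ 2 = dot w w, 0 < L &
    forall e, 0 < e -> exists2 T, t0 <= T & forall t, T <= t ->
    `|cons (s t) k - L *: e1 R| < e].
  move=> k; have [L [h1 _ h2]] := cons_limit hA t00 hs l0 B0
    (fun t t0t => let: And3 a b _ := hw t t0t k in conj a b).
  exists L; split=> //; have b20 : 0 < beta / 2 by rewrite divr_gt0.
  have [T t0T hT] := h2 _ b20.
  have := le_lt_trans (mx_norm_ge _ o0 0) (hT T (lexx T)).
  have := a_low T k t0T.
  by rewrite mxBE mxZE e1E mulr1 ltr_norml; lra.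
have [T [delta [k0 _]]] := hconn.
have [L2 L0 _] := hL k0.
have LE k : L k = L k0.
  have [L2' L0' _] := hL k; apply/eqP; rewrite -(@eqrXn2 _ 2)// ?(ltW L0) ?(ltW L0')//.
  by rewrite L2 L2'.
have c0 : 0 < dot w w by rewrite -L2 exprn_gt0.
(* Relative attitudes need [6 e'] and relative positions [9 P e']; 7 instead of 6 leaves room for
   strictness. *)
move=> e e0; pose e' := e / (7 + 9 * P).
have c7 : 0 < 7 + 9 * P by rewrite ltr_wpDr// mulr_ge0.
have e'0 : 0 < e' by rewrite divr_gt0.
have eE : e = 7 * e' + 9 * P * e' by rewrite /e'; field; rewrite gt_eqF.
have Pe' : 0 <= P * e' by rewrite mulr_ge0// ltW.
have [T' t0T hT] := aligned_states t00 hs l0 B0 c0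
  (fun t t0t k => let: And3 a _ _ := hw t t0t k in a)
  (fun k => let: And3 a _ _ := hL k in a) (fun k => let: And3 _ _ a := hL k in a) e'0.
exists T' => t T't; have t0t := le_trans t0T T't.
have [r [hrr rpos rw rc rd]] := hT t T't; exists r.
  apply: (E0_headingI t00 hrr L0); first by move=> k; rewrite rc LE.
  move=> k j; apply: (@scalerI _ _ (L k0)); first by rewrite gt_eqF.
  by rewrite -{1}(LE k) -{1}(LE j) -!cons_e1_abs// !rw.
have ra k : `|att (s t) k - att r k| < e' by rewrite distrC; case: (rd k).
split; [split|] => [k j|k|k j].
- apply: le_lt_trans (rel_att_diff k j (hr t t0t) hrr) _.
  by have := ra k; have := ra j; lra.
- by rewrite distrC; case: (rd k) => _; lra.
- rewrite /rel_pos rpos -mulmxBl -[X in X *m _]linearB/=.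
  apply: (le_lt_trans (mx_normM _ _)); rewrite mx_norm_tr.
  have h1 := pos_diff_bound k j (hr t t0t); have := hP (k, j) t t0t => /= h2.
  have h3 : `|pos (s t) j - pos (s t) k| <= 3 * P by apply: (le_trans h1); rewrite ler_wpM2l.
  have : 3 * `|att (s t) k - att r k| * `|pos (s t) j - pos (s t) k| <= 3 * e' * (3 * P).
    by rewrite ler_pM ?mulr_ge0// ler_wpM2l// ltW.
  lra.
Qed.

End ParallelAsymptoticStability.

(** * Instability of the other limit sets *)

Section Instability.
Variables (R : realType) (N : nat) (eta gamma : R) (A : R -> 'M[R]_N).
Hypothesis hA : communication_graph eta gamma A.
Hypothesis hconn : uniformly_connected eta A.
Implicit Types (s : R -> state R N) (p q : state R N).

Definition vanishes (t0 : R) (f : R -> R) : Prop :=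
  forall e, 0 < e -> exists2 T, t0 <= T & forall t, T <= t -> `|f t| < e.

Lemma vanishesD t0 f g h (K : R) : 0 < K -> vanishes t0 f -> vanishes t0 g ->
  (forall t, t0 <= t -> `|h t| <= K * (`|f t| + `|g t|)) -> vanishes t0 h.
Proof.
move=> K0 hf hg hh e e0; have e'0 : 0 < e / (2 * K) by rewrite divr_gt0// mulr_gt0.
have [T1 t0T1 h1] := hf _ e'0; have [T2 _ h2] := hg _ e'0.
exists (Num.max T1 T2); first by rewrite le_max t0T1.
move=> t; rewrite ge_max => /andP[T1t T2t].
apply: (le_lt_trans (hh t (le_trans t0T1 T1t))); rewrite mulrC -ltr_pdivlMr//.
apply: (lt_le_trans (ltrD (h1 t T1t) (h2 t T2t))); apply: eq_ler.
by field; rewrite gt_eqF.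
Qed.

Lemma vel_limit t0 s w k (L : R) : 0 <= t0 -> solution A t0 +oo%E s ->
  vanishes t0 (fun t => `|cons_abs (s t) k - w|) ->
  vanishes t0 (fun t => `|cons (s t) k - L *: e1 R|) ->
  vanishes t0 (fun t => `|L *: vel (s t) k - w|).
Proof.
move=> t00 hs h1 h2; apply: (@vanishesD t0 _ _ _ 3 _ h1 h2) => // t t0t.
have hp : rotations (s t) by apply: (solution_rotations hs) => //; exact: ltry.
have -> : L *: vel (s t) k - w =
    (cons_abs (s t) k - w) - att (s t) k *m (cons (s t) k - L *: e1 R).
  by rewrite mulmxBr -scalemxAr opprB [RHS]addrC addrA subrK.
rewrite !normr_id (le_trans (ler_normB _ _))//.
have := SO3_mul_norm (cons (s t) k - L *: e1 R) (hp k).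
have := normr_ge0 (cons_abs (s t) k - w); lra.
Qed.

(** Both [Lk x_k] and [Lj x_j] tend to [w], so their inner product tends to [|w|^2]. *)
Lemma vel_dot_limit t0 s w k j (Lk Lj : R) : 0 <= t0 -> solution A t0 +oo%E s ->
  (forall i, vanishes t0 (fun t => `|cons_abs (s t) i - w|)) ->
  vanishes t0 (fun t => `|cons (s t) k - Lk *: e1 R|) ->
  vanishes t0 (fun t => `|cons (s t) j - Lj *: e1 R|) ->
  vanishes t0 (fun t => Lk * Lj * rel_att (s t) k j 0 0 - dot w w).
Proof.
move=> t00 hs hw hk hj.
have hk' := vel_limit t00 hs (hw k) hk; have hj' := vel_limit t00 hs (hw j) hj.
have K0 : 0 < 3 * (`|Lj| + `|w| + 1) by rewrite mulr_gt0// ltr_wpDl// addr_ge0.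
apply: (@vanishesD t0 _ _ _ _ K0 hk' hj') => t t0t.
have hp : rotations (s t) by apply: (solution_rotations hs) => //; exact: ltry.
rewrite rel_att_dot; set x := vel (s t) k; set y := vel (s t) j.
have -> : Lk * Lj * dot x y - dot w w =
    Lj * dot (Lk *: x - w) y + dot w (Lj *: y - w).
  by rewrite !dotE !(mxBE, mxZE); ring.
rewrite !normr_id (le_trans (ler_normD _ _))// normrM.
have y1 : `|y| <= 1 by exact: vel_norm_le.
have h1 : `|dot (Lk *: x - w) y| <= 3 * `|Lk *: x - w|.
  by apply: (le_trans (dot_norm_le _ _)); rewrite ler_piMr// mulr_ge0.
have h2 := dot_norm_le w (Lj *: y - w).
have := ler_wpM2l (normr_ge0 Lj) h1.
have := mulr_ge0 (normr_ge0 w) (normr_ge0 (Lk *: x - w)).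
have := mulr_ge0 (normr_ge0 Lj) (normr_ge0 (Lj *: y - w)).
have := normr_ge0 (Lj *: y - w); have := normr_ge0 (Lk *: x - w).
lra.
Qed.

(** The case of zero limit consensus, in which [w] singles out no direction: the velocities then
    have exponentially small derivatives, so their angles still converge. *)
Lemma vel_dot_converges t0 s B l k j : 0 <= t0 -> solution A t0 +oo%E s -> 0 < l -> 0 <= B ->
  (forall t, t0 <= t -> forall k, `|cons_abs (s t) k| <= B * expR (- l * (t - t0))) ->
  exists c, vanishes t0 (fun t => rel_att (s t) k j 0 0 - c).
Proof.
move=> t00 hs l0 B0 hw.
have hd b : pw_derive t0 b (fun t => rel_att (s t) k j 0 0) (fun t =>
    dot (cons_abs (s t) k - cons (s t) k o0 0 *: vel (s t) k) (vel (s t) j) +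
    dot (vel (s t) k) (cons_abs (s t) j - cons (s t) j o0 0 *: vel (s t) j)).
  have hk := solution_vel hA k t00 hs (ltry b); have hj := solution_vel hA j t00 hs (ltry b).
  apply: pw_derive_ext (pw_derive_eqf _ (mx_pw_deriveM (mx_pw_derive_tr hk) hj 0 0)).
    by move=> t _; rewrite mxDE.
  by move=> t _; rewrite rel_att_dot.
have [|t /ltW t0t|c hc] := @exp_decay_limit _ t0 _ _ (24 * B) l l0 _ hd.
- by rewrite mulr_ge0.
- have hp : rotations (s t) by apply: (solution_rotations hs) => //; exact: ltry.
  have v1 i : `|vel (s t) i| <= 1 by exact: vel_norm_le.
  set E := expR _; have E0 : 0 <= E by exact: expR_ge0.
  have vr i : `|cons_abs (s t) i - cons (s t) i o0 0 *: vel (s t) i| <= 4 * (B * E).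
    have h1 := hw t t0t i; rewrite -/E in h1.
    have h2 : `|cons (s t) i o0 0| <= 3 * (B * E).
      rewrite -(att_trmulK i (cons (s t) i) hp).
      by apply: (le_trans (SO3_entry_le _ _ _ (hp i))); rewrite ler_wpM2l.
    rewrite (le_trans (ler_normB _ _))//.
    have : `|cons (s t) i o0 0 *: vel (s t) i| <= 3 * (B * E).
      apply: mx_norm_le => [|a b]; first by rewrite !mulr_ge0.
      by rewrite mxZE normrM -[leRHS]mulr1 ler_pM// (le_trans (mx_norm_ge _ _ _)).
    by lra.
  rewrite (le_trans (ler_normD _ _))//.
  have d1 : `|dot (cons_abs (s t) k - cons (s t) k o0 0 *: vel (s t) k) (vel (s t) j)|
      <= 3 * (4 * (B * E)).
    apply: (le_trans (dot_norm_le _ _)); rewrite -[leRHS]mulr1 ler_pM ?mulr_ge0//.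
    by rewrite ler_wpM2l.
  have d2 : `|dot (vel (s t) k) (cons_abs (s t) j - cons (s t) j o0 0 *: vel (s t) j)|
      <= 3 * (4 * (B * E)).
    apply: (le_trans (dot_norm_le _ _)); rewrite -mulrA ler_wpM2l// -[leRHS]mul1r.
    by rewrite ler_pM.
  lra.
exists c => e e0; have [T t0T hT] := expN_lt t0 (24 * B / l) l0 e0.
by exists T => // t Tt; apply: (le_lt_trans (hc t (le_trans t0T Tt))); exact: hT.
Qed.

Lemma expN_vanishes t0 l B (f : R -> R) : 0 < l ->
  (forall t, t0 <= t -> `|f t| <= B * expR (- l * (t - t0))) -> vanishes t0 f.
Proof.
move=> l0 h e e0; have [T t0T hT] := expN_lt t0 B l0 e0.
by exists T => // t Tt; apply: (le_lt_trans (h t (le_trans t0T Tt))); exact: hT.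
Qed.

(** All points of a limit set share the vectors [b_k = L k e_1] and the cosines [c k j], since these
    observables converge along the solution. Instability then follows once a perturbed solution
    moves one of them away from its common value. *)
Lemma limit_set_shape t0 s : 0 <= t0 -> solution A t0 +oo%E s ->
  exists (c0 : R) (L : 'I_N -> R) (c : 'I_N -> 'I_N -> R),
  [/\ forall k, L k ^+ 2 = c0, forall k j, L k * L j * c k j = c0,
      forall p, limit_set s p -> forall k, cons p k = L k *: e1 R
    & forall p, limit_set s p -> forall k j, rel_att p k j 0 0 = c k j].
Proof.
move=> t00 hs; have [w [B [l [l0 B0 hw]]]] := consensus_limit hA hconn t00 hs.
have /choice[L hL] : forall k, exists L, L ^+ 2 = dot w w /\
    vanishes t0 (fun t => `|cons (s t) k - L *: e1 R|).
  move=> k; have [L [h1 _ h2]] := cons_limit hA t00 hs l0 B0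
    (fun t t0t => let: And3 a b _ := hw t t0t k in conj a b).
  exists L; split=> // e /h2[T t0T hT]; exists T => // t Tt.
  by rewrite normr_id; exact: hT.
have hwv i : vanishes t0 (fun t => `|cons_abs (s t) i - w|).
  apply: (@expN_vanishes _ l B) => // t t0t; rewrite normr_id.
  by have [h _ _] := hw t t0t i; exact: h.
have lim0 (x : R) (f : R -> R) : vanishes t0 f ->
    (forall e T, 0 < e -> exists2 t, T <= t & `|x - f t| < e) -> x = 0.
  move=> hf hx; apply/eqP/negPn/negP; rewrite -normr_gt0 => x0.
  have x20 : 0 < `|x| / 2 by rewrite divr_gt0.
  have [T t0T hT] := hf _ x20; have [t Tt ht] := hx _ T x20.
  have := ler_normD (x - f t) (f t); rewrite subrK leNgt => /negP; apply.
  by have := hT t Tt; lra.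
have /choice[c hc] : forall kj : 'I_N * 'I_N, exists c, L kj.1 * L kj.2 * c = dot w w /\
    vanishes t0 (fun t => rel_att (s t) kj.1 kj.2 0 0 - c).
  move=> [k j] /=; have [[Lk hk] [Lj hj]] := (hL k, hL j).
  have [c0|c0] := eqVneq (dot w w) 0.
    have w0 : w = 0 by apply/eqP; apply: contraT => /dot_gt0; rewrite c0 ltxx.
    have [|c hc] := @vel_dot_converges t0 s B l k j t00 hs l0 B0.
      by move=> t t0t i; case: (hw t t0t i); rewrite w0 subr0.
    exists c; split=> //; move: Lk; rewrite c0 => /eqP; rewrite sqrf_eq0 => /eqP ->.
    by rewrite !mul0r.
  have Lkj : L k * L j != 0 by rewrite mulf_neq0// -sqrf_eq0 ?Lk ?Lj.
  exists (dot w w / (L k * L j)); split; first by rewrite mulrC divfK.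
  have hkj := vel_dot_limit t00 hs hwv hk hj.
  have K0 : 0 < `|(L k * L j)^-1| by rewrite normr_gt0 invr_eq0.
  apply: (vanishesD K0 hkj hkj) => t t0t.
  have -> : rel_att (s t) k j 0 0 - dot w w / (L k * L j) =
      (L k * L j)^-1 * (L k * L j * rel_att (s t) k j 0 0 - dot w w).
    by rewrite mulrBr mulKf// [_^-1 * dot w w]mulrC.
  by rewrite normrM ler_wpM2l// lerDl.
exists (dot w w), L, (fun k j => c (k, j)); split.
- by move=> k; case: (hL k).
- by move=> k j; case: (hc (k, j)).
- move=> p [_ hp] k; apply/eqP; rewrite -subr_eq0 -normr_eq0; apply/eqP.
  apply: (lim0 _ _ (proj2 (hL k))) => e T e0; have [t Tt [_ /(_ k) ht]] := hp e T e0.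
  exists t => //; apply: (le_lt_trans (ler_dist_dist _ _)); rewrite opprB addrA subrK.
  by rewrite distrC.
- move=> p [_ hp] k j; apply/eqP; rewrite -subr_eq0; apply/eqP.
  apply: (lim0 _ _ (proj2 (hc (k, j)))) => e T e0; have [t Tt [/(_ k j) ht _]] := hp e T e0.
  exists t => //=; rewrite opprB addrA subrK -mxBE.
  by apply: (le_lt_trans (mx_norm_ge _ _ _)); rewrite distrC.
Qed.

(** The squared distance of [L_k x_k] and [L_j x_j] is [L_k^2 + L_j^2 - 2 L_k L_j c_kj], which is
    zero. *)
Lemma limit_set_consensus t0 s p : 0 <= t0 -> solution A t0 +oo%E s -> limit_set s p ->
  forall k j, cons_abs p k = cons_abs p j.
Proof.
move=> t00 hs hp k j; have [c0 [L [c [h1 h2 h3 h4]]]] := limit_set_shape t00 hs.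
have hr : rotations p by case: hp.
apply/eqP; rewrite -subr_eq0; apply/negPn/negP => /dot_gt0.
rewrite dotBB !(cons_e1_abs (h3 p hp _)).
rewrite !dotZ !dot_vel// -rel_att_dot h4// h2 !mulr1 -!expr2 !h1.
by rewrite mulrDl mul1r subrr ltxx.
Qed.

Lemma limit_set_E0P t0 s p : 0 <= t0 -> solution A t0 +oo%E s -> limit_set s p ->
  (forall k j, vel p k = vel p j) -> E0_Cb A t0 p.
Proof.
move=> t00 hs hp hv; have [c0 [L [c [_ _ h3 _]]]] := limit_set_shape t00 hs.
apply/(E0_CbP hA p t00); split=> //; first by case: hp.
  by move=> k; exact: cons_e1_control (h3 p hp k).
exact: limit_set_consensus hs hp.
Qed.

(** Once the [w_i] agree they are constant and [a] is nondecreasing, so its limit is at least its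
    initial value, which is strictly above [-|w|]. The limit being [|w|] or [-|w|], it is [|w|]. *)
Lemma heading_unstable t0 s w k : 0 <= t0 -> solution A t0 +oo%E s ->
  (forall i, cons_abs (s t0) i = w) -> cons (s t0) k o0 0 ^+ 2 < dot w w ->
  exists L, [/\ 0 < L, L ^+ 2 = dot w w & vanishes t0 (fun t => `|cons (s t) k - L *: e1 R|)].
Proof.
move=> t00 hs hw hk.
(* The exponential errors are zero here, with the arbitrary rate 1; the correction term in the lower
   bound for [L] disappears. *)
have hwt t : t0 <= t -> `|cons_abs (s t) k - w| <= 0 * expR (- 1 * (t - t0)) /\
    `|cons_abs_rate A t (s t) k| <= 0 * expR (- 1 * (t - t0)).
  move=> t0t; rewrite mul0r (consensus_constant hA t00 hs hw)// subrr normr0.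
  rewrite cons_abs_rate_eq0 ?normr0// => i j.
  by rewrite !(consensus_constant hA t00 hs hw).
have [L [L2 hL hv]] := cons_limit hA t00 hs ltr01 (lexx 0) hwt.
have {hL} aL : cons (s t0) k o0 0 <= L.
  by have := hL t0 (lexx t0); rewrite mulr0 !mul0r subr0.
exists L; split=> //; last first.
  by move=> e /hv[T t0T hT]; exists T => // t Tt; rewrite normr_id; exact: hT.
rewrite ltNge; apply/negP => L0; move: hk; rewrite -L2 ltNge => /negP; apply.
by rewrite -[L ^+ 2]sqrrN -[leRHS]sqrrN lerXn2r ?nnegrE ?oppr_ge0 ?lerN2// (le_trans aL).
Qed.

Lemma vel_align t0 s w k j : 0 <= t0 -> solution A t0 +oo%E s ->
  (forall i, cons_abs (s t0) i = w) ->
  cons (s t0) k o0 0 ^+ 2 < dot w w -> cons (s t0) j o0 0 ^+ 2 < dot w w ->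
  vanishes t0 (fun t => rel_att (s t) k j 0 0 - 1).
Proof.
move=> t00 hs hw hk hj.
have [L [L0 L2 hL]] := heading_unstable t00 hs hw hk.
have [L' [L'0 L'2 hL']] := heading_unstable t00 hs hw hj.
have LL : L' = L by apply/eqP; rewrite -(@eqrXn2 _ 2)// ?(ltW L0) ?(ltW L'0)// L2 L'2.
rewrite LL in hL'.
have hwv i : vanishes t0 (fun t => `|cons_abs (s t) i - w|).
  move=> e e0; exists t0 => // t t0t.
  by rewrite (consensus_constant hA t00 hs hw)// subrr !normr0.
have hkj := vel_dot_limit t00 hs hwv hL hL'.
have K0 : 0 < (L ^+ 2)^-1 by rewrite invr_gt0 exprn_gt0.
apply: (vanishesD K0 hkj hkj) => t t0t.
have -> : rel_att (s t) k j 0 0 - 1 = (L ^+ 2)^-1 * (L * L * rel_att (s t) k j 0 0 - dot w w).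
  by rewrite -L2; field; rewrite gt_eqF.
by rewrite normrM (gtr0_norm K0) ler_wpM2l ?(ltW K0)// lerDl.
Qed.

(** A velocity exactly along or against [w] stays so, even where this equilibrium repels. The
    squared transverse part starts at 0 and grows at a rate of at most [2 K], so [exp_decay_bound]
    with zero forcing and negative rates keeps it at 0. *)
Lemma cons_e1_invariant t0 s w (d : R) k : 0 <= t0 -> solution A t0 +oo%E s ->
  (forall i, cons_abs (s t0) i = w) -> cons (s t0) k = d *: e1 R ->
  forall t, t0 <= t -> cons (s t) k = d *: e1 R.
Proof.
move=> t00 hs hw hk.
have hr t : t0 <= t -> rotations (s t).
  by move=> t0t; apply: (solution_rotations hs) => //; exact: ltry.
have rate0 t : t0 <= t -> cons_abs_rate A t (s t) k = 0.
  move=> t0t; rewrite cons_abs_rate_eq0// => i j.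
  by rewrite !(consensus_constant hA t00 hs hw).
have b0 t : t0 <= t -> cons (s t) k o1 0 ^+ 2 + cons (s t) k o2 0 ^+ 2 <= 0.
  move=> t0t; have [_ h1 h2] := solution_cons hA k t00 hs (ltry t).
  have hm := pw_deriveD (pw_deriveM h1 h1) (pw_deriveM h2 h2).
  have m0 : cons (s t0) k o1 0 * cons (s t0) k o1 0 + cons (s t0) k o2 0 * cons (s t0) k o2 0 = 0.
    by rewrite hk !mxZE !e1E !mulr0 addr0.
  pose K := 3 * `|w|.
  have aK u : t0 <= u -> `|cons (s u) k o0 0| <= K.
    move=> t0u; rewrite -(att_trmulK k (cons (s u) k) (hr u t0u)).
    rewrite -/(cons_abs (s u) k) (consensus_constant hA t00 hs hw)//.
    by apply: SO3_entry_le; exact: hr.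
  have lK : - (2 * K) - 1 < - (2 * K) by rewrite ltrBlDr ltrDl.
  have := exp_decay_bound t0t lK (lexx 0) _ hm _.
  rewrite m0 !mul0r addr0 mul0r -!expr2; apply=> // u /andP[/ltW t0u _].
  have z i : (0 : 'cV[R]_3) i 0 = 0 by rewrite mxE.
  rewrite rate0// mulmx0 !z !addr0 mul0r addr0.
  set a := cons _ _ o0 0; set x := cons _ _ o1 0; set y := cons _ _ o2 0.
  have -> : - a * x * x + x * (- a * x) + (- a * y * y + y * (- a * y)) =
     2 * (- a) * (x * x + y * y) by ring.
  rewrite opprK ler_wpM2r ?addr_ge0 -?expr2 ?sqr_ge0// ler_wpM2l//.
  by have := aK u t0u; rewrite ler_norml => /andP[h _]; rewrite lerNl.
have b1 t : t0 <= t -> cons (s t) k o1 0 = 0 /\ cons (s t) k o2 0 = 0.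
  move=> /b0; have := sqr_ge0 (cons (s t) k o1 0); have := sqr_ge0 (cons (s t) k o2 0).
  by move=> h1 h2 h3; split; apply/eqP; rewrite -sqrf_eq0 eq_le; apply/andP; split; lra.
move=> t t0t; have [h1 h2] := b1 t t0t; rewrite (cV_e1P h1 h2); congr (_ *: _).
have [h0 _ _] := solution_cons hA k t00 hs (ltry t).
rewrite (pw_derive0 t0t h0); first by rewrite hk mxZE e1E mulr1.
move=> u /andP[/ltW t0u _]; have [-> ->] := b1 u t0u.
by rewrite rate0// mulmx0 mxE expr0n/= !addr0.
Qed.

Definition with_consensus p (w : 'cV[R]_3) : state R N :=
  State (pos p) (att p) (fun k => (att p k)^T *m w).

Lemma open_rel_att_lt k j (c : R) :
  open_for (@attitude_close R N) [set q | rel_att q k j 0 0 < c].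
Proof.
move=> p /= h; exists (c - rel_att p k j 0 0); first by rewrite subr_gt0.
move=> q [/(_ k j) hq _] /=; have := le_lt_trans (mx_norm_ge _ 0 0) hq.
by rewrite mxBE ltr_norml => /andP[h1 h2]; lra.
Qed.

Lemma open_rel_att_gt k j (c : R) :
  open_for (@attitude_close R N) [set q | c < rel_att q k j 0 0].
Proof.
move=> p /= h; exists (rel_att p k j 0 0 - c); first by rewrite subr_gt0.
move=> q [/(_ k j) hq _] /=; have := le_lt_trans (mx_norm_ge _ 0 0) hq.
by rewrite mxBE ltr_norml => /andP[h1 h2]; lra.
Qed.

Lemma open_cons_lt k (c : R) :
  open_for (@attitude_close R N) [set q | cons q k o0 0 < c].
Proof.
move=> p /= h; exists (c - cons p k o0 0); first by rewrite subr_gt0.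
move=> q [_ /(_ k) hq] /=; have := le_lt_trans (mx_norm_ge _ o0 0) hq.
by rewrite mxBE ltr_norml => /andP[h1 h2]; lra.
Qed.

(* Adding to [w] a vector orthogonal to both velocities increases [dot w w] but not
   the components of [w] along them: the velocities are no longer along [- w]. *)
Lemma tilt p k j (w : 'cV[R]_3) (a e : R) : rotations p -> (forall i, cons_abs p i = w) ->
  w = a *: vel p k -> 0 < e ->
  exists w', [/\ attitude_close e p (with_consensus p w'),
    forall i, cons_abs (with_consensus p w') i = w',
    cons (with_consensus p w') k o0 0 = cons p k o0 0,
    cons (with_consensus p w') j o0 0 = cons p j o0 0 & dot w w < dot w' w'].
Proof.
move=> hp hw wa e0; have [v [v0 vk vj]] := orthogonal_vector (vel p k) (vel p j).
pose d := e / (3 * `|v| + 1); have d0 : 0 < d by rewrite divr_gt0// ltr_wpDl// mulr_ge0.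
have hq : rotations (with_consensus p (w + d *: v)) by [].
have hqw i : cons_abs (with_consensus p (w + d *: v)) i = w + d *: v by exact: att_mulK.
have perp i : dot v (vel p i) = 0 -> cons (with_consensus p (w + d *: v)) i o0 0 = cons p i o0 0.
  move=> vi; rewrite -!dot_vel_cons// hqw hw.
  have -> : dot (vel p i) w = dot (vel p i) w + d * dot v (vel p i) by rewrite vi mulr0 addr0.
  by rewrite /= !dotE !(mxDE, mxZE); ring.
exists (w + d *: v); split; [|exact: hqw|exact: perp|exact: perp|].
- split=> [i i'|i]; first by rewrite subrr normr0.
  rewrite /= -(att_trmulK i (cons p i) hp) -/(cons_abs p i) hw -mulmxBr opprD addNKr.
  apply: (le_lt_trans (SO3_trmul_norm _ (hp i))).
  have hd : d * (3 * `|v| + 1) = e by rewrite /d divfK// gt_eqF// ltr_wpDl// mulr_ge0.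
  have : `|- (d *: v)| <= d * `|v|.
    rewrite normrN; apply: mx_norm_le => [|i' j']; first by rewrite mulr_ge0// ltW.
    by rewrite mxZE normrM (gtr0_norm d0) ler_wpM2l ?(ltW d0)// mx_norm_ge.
  by lra.
- have vw : dot v w = 0.
    have -> : dot v w = a * dot v (vel p k) by rewrite wa !dotE !mxZE; ring.
    by rewrite vk mulr0.
  have -> : dot (w + d *: v) (w + d *: v) = dot w w + 2 * d * dot v w + d ^+ 2 * dot v v.
    by rewrite !dotE !(mxDE, mxZE); ring.
  by rewrite vw mulr0 addr0 ltrDl mulr_gt0 ?exprn_gt0// dot_gt0.
Qed.

(** If two velocities differ at [p], their cosine is a constant below 1 on the limit set. After
    tilting the common consensus vector, neither velocity is along its opposite, so both turn to it
    and their cosine tends to 1. This also covers [w = 0], where the tilt itself creates the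
    attracting direction. *)
Lemma unstable_not_parallel t0 s : 0 <= t0 -> solution A t0 +oo%E s ->
  ~ (limit_set s `<=` E0_Cb A t0) -> unstable (@attitude_close R N) A t0 (limit_set s).
Proof.
move=> t00 hs hE hst; apply: hE => p hp.
have hr : rotations p by case: hp.
apply: (limit_set_E0P t00 hs hp) => k j; apply/eqP/negPn/negP => xy.
have [c0 [L [c [h1 h2 h3 h4]]]] := limit_set_shape t00 hs.
have ckj : c k j < 1.
  have : vel p k - vel p j != 0 by rewrite subr_eq0.
  by move=> /dot_gt0; rewrite dotBB !dot_vel// -rel_att_dot h4//; lra.
have [|V [Vo MV] hV] := hst [set q | rel_att q k j 0 0 < (1 + c k j) / 2].
  by split; [exact: open_rel_att_lt|move=> q hq /=; rewrite h4//; lra].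
have [e e0 he] := Vo p (MV p hp).
have hw i : cons_abs p i = cons_abs p k by exact: (limit_set_consensus t00 hs hp).
have [w' [wc ww wk wj wlt]] := tilt j hr hw (cons_e1_abs (h3 p hp k)) e0.
have [s' [hs' s'0]] := solution_exists hA (p0 := with_consensus p w') t00 hr.
have sq i : cons p i o0 0 ^+ 2 = dot (cons_abs p k) (cons_abs p k).
  by rewrite (cons_e1_abs (h3 p hp k)) dotZ dot_vel// mulr1 -expr2 h3// mxZE e1E mulr1 !h1.
have [||||T t0T hT] := @vel_align t0 s' w' k j t00 hs' _ _ _ ((1 - c k j) / 2).
- by move=> i; rewrite s'0 ww.
- by rewrite s'0 wk sq.
- by rewrite s'0 wj sq.
- by rewrite divr_gt0// subr_gt0.
have := hV s' hs' _ T t0T; rewrite s'0 => /(_ (he _ wc)) /=.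
by have := hT T (lexx T); rewrite ltr_norml => /andP[h _]; lra.
Qed.

(** The image of [e_1] is moved along a circle with rational parametrization [C], [S], where [h] is
    the tangent of half the angle; a nonzero [h] below 1 avoids the angles 0 and pi. *)
Lemma rotation_near (P : 'M[R]_3) e : SO3 P -> 0 < e ->
  exists Q, [/\ SO3 Q, dot (Q *m e1 R) (P *m e1 R) ^+ 2 < 1 & `|P - Q| <= e].
Proof.
(* [rotation_to] is applied with distance [6 h]: it requires [6 h <= 1] and costs
   [144 * 6 h <= e]. *)
move=> hP e0; pose h := Num.min (1 / 6) (e / 144 / 6).
have hgt0 : 0 < h by rewrite lt_min divr_gt0//= divr_gt0// divr_gt0.
have h6 : h <= 1 / 6 by rewrite ge_min lexx.
have he6 : h <= e / 144 / 6 by rewrite ge_min lexx orbT.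
pose D := 1 + h ^+ 2; have D0 : 0 < D by rewrite ltr_wpDr// sqr_ge0.
pose C := (1 - h ^+ 2) / D; pose S := 2 * h / D.
have CS : C ^+ 2 + S ^+ 2 = 1 by rewrite /C /S /D; field; rewrite gt_eqF.
have C1 : 1 - C = h * S by rewrite /C /S /D; field; rewrite gt_eqF.
have S0 : 0 < S by rewrite divr_gt0// mulr_gt0.
have S2 : S <= 2 * h.
  by rewrite ler_pdivrMr// ler_peMr ?mulr_ge0 ?(ltW hgt0)// lerDl sqr_ge0.
have C2 : C ^+ 2 < 1 by rewrite -CS ltrDl exprn_gt0.
pose y : 'cV[R]_3 := \col_i (if i == o0 then C else if i == o1 then S else 0).
have yE : (y o0 0 = C) * (y o1 0 = S) * (y o2 0 = 0).
  by rewrite !mxE !ord3_neq !eqxx.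
have [Q [hQ Qe Qd]] : exists Q, [/\ SO3 Q, Q *m e1 R = P *m y & `|Q - P| <= 144 * (6 * h)].
  apply: rotation_to => //.
  - by rewrite dot_mul ?SO3_trmul// dotE !yE -CS; ring.
  - rewrite -mulmxBr; apply: (le_trans (SO3_mul_norm _ hP)).
    have -> : 6 * h = 3 * (2 * h) by ring.
    rewrite ler_wpM2l//; apply: mx_norm_le => [|i i']; first by rewrite mulr_ge0// ltW.
    rewrite (ord1 i') mxBE; move: i; apply: ord3P; rewrite e1E yE.
    + rewrite C1 (ger0_norm (mulr_ge0 (ltW hgt0) (ltW S0))).
      by apply: le_trans S2; rewrite ler_piMl ?(ltW S0)//; lra.
    + by rewrite sub0r normrN gtr0_norm.
    + by rewrite subr0 normr0 mulr_ge0// ltW.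
  - by lra.
exists Q; split=> //; last by rewrite distrC (le_trans Qd)//; lra.
by rewrite Qe dot_mul ?SO3_trmul// (_ : dot y (e1 R) = C)// dotE !yE !e1E; ring.
Qed.

(** Within parallel motions the common [beta] is then negative or zero. If negative, a tilt makes
    the first component of [b_k] tend to a positive limit. If zero, one frame [k] is turned slightly
    and all [w_i] are set to [- d x]: another agent [j] keeps its velocity [x], exactly against the
    consensus vector, while agent [k] turns to [- x], and their cosine goes from near 1 to -1. *)
Lemma unstable_not_heading t0 s : 0 <= t0 -> (1 < N)%N -> solution A t0 +oo%E s ->
  ~ (limit_set s `<=` @heading R N) -> unstable (@attitude_close R N) A t0 (limit_set s).
Proof.
move=> t00 N1 hs hE.
have [hE0|] := pselect (limit_set s `<=` E0_Cb A t0); last exact: unstable_not_parallel.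
move=> hst; apply: hE => p hp k.
have hr : rotations p by case: hp.
have [c0 [L [c [h1 h2 h3 h4]]]] := limit_set_shape t00 hs.
have aL i : cons p i o0 0 = L i by rewrite h3// mxZE e1E mulr1.
have hw i : cons_abs p i = cons_abs p k by exact: (limit_set_consensus t00 hs hp).
rewrite dot_vel_cons// aL ltNge; apply/negP; rewrite le_eqVlt => /orP[/eqP Lk0|Lk0]; last first.
  have [|V [Vo MV] hV] := hst [set q | cons q k o0 0 < 0].
    by split; [exact: open_cons_lt|move=> q hq /=; rewrite h3// mxZE e1E mulr1].
  have [e e0 he] := Vo p (MV p hp).
  have [w' [wc ww wk _ wlt]] := tilt k hr hw (cons_e1_abs (h3 p hp k)) e0.
  have [s' [hs' s'0]] := solution_exists hA (p0 := with_consensus p w') t00 hr.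
  have [||M [M0 _ hM]] := @heading_unstable t0 s' w' k t00 hs'.
  - by move=> i; rewrite s'0 ww.
  - rewrite s'0 wk; apply: le_lt_trans wlt.
    by rewrite (cons_e1_abs (h3 p hp k)) dotZ dot_vel// mulr1 -expr2 aL.
  have [T t0T hT] := hM _ M0.
  have := hV s' hs' _ T t0T; rewrite s'0 => /(_ (he _ wc)) /=.
  have := hT T (lexx T); rewrite normr_id => /(le_lt_trans (mx_norm_ge _ o0 0)).
  by rewrite mxBE mxZE e1E mulr1 ltr_norml => /andP[h _]; lra.
have [_ _ _ hv] : [/\ rotations p, forall k, control p k = 0,
    forall k j, cons_abs p k = cons_abs p j & forall k j, vel p k = vel p j].
  by apply/(E0_CbP hA p t00); exact: hE0.
have L0 i : L i = 0 by apply/eqP; rewrite -sqrf_eq0 h1 -(h1 k) Lk0 expr0n.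
have p0 i : cons p i = 0 by rewrite h3// L0 scale0r.
have [j jk] : exists j : 'I_N, j != k.
  have : [exists j : 'I_N, j != k].
    apply: contraT; rewrite negb_exists => /forallP h.
    have : (#|[set: 'I_N]%SET| <= 1)%N.
      rewrite (_ : [set: 'I_N] = [set k])%SET ?cards1//.
      apply/finset.setP => i; rewrite finset.inE; apply/esym/finset.set1P/eqP.
      by have := h i; rewrite negbK.
    by rewrite cardsT card_ord leqNgt N1.
  by move=> /existsP.
have ckj : c k j = 1 by rewrite -(h4 p hp) rel_att_dot (hv k j) dot_vel.
have [|V [Vo MV] hV] := hst [set q | 0 < rel_att q k j 0 0].
  by split; [exact: open_rel_att_gt|move=> q hq /=; rewrite h4// ckj].
have [e e0 he] := Vo p (MV p hp).
(* Seven exceeds the total factor 6 of [rel_att_diff]; likewise 4 in [d] exceeds the factor 3 for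
   the body-frame vectors. *)
have e60 : 0 < e / 7 by rewrite divr_gt0.
have [Q [hQ C2 Qd]] := rotation_near (hr k) e60.
pose d := e / 4; have d0 : 0 < d by rewrite divr_gt0.
pose x := vel p k.
have xx : dot x x = 1 by exact: dot_vel.
pose q := with_consensus (State (pos p) (fun i => if i == k then Q else att p i) (cons p))
  (- d *: x).
have hq : rotations q by move=> i /=; case: eqP.
have qw i : cons_abs q i = - d *: x by exact: att_mulK.
have wd : dot (- d *: x) (- d *: x) = d ^+ 2 by rewrite dotZ xx mulr1 mulrNN expr2.
have x1 : `|x| <= 1 by exact: vel_norm_le.
have dist i : `|att p i - att q i| <= e / 7.
  by rewrite /=; case: eqP => [->//|_]; rewrite subrr normr0 ltW.
have pq : attitude_close e p q.
  split=> [i i'|i].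
    apply: (le_lt_trans (rel_att_diff i i' hr hq)).
    by have := dist i; have := dist i'; lra.
  rewrite p0 sub0r normrN /=; apply: (le_lt_trans (SO3_trmul_norm _ (hq i))).
  have : `|- d *: x| <= d.
    apply: mx_norm_le => [|i' j']; first exact: ltW.
    rewrite mxZE normrM normrN (gtr0_norm d0) ler_piMr ?(ltW d0)//.
    exact: le_trans (mx_norm_ge _ _ _) x1.
  by rewrite /d; lra.
have velk : vel q k = Q *m e1 R by rewrite /vel /= eqxx.
have velj : vel q j = x by rewrite /vel /= (negbTE jk) -/(vel p j) (hv j k).
have [s' [hs' s'0]] := solution_exists hA (p0 := q) t00 hq.
have sw i : cons_abs (s' t0) i = - d *: x by rewrite s'0 qw.
have [|M [M0 M2 hM]] := @heading_unstable t0 s' (- d *: x) k t00 hs' sw.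
  rewrite s'0 -dot_vel_cons// qw velk -[Q *m e1 R]scale1r dotZ mul1r wd exprMn sqrrN.
  by rewrite -[ltRHS]mulr1 ltr_pM2l// exprn_gt0.
have consj t : t0 <= t -> cons (s' t) j = - d *: e1 R.
  apply: (cons_e1_invariant t00 hs' sw).
  by rewrite s'0 /= (negbTE jk) -scalemxAr /x (hv k j) att_trmulK.
have hj : vanishes t0 (fun t => `|cons (s' t) j - - d *: e1 R|).
  by move=> e' e'0; exists t0 => // t /consj ->; rewrite subrr !normr0.
have hwv i : vanishes t0 (fun t => `|cons_abs (s' t) i - - d *: x|).
  move=> e' e'0; exists t0 => // t t0t.
  by rewrite (consensus_constant hA t00 hs' sw)// subrr !normr0.
have Md : M = d by apply/eqP; rewrite -(@eqrXn2 _ 2)// ?(ltW M0) ?(ltW d0)// M2 wd.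
have d20 : 0 < d ^+ 2 by rewrite exprn_gt0.
have [T t0T hT] := vel_dot_limit t00 hs' hwv hM hj d20.
have := hV s' hs' _ T t0T; rewrite s'0 => /(_ (he _ pq)) /=.
move=> hpos; have := hT T (lexx T); rewrite wd Md ltr_norml => /andP[].
have -> : d * - d * rel_att (s' T) k j 0 0 - d ^+ 2 = - (d ^+ 2 * rel_att (s' T) k j 0 0) - d ^+ 2.
  by ring.
by have := mulr_gt0 d20 hpos; lra.
Qed.

End Instability.

(** * Symmetries of the closed loop, and assembly of the theorem *)

Section Invariance.
Variables (R : realType) (N : nat).
Implicit Types (A : R -> 'M[R]_N) (s : R -> state R N) (p q : state R N).

Lemma solution_restrict A t0 (tau : \bar R) s : solution A t0 +oo%E s -> solution A t0 tau s.
Proof.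
move=> [h1 h2 h3]; have sub t : (t%:E < tau)%E -> (t%:E < +oo)%E by move=> _; exact: ltry.
split.
- by move=> t [t0t /sub tt]; exact: h1.
- by move=> k; have [c1 c2 c3] := h2 k; split; [apply: continuous_subspaceW c1|
    apply: continuous_subspaceW c2|apply: continuous_subspaceW c3] => t [t0t /sub tt].
- by move=> t [t0t /sub tt]; exact: h3.
Qed.

(** The attitudes enter the consensus coupling only through [R_k^T R_j], in which a common left
    factor cancels. *)
Lemma field_rigid_act A t Q (c : 'cV[R]_3) p : SO3 Q ->
  field A t (rigid_act Q c p) = rigid_act Q 0 (field A t p).
Proof.
move=> hQ; apply: stateP => k /=.
- by rewrite /vel /= mulmxA addr0.
- by rewrite mulmxA.
- congr (_ - _); apply: eq_bigr => j _; congr (_ *: (_ *m _)).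
  by rewrite trmx_mul -mulmxA (mulmxA Q^T) SO3_trmul// mul1mx.
Qed.

Lemma cons_abs_shift_act (c : 'cV[R]_3) p k : rotations p ->
  cons_abs (shift_act c p) k = cons_abs p k + c.
Proof. by move=> hp; rewrite /cons_abs /= mulmxDr att_mulK. Qed.

Lemma cons_abs_field_shift_act A t (c : 'cV[R]_3) p k : rotations p -> A t k k = 0 ->
  cons_abs_field A t (shift_act c p) k = cons_abs_field A t p k.
Proof.
move=> hp Ak; rewrite !cons_abs_fieldE//; apply: eq_bigr => j _.
by rewrite !cons_abs_shift_act// opprD addrACA subrr addr0.
Qed.

End Invariance.

Unset Implicit Arguments.

Theorem theorem6 (R : realType) (N : nat) (eta gamma : R) (A : R -> 'M[R]_N)
  (hA : communication_graph eta gamma A)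
  (hconn : uniformly_connected eta A)
  (hLpc : forall k j, piecewise_continuous (fun t => laplacian (A t) k j))
  (hLb : forall k j, bounded_forward (fun t => laplacian (A t) k j)) :
  (* invariance under SE(3) *)
  (forall (t : R) (Q : 'M[R]_3) (c : 'cV[R]_3) (p : state R N), 0 <= t -> SO3 Q ->
     field A t (rigid_act Q c p) = rigid_act Q 0 (field A t p)) /\
  (* invariance under R^3 *)
  (forall (t : R) (c : 'cV[R]_3) (p : state R N), 0 <= t -> rotations p ->
     forall k, cons_abs (shift_act c p) k = cons_abs p k + c /\
               cons_abs_field A t (shift_act c p) k = cons_abs_field A t p k) /\
  forall t0 : R, 0 <= t0 ->
  [/\ (* existence on [t0, +oo), and no other solutions *)
      forall p0 : state R N, rotations p0 ->
        exists s, [/\ solution A t0 +oo%E s, s t0 = p0 &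
          forall tau s', solution A t0 tau s' -> s' t0 = p0 ->
          forall t : R, t0 <= t -> (t%:E < tau)%E -> s' t = s t],
      (* convergence *)
      forall s : R -> state R N, solution A t0 +oo%E s ->
        converges_to (@state_close R N) s (Sigma0_Cb A t0),
      (* asymptotic stability of parallel motions *)
      asymptotically_stable (@shape_close R N) A t0
        (E0_Cb A t0 `&` @heading R N),
      (* instability of every other limit set *)
      forall s : R -> state R N, solution A t0 +oo%E s ->
        ~ (limit_set s `<=` E0_Cb A t0) ->
        unstable (@attitude_close R N) A t0 (limit_set s)
    & (* including the parallel motions not heading along the consensus vector *)
      forall s : R -> state R N, (1 < N)%N -> solution A t0 +oo%E s ->
        ~ (limit_set s `<=` @heading R N) ->
        unstable (@attitude_close R N) A t0 (limit_set s)].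
Proof.
split; [|split].
- by move=> t Q c p _; exact: field_rigid_act.
- move=> t c p t_ge0 hp k; split; first exact: cons_abs_shift_act.
  by apply: cons_abs_field_shift_act => //; rewrite (weight_diag hA).
move=> t0 t00; split.
- move=> p0 hp0; have [s [hs s0]] := solution_exists hA t00 hp0.
  exists s; split=> // tau s' hs' s'0 t t0t ttau.
  by apply: (solution_unique hA t00 t0t ttau hs' (solution_restrict tau hs)); rewrite s'0 s0.
- by move=> s; exact: converges_to_Sigma0_Cb hA hconn _ _ t00.
- by split; [exact: stable_parallel hA hconn _ t00|exact: attractive_parallel hA hconn _ t00].
- by move=> s; exact: unstable_not_parallel hA hconn _ _ t00.
- by move=> s; exact: unstable_not_heading hA hconn _ _ t00.
Qed.
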